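(* Let $\mu$ be a Thoma measure. The function $\tilde\phi^\mu$ on $G^E$ is a spherical function of the pair $(G^E,K^E)$ if and only if $$\frac{\mu(x)}{|x|}\in 2\mathbb Z_+$$ for every $x\in[-1,0)$.
   Context: A bijection of $\mathbb Z$ is finite if it moves only finitely many integers. $G^E$ is the group of finite bijections $g:\mathbb Z\to\mathbb Z$ with $g(0)=0$, and $K^E=\{g\in G^E:g(-i)=-g(i)\ \forall i\}$. $S(\infty)\subset G^E$ denotes the subgroup of elements fixing all negative integers (i.e. finite permutations of $\{1,2,\dots\}$). $\mathbb Z_+=\{0,1,2,\dots\}$. A spherical representation of $(G^E,K^E)$ is an irreducible unitary representation $\pi$ of $G^E$ having a nonzero $K^E$-invariant vector; such a vector is unique up to a scalar factor. A spherical function is a function of the form $g\mapsto(\pi(g)\xi,\xi)$, where $\pi$ is a spherical representation and $\xi$ is a $K^E$-invariant unit vector. A Thoma measure is a discrete (purely atomic) probability measure $\mu$ on $[-1,1]$ such that $\mu(x)/|x|\in\mathbb Z_+$ for all $x\ne0$, where $\mu(x)=\mu(\{x\})$. For a Thoma measure $\mu$ define a function on $S(\infty)$ by $$\phi^\mu(\sigma)=\prod_{k\in[\sigma]}\int_{[-1,1]}t^{k-1}\,\mu(dt),$$ where $[\sigma]$ is the multiset of lengths of nontrivial cycles of $\sigma$. One has $G^E=K^E\,S(\infty)\,K^E$, and for each $g\in S(\infty)$ the intersection $S(\infty)\cap K^EgK^E$ is the conjugacy class of $g$ in $S(\infty)$; hence $\phi^\mu$ has a unique $K^E$-biinvariant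 extension to $G^E$, denoted $\tilde\phi^\mu$. *)

(* Defs.v *)
From HB Require Import structures.
From mathcomp Require Import all_boot all_order all_algebra.
From mathcomp Require Import finmap complex.
From mathcomp Require Import all_classical all_reals all_analysis.

Set Implicit Arguments.
Unset Strict Implicit.
Unset Printing Implicit Defensive.

Import Order.TTheory GRing.Theory Num.Theory.
Import numFieldNormedType.Exports.

Local Open Scope classical_set_scope.
Local Open Scope ring_scope.
Local Open Scope complex_scope.

(* The inner product is linear in its first argument. *)
Record hilbertType (R : realType) := Hilbert {
  hilbert_sort :> completeNormedModType R[i];
  inner : {dot hilbert_sort for Num.conj};
  inner_norm : forall v : hilbert_sort, `|v| ^+ 2 = inner v v }.

Record unitary_rep (R : realType) (G : groupType) (H : hilbertType R) :=
  UnitaryRep {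
    rep :> G -> {linear H -> H};
    rep1 : forall v, rep 1%g v = v;
    repM : forall g h v, rep (g * h)%g v = rep g (rep h v);
    rep_inner : forall g u v, inner H (rep g u) (rep g v) = inner H u v }.

Definition irreducible_rep (R : realType) (G : groupType) (H : hilbertType R)
    (pi : unitary_rep G H) : Prop :=
  (exists v : H, v != 0) /\
  forall V : set H,
    closed V -> GRing.submod_closed (mem V) ->
    (forall g v, V v -> V (pi g v)) ->
    V = [set 0] \/ V = setT.

Definition invariant_vector (R : realType) (G : groupType) (H : hilbertType R)
    (pi : unitary_rep G H) (K : set G) (v : H) : Prop :=
  forall k, K k -> pi k v = v.

Definition spherical_rep (R : realType) (G : groupType) (H : hilbertType R)
    (pi : unitary_rep G H) (K : set G) : Prop :=
  irreducible_rep pi /\ exists2 v : H, v != 0 & invariant_vector pi K v.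

Definition spherical_function (R : realType) (G : groupType) (K : set G)
    (f : G -> R[i]) : Prop :=
  exists (H : hilbertType R) (pi : unitary_rep G H) (xi : H),
    [/\ spherical_rep pi K, invariant_vector pi K xi, `|xi| = 1 &
        forall g, f g = inner H (pi g xi) xi].

Definition biinvariant (T : Type) (G : groupType) (K : set G) (f : G -> T) :
    Prop :=
  forall k1 g k2, K k1 -> K k2 -> f (k1 * g * k2)%g = f g.

Definition finite_bijection0 (g : int -> int) : Prop :=
  [/\ bijective g, finite_set [set i | g i <> i] & g 0 = 0].

Lemma finite_bijection0_id : finite_bijection0 id.
Proof.
split => //; first by exists id.
by rewrite (_ : [set _ | _] = set0)// -subset0 => i /=.
Qed.

Lemma finite_bijection0_comp g h :
  finite_bijection0 g -> finite_bijection0 h -> finite_bijection0 (g \o h).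
Proof.
move=> [bg fg g0] [bh fh h0]; split; [exact: bij_comp | | by rewrite /= h0].
apply: (@sub_finite_set _ _ ([set i | g i <> i] `|` [set i | h i <> i])).
  move=> i /= ghi; have [hi|] := pselect (h i = i); last by right.
  by left; rewrite hi in ghi.
by rewrite finite_setU.
Qed.

Lemma finite_bijection0_inv g : finite_bijection0 g ->
  exists2 h, finite_bijection0 h & cancel g h /\ cancel h g.
Proof.
move=> [[h gK hK] fg g0]; exists h => //; split; first by exists g.
  apply: sub_finite_set fg => i /= hi gi; apply: hi.
  by rewrite -{1}gi gK.
by rewrite -g0 gK.
Qed.

Record GE := MkGE {
  GE_fun :> int -> int;
  _ : `[< finite_bijection0 GE_fun >] }.

HB.instance Definition _ := [isSub for GE_fun].
HB.instance Definition _ := [Choice of GE by <:].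

Lemma GEP (g : GE) : finite_bijection0 g.
Proof. by apply/asboolP; case: g. Qed.

Definition GE_of g (gP : finite_bijection0 g) : GE := MkGE (asboolT gP).

Definition GE_one : GE := GE_of finite_bijection0_id.

Definition GE_mul (g h : GE) : GE :=
  GE_of (finite_bijection0_comp (GEP g) (GEP h)).

Definition GE_inv (g : GE) : GE :=
  GE_of (s2valP (cid2 (finite_bijection0_inv (GEP g)))).

Lemma GE_mulA : associative GE_mul.
Proof. by move=> g h k; apply: val_inj. Qed.

Lemma GE_mul1 : left_id GE_one GE_mul.
Proof. by move=> g; apply: val_inj. Qed.

Lemma GE_mulr1 : right_id GE_one GE_mul.
Proof. by move=> g; apply: val_inj. Qed.

Lemma GE_mulV : left_inverse GE_one GE_inv GE_mul.
Proof.
move=> g; apply: val_inj; apply/funext => i /=.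
by case: cid2 => h /= _ [gK _]; rewrite gK.
Qed.

Lemma GE_mulrV : right_inverse GE_one GE_inv GE_mul.
Proof.
move=> g; apply: val_inj; apply/funext => i /=.
by case: cid2 => h /= _ [_ hK]; rewrite hK.
Qed.

HB.instance Definition _ :=
  isGroup.Build GE GE_mulA GE_mul1 GE_mulr1 GE_mulV GE_mulrV.

Definition KE : set GE := [set g | forall i, g (- i) = - g i].

Definition Sinfty : set GE := [set g | forall i, i < 0 -> g i = i].

Definition thoma_measure (R : realType)
    (mu : probability (measurableTypeR R) R) : Prop :=
  [/\ mu `[-1, 1]%classic = 1%E,
      (exists2 A : set R, countable A & mu A = 1%E) &
      forall x : R, -1 <= x <= 1 -> x != 0 ->
        exists n : nat, fine (mu [set x]) / `|x| = n%:R].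

(* For a permutation of finite order, the cycle through i is its forward
   orbit. *)
Definition cycle_of (s : int -> int) (i : int) : set int :=
  [set iter n s i | n in [set: nat]].

Definition nontrivial_cycles (s : int -> int) : set (set int) :=
  [set cycle_of s i | i in [set i | s i <> i]].

Definition thoma_character (R : realType)
    (mu : probability (measurableTypeR R) R) (s : GE) : R :=
  \big[*%R/1]_(C \in nontrivial_cycles s)
    (\int[mu]_(t in `[-1, 1]) t ^+ (#|` fset_set C|%fset - 1)%N).

(* G^E = K^E S(oo) K^E, and each double coset meets S(oo) in one conjugacy
   class of S(oo), so this set is a singleton and the default is not used. *)
Definition thoma_extension (R : realType)
    (mu : probability (measurableTypeR R) R) : GE -> R :=
  xget (fun=> 0)
    [set f | biinvariant KE f /\
             forall s, Sinfty s -> f s = thoma_character mu s].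

(* Main.v *)
From HB Require Import structures.
Require Import Defs.
From mathcomp Require Import all_boot all_order all_fingroup all_algebra.
From mathcomp Require boolp.

(** For the "if" part, a positive atom x of mass n x is n colours of size x and
    a negative atom x of mass -2 n x is n pairs of opposite colours whose
    transposition carries a sign.  The part of the mass at 0 or in the tail of
    small atoms is approximated by many small colours.  A finite list of colours
    turns g into the signed weight of the colourings compatible with two perfect
    matchings of the nonzero integers, namely i <-> -i and its conjugate by g;
    this is a Gram matrix, so the extension of the character is a limit of
    positive definite functions.  The GNS vector is cyclic, and moving finite
    supports to infinity by elements of K^E makes the function asymptotically
    multiplicative, whence irreducibility.

    For the "only if" part, let x < 0 be an atom of mass w.  To the spherical
    vector apply, for every i <= N, linear factors a + b (i m) with fresh indices
    m: each index i gets weighted by a polynomial p.  For two disjoint families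
    of fresh indices, the matrix coefficient of the two resulting vectors at
    g = k1 s k2 is the product over the cycles of s, of length r, of the integral
    of t^(r-1) p(t)^(2r).  Averaging over all permutations g of -N, ..., -1,
    1, ..., N, and using arbitrarily many disjoint families, shows that the sum of
    this coefficient over g is nonnegative.  When p is peaked at x, normalising
    turns the coefficient into (x/w)^(N - number of cycles), whose sum is the
    product of the (2n+2)(1 + 2n x/w) for n < N.  Its nonnegativity for all N
    forces w/|x| to be even. *)

Set Implicit Arguments.
Unset Strict Implicit.
Unset Printing Implicit Defensive.

Import Order.TTheory GRing.Theory Num.Theory.

(** * Permutations of signed points *)

Section SignedPermutations.
Local Open Scope group_scope.
Variable I : finType.
Implicit Types (A B : {set I}) (s t : {perm I}) (k g : {perm I * bool}).

(** Two obstacles shape the proof. A matching exchanges the two colours of an opposite pair, so it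
    has no sign of its own: only a product of two compatible matchings preserves one half of the
    points with such colours. The signed kernel becomes a Gram kernel by comparing every matching
    with one reference matching chosen for each colouring. In the converse, all atoms contribute to
    each moment, and a single one must be isolated from inside the representation. Multiplying by
    the transposition of [y] with a fresh index lengthens the cycle through [y] by one, which puts
    one more factor t under its integral; combinations of such products therefore multiply the
    integrand by a polynomial. If the two vectors of a coefficient shared fresh indices, their
    transpositions would interact and the product over cycles would be lost. So only inner products
    of differently dressed vectors are computed, and their sign comes from having unboundedly many
    vectors of bounded norm with the same pairwise inner product, which cannot then be negative. *)

Definition opp (x : I * bool) := (x.1, ~~ x.2).

Lemma oppK : involutive opp.
Proof. by case=> i b; rewrite /opp /= negbK. Qed.

Lemma opp_neq x : opp x != x.
Proof. by case: x => i [] /=; apply/eqP => -[]. Qed.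

Definition oppp : {perm I * bool} := perm (inv_inj oppK).

Lemma opppE x : oppp x = opp x. Proof. exact: permE. Qed.

Lemma opppV : oppp^-1 = oppp.
Proof.
apply/permP => x; apply: (@perm_inj _ oppp).
by rewrite permKV !opppE oppK.
Qed.

Definition hyper := 'C[oppp].

Lemma hyperP k : reflect (forall x, k (opp x) = opp (k x)) (k \in hyper).
Proof.
apply: (iffP cent1P) => [kC x|kC].
  by move/permP: kC => /(_ x); rewrite !permM !opppE.
by apply/permP => x; rewrite !permM !opppE kC.
Qed.

Lemma hyperJ k : (k \in hyper) = (k ^ oppp == k).
Proof.
rewrite conjgE; apply/cent1P/eqP => [->|/(canRL (mulKg _))]; first by rewrite mulKg.
by rewrite invgK.
Qed.

Lemma hyper_flip i : tperm (i, true) (i, false) \in hyper.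
Proof. by rewrite hyperJ tpermJ !opppE tpermC. Qed.

Lemma tperm_mul (T : finType) (x y : T) (g : {perm T}) :
  tperm x y * g = g * tperm (g x) (g y).
Proof. by rewrite -tpermJ conjgC. Qed.

Lemma mul_tperm (T : finType) (x y : T) (g : {perm T}) :
  g * tperm x y = tperm (g^-1 x) (g^-1 y) * g.
Proof. by rewrite tperm_mul !permKV. Qed.

Lemma hyper_tperm2 x y : x.1 != y.1 ->
  tperm x y * tperm (opp x) (opp y) \in hyper.
Proof.
move=> xy; rewrite hyperJ conjMg !tpermJ !opppE !oppK tperm_mul.
have xy' : x != opp y by apply: contraNneq xy => ->.
have yx' : y != opp x by rewrite eq_sym; apply: contraNneq xy => <-.
by rewrite [tperm _ _ x]tpermD 1?[tperm _ _ y]tpermD ?opp_neq 1?eq_sym.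
Qed.

Definition pos_fun s (x : I * bool) := if x.2 then (s x.1, true) else x.

Lemma pos_fun_inj s : injective (pos_fun s).
Proof. by move=> [i []] [j []] //= [/perm_inj] ->. Qed.

Definition pos s : {perm I * bool} := perm (@pos_fun_inj s).

Lemma posT s i : pos s (i, true) = (s i, true). Proof. by rewrite permE. Qed.

Lemma posF s i : pos s (i, false) = (i, false). Proof. by rewrite permE. Qed.

Lemma posM s t : pos (s * t) = pos s * pos t.
Proof.
by apply/permP => -[i []]; rewrite permM ?posT ?posF ?permM.
Qed.

Lemma pos1 : pos 1 = 1.
Proof. by apply/permP => -[i []]; rewrite ?posT ?posF ?perm1. Qed.

Lemma posV s : pos s^-1 = (pos s)^-1.
Proof. by apply/eqP; rewrite eq_sym eq_invg_mul -posM mulgV pos1. Qed.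

Lemma pos_tperm i j : pos (tperm i j) = tperm (i, true) (j, true).
Proof.
apply/permP => -[l []].
  rewrite posT; case: tpermP => [->|->|/eqP li /eqP lj]; rewrite ?(tpermL, tpermR) //.
  by rewrite tpermD // xpair_eqE negb_and eq_sym ?li ?lj.
by rewrite posF tpermD // xpair_eqE andbF.
Qed.

Definition signed A : {set I * bool} := [set x | x.1 \in A].

Lemma mem_signed A i b : ((i, b) \in signed A) = (i \in A).
Proof. by rewrite inE. Qed.

Lemma perm_on_tperm (T : finType) (B : {set T}) (x y : T) :
  x \in B -> y \in B -> perm_on B (tperm x y).
Proof.
move=> xB yB; apply: (subset_trans (tperm_on x y)).
by apply/subsetP => z; rewrite !inE => /orP[]/eqP->.
Qed.

Lemma perm_on_sub (T : finType) (B C : {set T}) (g : {perm T}) :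
  B \subset C -> perm_on B g -> perm_on C g.
Proof. by move=> BC gB; apply: subset_trans BC. Qed.

Lemma signedS A B : A \subset B -> signed A \subset signed B.
Proof. by move=> /subsetP AB; apply/subsetP => -[i b]; rewrite !inE => /AB. Qed.

Lemma hyper_transitive A x y : x \in signed A -> y \in signed A ->
  exists2 k, k \in hyper & perm_on (signed A) k /\ k x = y.
Proof.
case: x y => i b [j c] /=; rewrite !inE /= => iA jA.
have [ij|ij] := eqVneq i j.
  subst j; have [->|bc] := eqVneq b c.
    by exists 1; rewrite ?group1 // perm_on1 perm1.
  exists (tperm (i, true) (i, false)); first exact: hyper_flip.
  split; first by rewrite perm_on_tperm ?inE.
  by case: b c bc => -[] //= _; rewrite ?(tpermL, tpermR).
exists (tperm (i, b) (j, c) * tperm (opp (i, b)) (opp (j, c))).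
  exact: hyper_tperm2.
split; first by rewrite perm_onM ?perm_on_tperm ?inE.
by rewrite permM tpermL tpermD // /opp xpair_eqE /= ?(negPf ij) // eqxx; case: (c).
Qed.

(** Up to the hyperoctahedral group, the transposition inserts [m] into the cycle of [z.1]: just
    after [z.1] if [z] is positive, just before it if [z] is negative. This is why [t] has two
    forms. The explicit [k1] and the support of [k2] serve the later inductions. *)
Lemma insert_hyper s m z : s m = m -> z.1 != m ->
  exists k1 t k2,
  [/\ k1 = 1 \/ k1 = tperm (m, true) (m, false),
      t = tperm m z.1 * s \/ t = s * tperm m z.1,
      k2 \in hyper, perm_on (signed [set m; z.1]) k2 &
      tperm (m, true) z * pos s = k1 * pos t * k2].
Proof.
move=> sm; case: z => i [] /= im.
  exists 1, (tperm m i * s), 1.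
  by rewrite perm_on1 group1 posM pos_tperm mulg1 mul1g; split => //; left.
set f := tperm (m, true) (m, false).
set k := tperm (m, true) (i, true) * tperm (opp (m, true)) (opp (i, true)).
exists f, (s * tperm m i), (k * f); split; [by right|by right| | |].
- by rewrite groupM ?hyper_flip ?hyper_tperm2 // eq_sym.
- by rewrite !perm_onM ?perm_on_tperm ?inE ?eqxx ?orbT.
(* The mixed transposition is conjugate by the flip of [m] to a purely negative one, and both the
   flip and the negative transposition commute with [pos s]. *)
have -> : tperm (m, true) (i, false) = f^-1 * (tperm (m, false) (i, false) * f).
  have fi : f (i, false) = (i, false).
    by rewrite tpermD // xpair_eqE eq_sym (negPf im).
  by rewrite -conjgE tpermJ fi tpermR.
rewrite posM pos_tperm /k /opp /=.
have -> : f^-1 = f by rewrite /f tpermV.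
have fs : f * pos s = pos s * f by rewrite tperm_mul posT posF sm.
set T1 := tperm _ (i, false).
have Ts : T1 * pos s = pos s * T1 by rewrite tperm_mul !posF.
rewrite -!mulgA fs (mulgA T1) Ts; congr (_ * _); rewrite -!mulgA.
by rewrite (mulgA (tperm _ _) (tperm _ _)) tperm2 mul1g.
Qed.

Lemma perm_on_signedD1 A m g : perm_on (signed A) g ->
  (forall b, g (m, b) = (m, b)) -> perm_on (signed (A :\ m)) g.
Proof.
move=> gA gm; apply/subsetP => -[i b] gi; rewrite !inE /=.
have := subsetP gA _ gi; rewrite inE /= => ->; rewrite andbT.
by apply: contraNneq gi => ->; rewrite /= gm.
Qed.

Lemma perm_on_signed_fix A m g b : perm_on (signed A) g -> m \notin A ->
  g (m, b) = (m, b).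
Proof. by move=> gA mA; rewrite (out_perm gA) // inE. Qed.

(** The finite form of G = K S K, with control of supports. Induction removes an index [m]: a
    hyperoctahedral factor makes [(m, false)] fixed, a transposition makes [(m, true)] fixed, and
    once the rest is decomposed [insert_hyper] puts the transposition back. *)
Lemma hyper_pos_hyper A g : perm_on (signed A) g ->
  exists k1 s k2,
  [/\ k1 \in hyper /\ perm_on (signed A) k1, perm_on A s,
      k2 \in hyper /\ perm_on (signed A) k2 & g = k1 * pos s * k2].
Proof.
have [n] := ubnP #|A|; elim: n => // n IHn in A g *; rewrite ltnS => An gA.
have [A0|[m mA]] := set_0Vmem A.
  exists 1, 1, 1; rewrite group1 !perm_on1 pos1 !mulg1; split => //.
  apply/permP => x; rewrite perm1; apply: (out_perm gA).
  by rewrite inE A0 inE.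
have {}An : #|A :\ m| < n by move: An; rewrite (cardsD1 m A) mA.
have AmA : signed (A :\ m) \subset signed A by rewrite signedS ?subD1set.
have gV := perm_onV gA.
have [k kK [kA km]] : exists2 k, k \in hyper &
    perm_on (signed A) k /\ k (m, false) = g^-1 (m, false).
  by apply: hyper_transitive; rewrite ?perm_closed // mem_signed.
set h := k * g.
have hA : perm_on (signed A) h by exact: perm_onM.
have hm : h (m, false) = (m, false) by rewrite permM km permKV.
suff [k1 [s [k2 [[k1K k1A] sA [k2K k2A] hE]]]] : exists k1 s k2,
  [/\ k1 \in hyper /\ perm_on (signed A) k1, perm_on A s,
      k2 \in hyper /\ perm_on (signed A) k2 & h = k1 * pos s * k2].
  exists (k^-1 * k1), s, k2; rewrite groupM ?groupV ?perm_onM ?perm_onV //.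
  by split=> //; rewrite -2!mulgA [k1 * _]mulgA -hE mulKg.
set z := h^-1 (m, true).
have hz : h z = (m, true) by rewrite permKV.
have zA : z \in signed A by rewrite perm_closed ?perm_onV // mem_signed.
have [zm|zm] := eqVneq z (m, true).
  have /IHn : perm_on (signed (A :\ m)) h.
    by apply: perm_on_signedD1 => // -[] //; rewrite -{1}zm.
  move=> /(_ An) [k1 [s [k2 [[k1K k1A] sA [k2K k2A] hE]]]].
  exists k1, s, k2; rewrite k1K k2K !(perm_on_sub AmA) //.
  by rewrite (perm_on_sub (subD1set A m)).
have zm' : z.1 != m.
  apply: contraNneq zm; case: (z) hz => i [] /= hz im; first by rewrite im.
  by move: hz; rewrite im hm.
set g' := tperm (m, true) z * h.
have /IHn : perm_on (signed (A :\ m)) g'.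
  apply: perm_on_signedD1; first by rewrite perm_onM ?perm_on_tperm ?mem_signed.
  case; rewrite permM; first by rewrite tpermL.
  by rewrite tpermD // ?xpair_eqE ?andbF //; apply: contraNneq zm' => ->.
move=> /(_ An) [k1 [s [k2 [[k1K k1A] sA [k2K k2A] gE]]]].
have k1m : k1 (m, true) = (m, true) by rewrite (perm_on_signed_fix _ k1A) ?setD11.
have sm : s m = m by rewrite (out_perm sA) ?setD11.
have k1z : k1 z \in signed (A :\ m) by rewrite perm_closed // !inE zm'; move: zA; rewrite inE.
have k1zm : (k1 z).1 != m by move: k1z; rewrite !inE => /andP[].
have [l1 [s' [l2 [l1E s'E l2K l2A sE]]]] := insert_hyper sm k1zm.
have k1zA : (k1 z).1 \in A by move: k1z; rewrite !inE => /andP[].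
exists (k1 * l1), s', (l2 * k2); split.
- have k1A' := perm_on_sub AmA k1A.
  by case: l1E => ->; rewrite groupM ?group1 ?hyper_flip // perm_onM ?perm_on1
    ?perm_on_tperm ?mem_signed.
- by case: s'E => ->; rewrite perm_onM ?perm_on_tperm ?(perm_on_sub (subD1set A m) sA).
- rewrite groupM // perm_onM // ?(perm_on_sub AmA k2A) //.
  by apply: perm_on_sub l2A; apply/signedS/subsetP => j; rewrite !inE => /orP[]/eqP->.
have -> : h = tperm (m, true) z * g' by rewrite /g' mulgA tperm2 mul1g.
have tE : tperm (m, true) z * k1 = k1 * tperm (m, true) (k1 z).
  by rewrite tperm_mul k1m.
by rewrite gE !mulgA tE -[k1 * _ * pos s]mulgA sE !mulgA.
Qed.

End SignedPermutations.

(** * Sums of biinvariant functions over all permutations of the signed points *)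

Section SumOverPermutations.
Local Open Scope group_scope.

Lemma perm_on_mul_tperm (T : finType) (B : {set T}) (a y : T) (h : {perm T}) :
  a \in B -> y \in B ->
  perm_on B (tperm a y * h) && ((tperm a y * h) y == a) = perm_on (B :\ a) h.
Proof.
move=> aB yB; rewrite permM tpermR; apply/andP/idP => [[thB /eqP ha]|hB].
  have hB : perm_on B h.
    by rewrite -[h]mul1g -(tperm2 a y) -mulgA perm_onM // perm_on_tperm.
  apply/subsetP => x; rewrite !inE => hx; apply/andP; split.
    by apply: contraNneq hx => ->; rewrite ha.
  exact: subsetP hB x hx.
split; last by rewrite (out_perm hB) // !inE eqxx.
by rewrite perm_onM ?perm_on_tperm // (perm_on_sub (subD1set B a)).
Qed.

(** Coset decomposition for the stabiliser of [a]: products act from left to right, so [y] is the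
    point that the permutation sends to [a]. *)
Lemma sum_perm_onD1 (T : finType) (V : nmodType) (B : {set T}) (a : T)
    (G : {perm T} -> V) : a \in B ->
  (\sum_(g | perm_on B g) G g =
   \sum_(y in B) \sum_(g | perm_on (B :\ a) g) G (tperm a y * g)%g)%R.
Proof.
move=> aB; rewrite (partition_big (fun g : {perm T} => g^-1 a) (mem B)) /=.
  apply: eq_bigr => y yB.
  rewrite (reindex_inj (mulgI (tperm a y))) /=; apply: eq_bigl => h.
  rewrite -(perm_on_mul_tperm h aB yB); congr (_ && _).
  by rewrite -(inj_eq (@perm_inj _ (tperm a y * h))) permKV eq_sym.
by move=> g gB; rewrite perm_closed // perm_onV.
Qed.

Lemma sum_perm_on_mul (T : finType) (V : nmodType) (B : {set T}) (h : {perm T})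
    (G : {perm T} -> V) : perm_on B h ->
  (\sum_(g | perm_on B g) G (h * g)%g = \sum_(g | perm_on B g) G g)%R.
Proof.
move=> hB; rewrite [RHS](reindex_inj (mulgI h)); apply: eq_bigl => g.
apply/idP/idP => [gB|hgB]; first exact: perm_onM.
by rewrite -[g](mulKg h) perm_onM // perm_onV.
Qed.

Lemma porbit_fix (T : finType) (s : {perm T}) (m : T) : s m = m ->
  porbit s m = [set m].
Proof.
move=> sm; apply/setP => x; rewrite inE; apply/porbitP/eqP => [[i ->]|->].
  by elim: i => [|i IHi]; rewrite ?perm1 // expgS permM sm.
by exists 0%N; rewrite perm1.
Qed.

(** The singleton orbit of [m] is merged with the orbit of [i]. The second form of [t] reduces to
    the first by inversion, which keeps the orbits. *)
Lemma card_porbits_insert (T : finType) (s t : {perm T}) (m i : T) :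
  s m = m -> i != m -> t = tperm m i * s \/ t = s * tperm m i ->
  #|porbits t|.+1 = #|porbits s|.
Proof.
move=> sm im tE.
wlog {tE} -> : s t sm tE / t = tperm m i * s.
  case: tE => -> IH; first by apply: (IH s _ sm) => //; left.
  rewrite -porbitsV -[in RHS]porbitsV.
  apply: (IH s^-1); first by rewrite -{1}sm permK.
    by left; rewrite invMg tpermV.
  by rewrite invMg tpermV.
have := porbits_mul_tperm s m i; rewrite /= porbit_sym porbit_fix // inE im.
by rewrite eq_sym im /= -addnn addnA !addn1 => -[].
Qed.

Lemma card_porbits1 (T : finType) : #|porbits (1 : {perm T})| = #|T|.
Proof.
rewrite /porbits (eq_imset _ (g := set1)) ?card_imset //; first exact: set1_inj.
by move=> x; rewrite porbit_fix ?perm1.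
Qed.

Lemma card_signed (I : finType) (A : {set I}) : #|signed A| = #|A|.*2.
Proof.
rewrite (_ : signed A = setX A [set: bool]); last first.
  by apply/setP => -[i b]; rewrite !inE andbT.
by rewrite cardsX cardsT card_bool muln2.
Qed.

Section HyperoctahedralSum.
Variables (R : fieldType) (I : finType) (rho : R).
Variable F : {perm I * bool} -> R.
Hypothesis FK : forall k1 g k2, k1 \in hyper I -> k2 \in hyper I ->
  F (k1 * g * k2) = F g.
Implicit Types (A : {set I}) (g : {perm I * bool}).
Hypothesis Fpos : forall s, F (pos s) = (rho ^+ (#|I| - #|porbits s|))%R.

(** In a decomposition of [g] the index [m] is a fixed point of the middle factor; the transposition
    inserts it into a cycle, so one cycle is lost and the exponent of [rho] grows by one. *)
Lemma insert_value A m z g : perm_on (signed A) g -> m \notin A -> z.1 != m ->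
  (F (tperm (m, true) z * g) = rho * F g)%R.
Proof.
move=> /hyper_pos_hyper [k1 [s [k2 [[k1K k1A] sA [k2K k2A] ->]]]] mA zm.
have k1m : k1 (m, true) = (m, true) by rewrite (perm_on_signed_fix _ k1A).
have k1V : (k1^-1) \in hyper I by rewrite groupV.
have k1z : (k1 z).1 != m.
  apply: contraNneq zm; rewrite -{2}[z](permK k1); case: (k1 z) => j b /= ->.
  by rewrite (perm_on_signed_fix _ (perm_onV k1A)).
have sm : s m = m by rewrite (out_perm sA).
have [l1 [s' [l2 [l1E s'E l2K _ sE]]]] := insert_hyper sm k1z.
have l1K : l1 \in hyper I by case: l1E => ->; rewrite ?group1 ?hyper_flip.
rewrite !mulgA tperm_mul k1m -[k1 * _ * pos s]mulgA sE.
have -> : k1 * (l1 * pos s' * l2) * k2 = (k1 * l1) * pos s' * (l2 * k2).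
  by rewrite !mulgA.
rewrite !FK ?groupM // !Fpos -(card_porbits_insert sm k1z s'E) subnS.
have lt : #|porbits s'| < #|I|.
  by rewrite (card_porbits_insert sm k1z s'E) leq_imset_card.
by rewrite -exprS prednK // subn_gt0.
Qed.

(** The two transpositions differ on the left by a double transposition, which is hyperoctahedral; a
    choice for the negative point is thus traded for one for the positive point. *)
Lemma insert_opposite A m y g : m \in A -> y \in signed A ->
  y.1 != m -> (F (tperm (m, false) y * g) = F (tperm (m, true) (opp y) * g))%R.
Proof.
move=> mA yA ym.
have kK := @hyper_tperm2 _ (m, false) y; rewrite eq_sym in kK.
rewrite -(FK (k1 := tperm (m, false) y * tperm (opp (m, false)) (opp y)) (k2 := 1)
  (tperm (m, true) (opp y) * g)) ?group1 ?kK //.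
by rewrite mulg1 -mulgA (mulgA (tperm _ (opp y))) tperm2 mul1g.
Qed.

Local Open Scope ring_scope.

(** Let n + 1 be the cardinal of [A]. Removing [(m, false)] costs a factor 2 (n + 1), since all
    choices of its preimage give the same sum. Removing [(m, true)] then leaves one choice that
    fixes it, with factor 1, and 2 n choices that insert [m] into a cycle, each with factor
    [rho]. *)
Theorem sum_hyper_biinvariant A :
  \sum_(g | perm_on (signed A) g) F g =
  \prod_(n < #|A|) ((n.+1).*2%:R * (1 + n.*2%:R * rho)).
Proof.
have [n] := ubnP #|A|; elim: n => // n IHn in A *; rewrite ltnS => An.
have [->|[m mA]] := set_0Vmem A.
  rewrite cards0 big_ord0 (big_pred1 1%g); last first.
    move=> g; apply/idP/eqP => [gA|->]; last exact: perm_on1.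
    by apply/permP => x; rewrite perm1 (out_perm gA) // !inE.
  by rewrite -pos1 Fpos card_porbits1 subnn.
have Am : #|A| = (#|A :\ m|).+1 by rewrite (cardsD1 m A) mA.
have sigA : signed A :\ (m, false) :\ (m, true) = signed (A :\ m).
  by apply/setP => -[i []]; rewrite !inE !xpair_eqE ?andbT ?andbF.
set B := signed A :\ (m, false).
have bB : (m, true) \in B by rewrite !inE xpair_eqE andbF.
rewrite (sum_perm_onD1 (a := (m, false))) ?mem_signed //.
have -> : \sum_(y in signed A) \sum_(g | perm_on B g) F (tperm (m, false) y * g)%g
        = \sum_(y in signed A) \sum_(g | perm_on B g) F g.
  apply: eq_bigr => y yA.
  have [ym|ym] := eqVneq y.1 m.
    apply: eq_bigr => g _; rewrite -[RHS](FK (k1 := tperm (m, false) y) (k2 := 1%g) g) ?mulg1 ?group1 //.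
    case: y ym {yA} => j [] /= ->; last by rewrite tperm1 group1.
    by rewrite tpermC hyper_flip.
  (* The traded transposition stays inside [B], so a change of variable absorbs it. *)
  rewrite -[RHS](@sum_perm_on_mul _ _ _ (tperm (m, true) (opp y))).
    by apply: eq_bigr => g _; rewrite (insert_opposite (A := A)).
  rewrite perm_on_tperm // !inE xpair_eqE negb_and ym /=.
  by move: yA; rewrite inE.
rewrite sumr_const card_signed.
have -> : \sum_(g | perm_on B g) F g =
   (\sum_(g | perm_on (signed (A :\ m)) g) F g) * (1 + (#|A :\ m|).*2%:R * rho).
  rewrite (sum_perm_onD1 (a := (m, true))) // sigA (bigD1 (m, true)) //=.
  rewrite mulrDr mulr1 tperm1; congr (_ + _).
    by apply: eq_bigr => g _; rewrite mul1g.
  rewrite (eq_bigl (mem (signed (A :\ m)))); last first.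
    by move=> y; rewrite -sigA !inE andbC.
  rewrite (eq_bigr (fun=> rho * \sum_(g | perm_on (signed (A :\ m)) g) F g)).
    by rewrite sumr_const card_signed mulrCA mulr_natl [rho * _]mulrC.
  move=> z; rewrite !inE => /andP[zm _]; rewrite mulr_sumr; apply: eq_bigr => g gA.
  by rewrite (insert_value gA) // setD11.
rewrite IHn; last by rewrite -Am.
by rewrite Am big_ord_recr /= [RHS]mulrCA [RHS]mulr_natl.
Qed.
End HyperoctahedralSum.

End SumOverPermutations.

(** * Products over orbits *)

Section OrbitProducts.
Local Open Scope group_scope.

Lemma porbit_sub (T : finType) (t : {perm T}) (B : {set T}) x :
  (forall y, y \in B -> t y \in B) -> x \in B -> porbit t x \subset B.
Proof.
move=> tB xB; apply/subsetP => _ /porbitP[i ->].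
by elim: i => [|i IHi]; rewrite ?perm1 // expgSr permM tB.
Qed.

Lemma porbit_next (T : finType) (t : {perm T}) x y :
  (t y \in porbit t x) = (y \in porbit t x).
Proof. by rewrite -!eq_porbit_mem (porbit_perm t 1). Qed.

Section Insertion.
Variables (T : finType) (s t : {perm T}) (m i : T).
Hypothesis sm : s m = m.
Hypothesis tE : t = tperm m i * s \/ t = s * tperm m i.

Let O := m |: porbit s i.

Let tperm_in (B : {set T}) y : m \in B -> i \in B -> y \in B -> tperm m i y \in B.
Proof. by move=> mB iB yB; case: tpermP. Qed.

Lemma porbit_insert : porbit t i = O.
Proof.
have mO : m \in O by rewrite setU11.
have iO : i \in O by rewrite setU1r ?porbit_id.
have sO y : y \in O -> s y \in O.
  by rewrite !inE porbit_next => /orP[/eqP->|->]; rewrite ?sm ?eqxx ?orbT.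
apply/eqP; rewrite eqEsubset porbit_sub //=; last first.
  by case: tE => -> y yO; rewrite permM; [apply/sO/tperm_in|apply/tperm_in/sO].
have iB := porbit_id t i.
have mB : m \in porbit t i.
  case: tE => tE'; first by rewrite -{1}sm -(tpermR m i) -permM -tE' porbit_next.
  by rewrite porbit_sym -{1}(tpermL m i) -{2}sm -permM -tE' porbit_next porbit_id.
rewrite subUset sub1set mB porbit_sub // => y yB.
case: tE => tE'.
  by rewrite -[y](tpermK m i) -permM -tE' porbit_next tperm_in.
by rewrite -(tpermK m i (s y)) tperm_in // -permM -tE' porbit_next.
Qed.

Lemma porbit_insertD x : x \notin O -> porbit t x = porbit s x.
Proof.
move=> xO.
have nO y : y \in porbit s x -> y \notin O.
  rewrite !inE => yx; apply: contra xO; rewrite !inE => /orP[/eqP ym|yi].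
    by move: yx; rewrite ym porbit_sym porbit_fix // inE => ->.
  by move: yx yi; rewrite -!eq_porbit_mem => /eqP -> ->; rewrite orbT.
have ts y : y \in porbit s x -> t y = s y.
  move=> yx; have := nO _ yx; rewrite !inE negb_or => /andP[ym yi].
  have := nO (s y); rewrite porbit_next => /(_ yx); rewrite !inE negb_or => /andP[sym syi].
  have yi' : i != y by apply: contraNneq yi => <-; rewrite porbit_id.
  have syi' : i != s y.
    by apply: contraNneq syi => {1}->; rewrite porbit_next -eq_porbit_mem (porbit_perm s 1).
  by case: tE => ->; rewrite permM tpermD // eq_sym.
apply/eqP; rewrite eqEsubset; apply/andP; split.
  by apply: porbit_sub; rewrite ?porbit_id // => y yx; rewrite ts ?porbit_next.
have sub : porbit t x \subset porbit s x.
  by apply: porbit_sub; rewrite ?porbit_id // => y yx; rewrite ts ?porbit_next.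
apply: porbit_sub; rewrite ?porbit_id // => y yx.
by rewrite -ts ?porbit_next // (subsetP sub).
Qed.

Lemma porbits_insert :
  porbits t = O |: (porbits s :\ porbit s i :\ [set m]).
Proof.
apply/setP => C; rewrite !inE; apply/imsetP/idP => [[x _ ->]|].
  have [xO|xO] := boolP (x \in O).
    suff -> : porbit t x = O by rewrite eqxx.
    by rewrite -porbit_insert; apply/eqP; rewrite eq_porbit_mem porbit_insert.
  rewrite porbit_insertD //; apply/orP; right.
  rewrite -(porbit_fix sm) !eq_porbit_mem porbit_fix // inE.
  by move: xO; rewrite !inE negb_or => /andP[-> ->]; rewrite imset_f.
case/orP => [/eqP ->|/and3P[Cm Ci /imsetP[x _ Cx]]].
  by exists i => //; rewrite porbit_insert.
exists x => //; rewrite porbit_insertD // !inE negb_or.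
move: Cm Ci; rewrite Cx -(porbit_fix sm) !eq_porbit_mem porbit_fix // inE.
by move=> -> ->.
Qed.
End Insertion.

Local Open Scope ring_scope.

(** With [e] sending X^r to the r-th moment and [u] constantly X, this is the character at [s];
    other weights [u] will describe dressed vectors. *)
Definition orbit_prod (P R : comNzRingType) (T : finType) (e : P -> R) (u : T -> P)
    (s : {perm T}) : R :=
  \prod_(C in porbits s) e (\prod_(j in C) u j).

Definition mulat (P : comNzRingType) (T : finType) (u : T -> P) (i : T) (w : P) :=
  fun j => if j == i then w * u j else u j.

Lemma prod_mulat (P : comNzRingType) (T : finType) (u : T -> P) (i : T) (w : P)
    (C : {set T}) :
  \prod_(j in C) mulat u i w j =
  (if i \in C then w else 1) * \prod_(j in C) u j.
Proof.
have [iC|iC] := boolP (i \in C).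
  rewrite (bigD1 i) //= [in RHS](bigD1 i) //= /mulat eqxx mulrA; congr (_ * _).
  by apply: eq_bigr => j /andP[_ /negPf ->].
rewrite mul1r; apply: eq_bigr => j jC; rewrite /mulat ifN //.
by apply: contraNneq iC => <-.
Qed.

Lemma orbit_prod_mulat (P R : comNzRingType) (T : finType) (e : P -> R) (u : T -> P)
    (s : {perm T}) i w :
  orbit_prod e (mulat u i w) s =
  e (w * \prod_(j in porbit s i) u j) *
  \prod_(C in porbits s :\ porbit s i) e (\prod_(j in C) u j).
Proof.
rewrite /orbit_prod (big_setD1 (porbit s i)) /=; last by rewrite imset_f.
rewrite prod_mulat porbit_id; congr (_ * _); apply: eq_bigr => C.
rewrite !inE => /andP[Ci /imsetP[x _ Cx]]; rewrite prod_mulat ifN ?mul1r //.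
by apply: contra Ci; rewrite Cx -eq_porbit_mem eq_sym.
Qed.

(** The enlarged orbit carries the extra weight [u m], which may as well be attached to [i]; the
    orbit of [m] alone, which disappears, contributed [e (u m)], that is 1. *)
Lemma orbit_prod_insert (P R : comNzRingType) (T : finType) (e : P -> R)
    (u : T -> P) (s t : {perm T}) (m i : T) :
  s m = m -> i != m -> (t = tperm m i * s \/ t = s * tperm m i)%g ->
  e (u m) = 1 -> orbit_prod e u t = orbit_prod e (mulat u i (u m)) s.
Proof.
move=> sm im tE em; rewrite orbit_prod_mulat /orbit_prod (porbits_insert sm tE).
have mi : m \notin porbit s i by rewrite porbit_sym porbit_fix // inE.
rewrite big_setU1 /=; last first.
  rewrite !inE !negb_and; apply/orP; right; apply/orP; right.
  apply/imsetP => -[x _ Ox].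
  have : m \in porbit s x by rewrite -Ox setU11.
  rewrite porbit_sym porbit_fix // inE => /eqP xm.
  have : i \in porbit s x by rewrite -Ox setU1r ?porbit_id.
  by rewrite xm porbit_fix // inE (negPf im).
rewrite big_setU1 //=; congr (_ * _).
rewrite [RHS](big_setD1 [set m]) /=; last first.
  rewrite !inE -(porbit_fix sm) imset_f // andbT eq_porbit_mem //.
by rewrite big_set1 em mul1r.
Qed.

(** * Operators built from transpositions with fresh indices *)

Section Slots.
Variables (R : fieldType) (I : finType).
Implicit Types (g k : {perm I * bool}) (s : {perm I}).

(* A slot (y, m, a, b) stands for the operator a + b (m y), with m a fresh
   index. *)
Definition slot := ((I * bool) * I * (R * R))%type.

(** The head of the list is the operator applied first: the transpositions of the tail are
    multiplied to its left. *)
Fixpoint slots_value (f : {perm I * bool} -> R) (L : seq slot) g : R :=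
  if L is (y, m, (a, b)) :: L' then
    a * slots_value f L' g + b * slots_value f L' (tperm (m, true) y * g)%g
  else f g.

(** The leading X stands for the index [j] itself. The left factor [k] acts before [s], so a slot at
    [y] contributes to the index of [k y]. *)
Definition slots_weight k (L : seq slot) (j : I) : {poly R} :=
  'X * \prod_(q <- L | (k q.1.1).1 == j) (q.2.1%:P + q.2.2 *: 'X).

Variable (e : {poly R} -> R).
Hypothesis eL : forall a p q, e (a *: p + q) = a * e p + e q.
Hypothesis eX : e 'X = 1.
Variable f : {perm I * bool} -> R.
Hypothesis fE : forall k1 s k2, k1 \in hyper I -> k2 \in hyper I ->
  f (k1 * pos s * k2)%g = orbit_prod e (fun=> 'X) s.

(** The term with [b] inserts the fresh [m], of weight X, into the cycle of the index of [k1 y]; by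
    linearity of [e] the two terms together multiply the weight there by a + b X. As the fresh
    indices are distinct and no slot sits over them, the remaining ones stay fixed after the
    insertion. *)
Lemma slots_valueE L k1 s k2 : k1 \in hyper I -> k2 \in hyper I ->
  let fresh := [seq q.1.2 | q <- L] in
  uniq fresh ->
  (forall m, m \in fresh ->
     [/\ s m = m, forall b, k1 (m, b) = (m, b) &
          forall q, q \in L -> q.1.1.1 != m]) ->
  slots_value f L (k1 * pos s * k2)%g = orbit_prod e (slots_weight k1 L) s.
Proof.
elim: L k1 s k2 => [|[[y m] [a b]] L IHL] k1 s k2 k1K k2K /=.
  move=> _ _; rewrite fE // /slots_weight; congr orbit_prod.
  by apply: boolp.funext => j; rewrite big_nil mulr1.
move=> /andP[mL uL] fr.
have [sm k1m yfr] := fr m (mem_head _ _).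
have ym : y.1 != m by apply: (yfr (y, m, (a, b))); rewrite mem_head.
have frL m' : m' \in [seq q.1.2 | q <- L] ->
     [/\ s m' = m', forall b, k1 (m', b) = (m', b) &
          forall q, q \in L -> q.1.1.1 != m'].
  move=> m'L; have [|sm' k1m' yfr'] := fr m'; first by rewrite inE m'L orbT.
  by split => // q qL; apply: yfr'; rewrite inE qL orbT.
rewrite IHL //.
have ky : (k1 y).1 != m.
  apply: contraNneq ym; rewrite -{2}[y](permK k1); case: (k1 y) => j c /= ->.
  by rewrite -(k1m c) permK.
have [l1 [t [l2 [l1E tE l2K _ tE']]]] := insert_hyper sm ky.
have l1K : l1 \in hyper I by case: l1E => ->; rewrite ?group1 ?hyper_flip.
have l1fst x : (l1 x).1 = x.1.
  case: l1E => ->; first by rewrite perm1.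
  by case: tpermP => [->|->|].
have -> : (tperm (m, true) y * (k1 * pos s * k2) = (k1 * l1) * pos t * (l2 * k2))%g.
  rewrite !mulgA tperm_mul k1m; rewrite -(mulgA k1 (tperm _ _)) tE'.
  by rewrite !mulgA.
rewrite (IHL (k1 * l1)%g); [| by rewrite groupM | by rewrite groupM | by [] |]; last first.
  move=> m' m'L; have [sm' k1m' yfr'] := frL m' m'L.
  have mm' : m != m' by apply: contraNneq mL => ->.
  have kym' : (k1 y).1 != m'.
    have [_ _ /(_ _ (mem_head _ _)) /=] := fr m' (mem_behead (s := m :: _) m'L).
    apply: contraNneq; rewrite -{2}[y](permK k1); case: (k1 y) => j c /= ->.
    by rewrite -(k1m' c) permK.
  split=> //.
    by case: tE => ->; rewrite permM ?sm' tpermD.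
  move=> c; rewrite permM k1m'; case: l1E => ->; first by rewrite perm1.
  by rewrite tpermD // xpair_eqE (negPf mm').
have wE : slots_weight (k1 * l1) L = slots_weight k1 L.
  apply: boolp.funext => j; rewrite /slots_weight; congr (_ * _).
  by apply: eq_bigl => q; rewrite permM l1fst.
rewrite wE.
set w := slots_weight k1 L.
(* No slot sits over [m], so its weight is X, and [e 'X = 1] is what the insertion lemma
   requires. *)
have wm : w m = 'X.
  rewrite /w /slots_weight big_seq_cond big_pred0 ?mulr1 // => q.
  apply/negbTE/negP => /andP[qL /eqP kq].
  have /negP := yfr q (mem_behead (s := _ :: _) qL); apply.
  rewrite -[q.1.1](permK k1); case: (k1 q.1.1) kq => j c /= ->.
  by rewrite -(k1m c) permK.
rewrite (orbit_prod_insert sm ky tE) ?wm //.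
have -> : slots_weight k1 ((y, m, (a, b)) :: L) = mulat w (k1 y).1 (a%:P + b *: 'X).
  apply: boolp.funext => j; rewrite /slots_weight /mulat big_cons /= eq_sym.
  by case: ifP => // _; rewrite mulrCA.
rewrite !orbit_prod_mulat mulrDl mul_polyC -scalerAl eL mulrDl -!mulrA.
have -> : orbit_prod e w s = e (\prod_(j in porbit s (k1 y).1) w j) *
    \prod_(C in porbits s :\ porbit s (k1 y).1) e (\prod_(j in C) w j).
  by rewrite /orbit_prod (big_setD1 (porbit s (k1 y).1)) ?imset_f.
congr (_ + _).
have e0 : e 0 = 0 by have := eL (-1) 0 0; rewrite scaler0 addr0 mulN1r addNr.
by rewrite -[_ *: (_ * _)]addr0 eL e0 addr0 mulrA.
Qed.
End Slots.

End OrbitProducts.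

(** * Signs and sums of colourings, orbit by orbit *)

Section OrbitSums.
Local Open Scope ring_scope.

Lemma mem_porbits (T : finType) (s : {perm T}) (C : {set T}) i :
  C \in porbits s -> (porbit s i == C) = (i \in C).
Proof. by case/imsetP => x _ ->; rewrite eq_porbit_mem. Qed.

Lemma prod_porbits (R : comPzSemiRingType) (T : finType) (s : {perm T}) (F : T -> R) :
  \prod_i F i = \prod_(C in porbits s) \prod_(i in C) F i.
Proof.
rewrite (partition_big (porbit s) (mem (porbits s))) /=; last first.
  by move=> i _; rewrite imset_f.
by apply: eq_bigr => C Cs; apply: eq_bigl => i; rewrite mem_porbits.
Qed.

(** The parity of a permutation is that of the number of points plus the number of orbits, and each
    count is a product of -1 over orbits. *)
Lemma sign_porbits (R : comPzRingType) (T : finType) (s : {perm T}) :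
  (-1) ^+ s = \prod_(C in porbits s) (-1) ^+ (#|C|.-1) :> R.
Proof.
have -> : \prod_(C in porbits s) (-1) ^+ (#|C|.-1) =
    \prod_(C in porbits s) \prod_(i in C) (-1) *
    \prod_(C in porbits s) (-1) :> R.
  rewrite -big_split; apply: eq_bigr => C /imsetP[x _ ->] /=.
  rewrite prodr_const; case: #|_| (card_porbit_neq0 s x) => // n _ /=.
  by rewrite exprSr -mulrA mulrNN mulr1 mulr1.
rewrite -prod_porbits prodr_const prodr_const -exprD.
by rewrite -[RHS]signr_odd oddD.
Qed.

(** The default [c0] is met only at the empty set, and orbits are nonempty. *)
Definition orbit_value (I Col : finType) (c0 : Col) (y : I -> Col) (C : {set I}) :=
  if [pick j in C] is Some j then y j else c0.

Lemma stable_porbit (I Col : finType) (s : {perm I}) (y : I -> Col) :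
  (forall i, y (s i) = y i) -> forall i j, j \in porbit s i -> y j = y i.
Proof.
move=> ys i _ /porbitP[n ->]; elim: n => [|n IHn]; first by rewrite perm1.
by rewrite expgSr permM ys.
Qed.

Lemma orbit_valueE (I Col : finType) (c0 : Col) (s : {perm I}) (y : I -> Col) :
  (forall i, y (s i) = y i) ->
  forall C i, C \in porbits s -> i \in C -> orbit_value c0 y C = y i.
Proof.
move=> ys C i /imsetP[x _ ->] ix; rewrite /orbit_value.
case: pickP => [j jx|/(_ i)]; last by rewrite ix.
by rewrite !(stable_porbit ys (i := x)).
Qed.

(** Invariant colourings are functions on the orbits, so the sum distributes over the product. Such
    functions are extended by [c0] to all sets of points, the form in which the distributivity law
    produces them. *)
Lemma sum_orbit_constant (R : comPzSemiRingType) (I Col : finType) (c0 : Col)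
    (s : {perm I}) (G : {set I} -> Col -> R) :
  \sum_(y : {ffun I -> Col} | [forall i, y (s i) == y i])
     \prod_(C in porbits s) G C (orbit_value c0 y C) =
  \prod_(C in porbits s) \sum_c G C c.
Proof.
rewrite (big_distr_big_dep c0).
pose h (y : {ffun I -> Col}) : {ffun {set I} -> Col} :=
  [ffun C => if C \in porbits s then orbit_value c0 y C else c0].
pose h' (phi : {ffun {set I} -> Col}) : {ffun I -> Col} :=
  [ffun i => phi (porbit s i)].
rewrite (reindex_onto h h') /=; last first.
  move=> phi /pfamilyP[/supportP phi0 _]; apply/ffunP => C; rewrite ffunE.
  case: ifP => [Cs|/negbT /phi0 -> //].
  have : C \in porbits s by [].
  case/imsetP => x _ Cx; rewrite (@orbit_valueE _ _ c0 s _ _ _ x) ?Cx ?imset_f ?porbit_id //.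
    by rewrite ffunE.
  by move=> i; rewrite !ffunE (porbit_perm s 1).
apply: eq_big => y.
  apply/forallP/andP => [ys|[_ /eqP <-] i]; last first.
    by rewrite !ffunE (porbit_perm s 1).
  have {}ys i : y (s i) = y i by apply/eqP.
  split.
    apply/pfamilyP; split; last by [].
    by apply/supportP => C Cs; rewrite ffunE ifN.
  apply/eqP/ffunP => i; rewrite !ffunE imset_f //.
  by rewrite (orbit_valueE c0 ys _ (porbit_id s i)) ?imset_f.
by move=> ys; apply: eq_bigr => C Cs; rewrite ffunE Cs.
Qed.

End OrbitSums.

(** * Coloured matchings *)

Lemma stable_astabs (T : finType) (P : {set T}) (g : {perm T}) :
  (forall a, a \in P -> g a \in P) -> g \in ('N(P | 'P))%g.
Proof.
move=> gP; rewrite /astabs !inE /=.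
by apply/subsetP => a aP; rewrite inE apermE gP.
Qed.

Section ColouredMatchings.
Local Open Scope ring_scope.
Variables (R : rcfType) (I Col : finType).
Variables (star : Col -> Col) (half : pred Col) (w : Col -> R).
Hypothesis starK : involutive star.
Hypothesis half_star : forall c, star c != c -> half (star c) = ~~ half c.
Hypothesis w_ge0 : forall c, 0 <= w c.
Hypothesis w_star : forall c, w (star c) = w c.

Local Notation X := (I * bool)%type.
Implicit Types (M N g u : {perm X}) (x : {ffun X -> Col}).

Definition odd_colour c := star c != c.

Definition compatible M x := [forall a, x (M a) == star (x a)].

Definition odd_half x := [set a | odd_colour (x a) && half (x a)].

(** Square roots because an index carries two points, whose colours c and star c have equal weight;
    together they give w c. *)
Definition colour_weight x := \prod_a Num.sqrt (w (x a)).

Definition half_sign (P : {set X}) g : R := (-1) ^+ (restr_perm P g).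

Definition colour_kernel M N : R :=
  \sum_(x | compatible M x && compatible N x)
    colour_weight x * half_sign (odd_half x) (M * N).

Lemma odd_star c : odd_colour (star c) = odd_colour c.
Proof. by rewrite /odd_colour starK eq_sym. Qed.

Lemma compatible_norm M N x : compatible M x -> compatible N x ->
  (M * N)%g \in ('N(odd_half x | 'P))%g.
Proof.
move=> /forallP xM /forallP xN; apply: stable_astabs => a.
rewrite !inE permM => /andP[ao ah].
by rewrite (eqP (xN _)) (eqP (xM _)) starK ao ah.
Qed.

Lemma half_signM P M N : M \in ('N(P | 'P))%g -> N \in ('N(P | 'P))%g ->
  half_sign P (M * N)%g = half_sign P M * half_sign P N.
Proof. by move=> MP NP; rewrite /half_sign morphM // odd_permM signr_addb. Qed.

(** A choice depending on the colouring alone. The default 1 is taken only when no involution is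
    compatible with [x], and then the feature of every involution at [x] vanishes. *)
Definition reference x : {perm X} :=
  odflt 1%g [pick M | (M^-1 == M)%g && compatible M x].

Definition colour_feature M x : R :=
  (compatible M x)%:R * Num.sqrt (colour_weight x) *
  half_sign (odd_half x) (reference x * M)%g.

Lemma colour_weight_ge0 x : 0 <= colour_weight x.
Proof. by apply: prodr_ge0 => a _; rewrite sqrtr_ge0. Qed.

(** With L the reference matching, M N is the product of M L and L N, both preserving [odd_half x];
    and M L is the inverse of L M, hence has the same sign. *)
Lemma colour_kernel_gram M N : (M^-1 = M)%g -> (N^-1 = N)%g ->
  colour_kernel M N = \sum_x colour_feature M x * colour_feature N x.
Proof.
move=> MV NV; rewrite /colour_kernel big_mkcond; apply: eq_bigr => x _.
rewrite /colour_feature.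
have [Mx|_] := boolP (compatible M x); last by rewrite !mul0r.
have [Nx|_] := boolP (compatible N x); last by rewrite !(mul0r, mulr0).
rewrite /= !mul1r mulrACA -expr2 sqr_sqrtr ?colour_weight_ge0 //; congr (_ * _).
rewrite /reference; case: pickP => [L /andP[/eqP LV Lx]|/(_ M)] /=; last first.
  by rewrite MV eqxx Mx.
have -> : half_sign (odd_half x) (L * M) = half_sign (odd_half x) (M * L).
  rewrite -[in RHS]MV -[in RHS]LV -invMg /half_sign.
  by rewrite morphV ?compatible_norm // odd_permV.
rewrite -half_signM ?compatible_norm //; congr half_sign.
by rewrite mulgA -(mulgA M) -{1}LV mulVg mulg1.
Qed.

Lemma restr_permJ (P : {set X}) g u : g \in ('N(P | 'P))%g ->
  restr_perm (u @: P) (g ^ u)%g = (restr_perm P g ^ u)%g.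
Proof.
move=> gP.
have gPu : (g ^ u)%g \in ('N(u @: P | 'P))%g.
  apply: stable_astabs => _ /imsetP[a aP ->]; rewrite permJ imset_f //.
  by have := astabs_act a gP; rewrite aP.
apply/permP => a; rewrite -[a](permKV u) [RHS]permJ.
have [aP|aP] := boolP ((u^-1)%g a \in P).
  by rewrite !restr_permE ?imset_f // permJ.
rewrite [LHS](out_perm (restr_perm_on _ _)); last by rewrite mem_imset //; exact: perm_inj.
by rewrite (out_perm (restr_perm_on _ _)).
Qed.

Lemma colour_kernelJ M N u :
  colour_kernel (M ^ u)%g (N ^ u)%g = colour_kernel M N.
Proof.
pose h x : {ffun X -> Col} := [ffun a => x ((u^-1)%g a)].
pose h' x : {ffun X -> Col} := [ffun a => x (u a)].
rewrite /colour_kernel (reindex_onto h h') /=; last first.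
  by move=> x _; apply/ffunP => a; rewrite !ffunE permKV.
have hc L x : compatible (L ^ u)%g (h x) = compatible L x.
  apply/forallP/forallP => xL a; last first.
    by rewrite -[a](permKV u) permJ !ffunE !permK.
  by have := xL (u a); rewrite permJ !ffunE !permK.
have h'h x : h' (h x) = x by apply/ffunP => a; rewrite !ffunE permK.
apply: eq_big => x; first by rewrite !hc h'h eqxx andbT.
rewrite !hc => /andP[/andP[xM xN] _]; congr (_ * _).
  rewrite /colour_weight (reindex_inj (@perm_inj _ u)); apply: eq_bigr => a _.
  by rewrite ffunE permK.
have -> : odd_half (h x) = u @: odd_half x.
  apply/setP => a; rewrite -[a](permKV u) mem_imset ?inE ?ffunE ?permK //.
  exact: perm_inj.
by rewrite /half_sign -conjMg restr_permJ ?compatible_norm // odd_permJ.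
Qed.

Lemma oppp_posJF (s : {perm I}) i : (oppp I ^ pos s)%g (i, false) = (s i, true).
Proof. by rewrite -{1}(posF s i) permJ opppE /opp /= posT. Qed.

Lemma oppp_posJT (s : {perm I}) i : (oppp I ^ pos s)%g (s i, true) = (i, false).
Proof. by rewrite -(posT s i) permJ opppE /opp /= posF. Qed.

Definition colouring (y : {ffun I -> Col}) : {ffun X -> Col} :=
  [ffun a => if a.2 then y a.1 else star (y a.1)].

(** On [odd_half] the product of the two matchings acts as [s] where the chosen half is positive and
    as its inverse where it is negative. Its orbits there are therefore copies, by [phi], of the
    orbits of [s] with odd colour. *)
Lemma half_sign_pos (c0 : Col) (s : {perm I}) (y : {ffun I -> Col}) :
  (forall i, y (s i) = y i) ->
  half_sign (odd_half (colouring y)) (oppp I * oppp I ^ pos s)%g =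
  \prod_(C in porbits s)
    (if odd_colour (orbit_value c0 y C) then (-1) ^+ #|C|.-1 else 1).
Proof.
move=> ys; set P := odd_half _; set g := (_ * _)%g; set r := restr_perm P g.
pose phi i := (i, half (y i)).
have phi_inj : injective phi by move=> i j [].
have PE i b : ((i, b) \in P) = odd_colour (y i) && (b == half (y i)).
  rewrite !inE !ffunE /=; case: b; first by case: (half _).
  rewrite odd_star; have [yo|//] := boolP (odd_colour _).
  by rewrite half_star //; case: (half _).
have gP : g \in ('N(P | 'P))%g.
  apply: stable_astabs => -[i b]; rewrite PE => /andP[yo /eqP->].
  case: (boolP (half (y i))) => hi; rewrite permM opppE /opp /=.
    by rewrite oppp_posJF PE ys yo hi.
  by rewrite -{1}(permKV s i) oppp_posJT PE -ys permKV yo (negPf hi).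
have rphi i : odd_colour (y i) ->
    r (phi i) = phi ((if half (y i) then s else s^-1)%g i).
  move=> yo; rewrite /r restr_permE // ?PE ?yo ?eqxx // permM opppE /opp /phi.
  case: (boolP (half (y i))) => hi /=.
    by rewrite oppp_posJF ys hi.
  by rewrite -{1}(permKV s i) oppp_posJT -[in RHS]ys permKV (negPf hi).
have porb i : odd_colour (y i) -> porbit r (phi i) = phi @: porbit s i.
  move=> yo; pose s' := (if half (y i) then s else s^-1)%g.
  have s'E j : porbit s' j = porbit s j by rewrite /s'; case: ifP => _; rewrite ?porbitV.
  have yj := stable_porbit ys (i := i).
  apply/eqP; rewrite eqEsubset; apply/andP; split.
    apply: porbit_sub; last by rewrite imset_f ?porbit_id.
    move=> _ /imsetP[j ji ->]; rewrite rphi ?yj // -/s' imset_f //.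
    by rewrite -s'E porbit_next s'E.
  apply/subsetP => _ /imsetP[j ji ->].
  pose B := [set j in porbit s i | phi j \in porbit r (phi i)].
  suff /subsetP/(_ j) : porbit s' i \subset B by rewrite s'E !inE => /(_ ji)/andP[].
  apply: porbit_sub; last by rewrite !inE !porbit_id.
  move=> l; rewrite !inE => /andP[li lB].
  rewrite -{1}s'E porbit_next s'E li /= /s' -(yj _ li) -rphi ?yj //.
  by rewrite porbit_next.
rewrite /half_sign sign_porbits -/r (bigID (fun C : {set X} => C \subset P)) /=.
(* Orbits that leave [P] are fixed points of the restricted permutation, of sign 1. *)
rewrite [X in _ * X]big1 ?mulr1; last first.
  move=> _ /andP[/imsetP[[i b] _ ->]].
  have [|ibP _] := boolP ((i, b) \in P); last first.
    by rewrite porbit_fix ?cards1 // (out_perm (restr_perm_on _ _)).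
  rewrite PE => /andP[yo /eqP ->]; rewrite porb // => /negP[].
  apply/subsetP => _ /imsetP[j ji ->]; rewrite PE eqxx andbT.
  by rewrite (stable_porbit ys ji).
have -> : \prod_(C in porbits r | C \subset P) (-1) ^+ #|C|.-1 =
   \prod_(C in [set phi @: D | D : {set I} in [set D in porbits s | odd_colour (orbit_value c0 y D)]])
     (-1) ^+ #|C|.-1 :> R.
  apply: eq_bigl => C; apply/andP/imsetP => [[/imsetP[[i b] _ CE] CP]|[D]].
    have : (i, b) \in P by rewrite (subsetP CP) // CE porbit_id.
    rewrite PE => /andP[yo /eqP bE]; exists (porbit s i); last by rewrite CE bE porb.
    by rewrite inE imset_f // (orbit_valueE c0 ys _ (porbit_id s i)) ?imset_f.
  rewrite inE => /andP[/imsetP[i _ DE]].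
  rewrite {1}DE (orbit_valueE c0 ys _ (porbit_id s i)) ?imset_f // => yo ->.
  rewrite DE -porb // imset_f // porb //; split => //.
  apply/subsetP => _ /imsetP[j ji ->]; rewrite PE eqxx andbT.
  by rewrite (stable_porbit ys ji).
rewrite big_imset /=; last by move=> C D _ _; apply: imset_inj.
under eq_bigl do rewrite inE.
rewrite big_mkcondr /=; apply: eq_bigr => C _.
by rewrite card_imset.
Qed.

(** A colouring compatible with both matchings is determined by the colours of the positive points,
    and these are constant on the orbits of [s]. *)
Lemma colour_kernel_pos (c0 : Col) (s : {perm I}) :
  colour_kernel (oppp I) (oppp I ^ pos s)%g =
  \prod_(C in porbits s)
    \sum_c (if odd_colour c then (-1) ^+ #|C|.-1 else 1) * w c ^+ #|C|.
Proof.
rewrite -(sum_orbit_constant c0) /colour_kernel.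
pose h' x : {ffun I -> Col} := [ffun i => x (i, true)].
rewrite (reindex_onto colouring h') /=; last first.
  move=> x /andP[/forallP xo _]; apply/ffunP => -[i []]; rewrite !ffunE //=.
  by rewrite -(eqP (xo (i, true))) opppE.
apply: eq_big => y.
  apply/andP/forallP => [[/andP[/forallP yo /forallP yJ] _] i|ys].
    have /eqP := yJ (i, false); rewrite oppp_posJF !ffunE /= starK => ->.
    by rewrite eqxx.
  have {}ys i : y (s i) = y i by apply/eqP.
  split; last by apply/eqP/ffunP => i; rewrite !ffunE.
  apply/andP; split; apply/forallP => -[i []]; rewrite ?opppE ?oppp_posJF.
  - by rewrite !ffunE.
  - by rewrite !ffunE /= starK.
  - by rewrite -{1}(permKV s i) oppp_posJT !ffunE /= -ys permKV.
  - by rewrite !ffunE /= starK ys.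
move=> /andP[/andP[/forallP yo /forallP yJ] _].
have ys i : y (s i) = y i.
  by have /eqP := yJ (i, false); rewrite oppp_posJF !ffunE /= starK.
rewrite (half_sign_pos c0) // big_split /= mulrC; congr (_ * _).
have -> : colour_weight (colouring y) =
    \prod_i \prod_b Num.sqrt (w (colouring y (i, b))).
  by rewrite pair_bigA; apply: eq_bigr => -[i b].
rewrite (prod_porbits s); apply: eq_bigr => C Cs.
rewrite -prodr_const; apply: eq_bigr => i iC.
rewrite (orbit_valueE c0 ys Cs iC) big_bool !ffunE /= w_star.
by rewrite -expr2 sqr_sqrtr.
Qed.

End ColouredMatchings.

From mathcomp Require Import finmap complex.
From mathcomp Require Import all_classical all_reals all_analysis.
From mathcomp Require Import measurable_realfun.
From mathcomp Require Import zify ring lra.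

Import numFieldNormedType.Exports.

Local Open Scope classical_set_scope.
Local Open Scope ring_scope.
Local Open Scope complex_scope.

(** * Permutations of signed points inside G^E *)

Section Embedding.
Variable M : nat.
Local Notation X := ('I_M * bool)%type.
Implicit Types (g h : {perm X}) (s : {perm 'I_M}).

Definition enc (x : X) : int := if x.2 then Posz x.1.+1 else Negz x.1.

Definition dec (z : int) : option X :=
  match z with
  | Posz 0 => None
  | Posz k.+1 => omap (pair^~ true) (insub k)
  | Negz k => omap (pair^~ false) (insub k)
  end.

Lemma encK : pcancel enc dec.
Proof. by case=> i []; rewrite /enc /dec /= valK. Qed.

Lemma enc_inj : injective enc. Proof. exact: pcan_inj encK. Qed.

Lemma decK z x : dec z = Some x -> enc x = z.
Proof.
case: z => [[|k]|k] //=; case: insubP => //= i _ <- [<-] //.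
Qed.

Lemma dec_None z : (dec z == None) = ((z == 0) || (M < `|z|)%N).
Proof.
have lt k : (M < k.+1)%N = ~~ (k < M)%N by rewrite ltnS leqNgt.
by case: z => [[|k]|k] //=; rewrite lt; case: insubP => /= [i -> _|->].
Qed.

Lemma enc_opp x : enc (opp x) = - enc x.
Proof. by case: x => i []; rewrite /enc /opp /= ?NegzE ?opprK. Qed.

(* The inverse makes the embedding a morphism, permutations being multiplied
   from left to right. *)
Definition emb_fun g (z : int) := if dec z is Some x then enc (g^-1%g x) else z.

Lemma emb_fun_enc g x : emb_fun g (enc x) = enc (g^-1%g x).
Proof. by rewrite /emb_fun encK. Qed.

Lemma emb_fun_dec g z : dec z = None -> emb_fun g z = z.
Proof. by rewrite /emb_fun => ->. Qed.

Lemma int_enc z : (exists x, z = enc x) \/ dec z = None.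
Proof.
by case E: (dec z) => [x|]; [left; exists x; rewrite (decK E)|right].
Qed.

Lemma emb_funM g h z : emb_fun (g * h)%g z = emb_fun g (emb_fun h z).
Proof.
have [[x ->]|z0] := int_enc z; last by rewrite !emb_fun_dec.
by rewrite !emb_fun_enc invMg permM.
Qed.

Lemma emb_fun1 z : emb_fun 1 z = z.
Proof.
have [[x ->]|z0] := int_enc z; last by rewrite !emb_fun_dec.
by rewrite !emb_fun_enc invg1 perm1.
Qed.

Lemma emb_fun_bijection g : finite_bijection0 (emb_fun g).
Proof.
split => //.
  by exists (emb_fun g^-1) => z; rewrite -emb_funM ?mulgV ?mulVg emb_fun1.
apply: (@sub_finite_set _ _ (enc @` [set: X])); last exact: finite_image.
move=> z /=; have [[x ->] _|z0] := int_enc z; first by exists x.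
by rewrite emb_fun_dec.
Qed.

Definition emb g : GE := GE_of (emb_fun_bijection g).

Lemma embE g x : emb g (enc x) = enc (g^-1%g x). Proof. exact: emb_fun_enc. Qed.

Lemma emb_dec g z : dec z = None -> emb g z = z. Proof. exact: emb_fun_dec. Qed.

Lemma GE_ext (g h : GE) : g =1 h -> g = h.
Proof. by move=> gh; apply: val_inj; apply/funext. Qed.

Lemma embM g h : emb (g * h) = (emb g * emb h)%g.
Proof. by apply: GE_ext => z; rewrite [LHS]emb_funM. Qed.

Lemma emb1 : emb 1 = 1%g.
Proof. by apply: GE_ext => z; rewrite [LHS]emb_fun1. Qed.

Lemma embV g : emb g^-1 = (emb g)^-1%g.
Proof. by rewrite -[LHS]mulg1 -(mulgV (emb g)) mulgA -embM mulVg emb1 mul1g. Qed.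

Lemma emb_inj : injective emb.
Proof.
move=> g h gh; apply: invg_inj; apply/permP => x.
by apply: enc_inj; rewrite -!embE gh.
Qed.

Lemma emb_KE g : KE (emb g) <-> g \in hyper 'I_M.
Proof.
rewrite -groupV; split => [gK|/hyperP gK z].
  apply/hyperP => x; apply: enc_inj.
  by rewrite enc_opp -!embE enc_opp gK.
have [[x ->]|/eqP] := int_enc z; first by rewrite -enc_opp !embE gK enc_opp.
move=> z0; rewrite !emb_dec //; first exact/eqP.
by apply/eqP; move: z0; rewrite !dec_None oppr_eq0 abszN.
Qed.

Lemma emb_pos s : Sinfty (emb (pos s)).
Proof.
move=> z z0; have [[x zx]|] := int_enc z; last by move/emb_dec->.
rewrite zx embE -posV; case: x zx => i []; last by rewrite posF.
by move=> zx; move: z0; rewrite zx.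
Qed.

Lemma emb_onto (g : GE) : (forall z, (M < `|z|)%N -> g z = z) ->
  exists h, g = emb h.
Proof.
move=> gM; have [[g' gK g'K] _ g0] := GEP g.
have gd z : dec z = None -> g z = z.
  by move/eqP; rewrite dec_None => /orP[/eqP->|/gM].
pose f x := odflt x (dec (g (enc x))).
have fE x : enc (f x) = g (enc x).
  rewrite /f; case E: (dec (g (enc x))) => [y|] /=; first exact: decK.
  by have /(can_inj gK) := gd _ E.
have f_inj : injective f.
  by move=> x y /(congr1 enc); rewrite !fE => /(can_inj gK)/enc_inj.
exists (perm f_inj)^-1%g; apply: GE_ext => z.
have [[x ->]|zd] := int_enc z; first by rewrite embE invgK permE fE.
by rewrite emb_dec ?gd.
Qed.

Lemma emb_onto_pos (g : GE) : (forall z, (M < `|z|)%N -> g z = z) ->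
  Sinfty g -> exists s, g = emb (pos s).
Proof.
move=> /emb_onto[h ->] hS.
have hF i : h^-1%g (i, false) = (i, false).
  by apply: enc_inj; rewrite -embE hS.
pose f i := (h^-1%g (i, true)).1.
have hT i : h^-1%g (i, true) = (f i, true).
  rewrite /f; case E: (h^-1%g _) => [j []] //=.
  by have := perm_inj (etrans E (esym (hF j))).
have f_inj : injective f.
  move=> i j fij; have : h^-1%g (i, true) = h^-1%g (j, true) by rewrite !hT fij.
  by move/perm_inj => [].
exists (perm f_inj)^-1%g; congr emb; apply: invg_inj; rewrite -posV invgK.
by apply/permP => -[i []]; rewrite ?posT ?posF ?hF // hT permE.
Qed.

(** The shape of [thoma_character] with an arbitrary sequence [m], indexed by the cycle length, in
    place of the moments. *)
Definition cycle_product (R : comPzRingType) (m : nat -> R) (g : GE) : R :=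
  \big[*%R/1]_(C \in nontrivial_cycles g) m #|` fset_set C|%fset.

Definition positive_set (C : {set 'I_M}) : set int :=
  [set Posz (i : 'I_M).+1 | i in [set` C]].

Lemma card_positive_set (C : {set 'I_M}) : #|` fset_set (positive_set C)|%fset = #|C|.
Proof.
have inj : injective (fun i : 'I_M => Posz i.+1) by move=> i j [/val_inj].
rewrite /positive_set fset_set_image // card_imfset //.
rewrite cardE; apply: perm_size; apply: uniq_perm; rewrite ?fset_uniq ?enum_uniq //.
move=> i; rewrite mem_enum in_fset_set //; apply/idP/idP; rewrite inE //.
Qed.

Lemma positive_set_inj : injective positive_set.
Proof.
move=> C D CD; apply/setP => i.
have memP (B : {set 'I_M}) : (i \in B) = `[< positive_set B (Posz i.+1) >].
  apply/idP/asboolP => [iB|[j /= jB [/val_inj <-]]] //; first by exists i.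
by rewrite !memP CD.
Qed.

Lemma cycle_of_emb s i : cycle_of (emb (pos s)) (Posz (i : 'I_M).+1) = positive_set (porbit s i).
Proof.
have it n : iter n (emb (pos s)) (Posz i.+1) = Posz ((s^-1 ^+ n)%g i).+1.
  elim: n => [|n IHn]; first by rewrite perm1.
  rewrite iterS IHn -[Posz _]/(enc (_, true)) embE -posV posT /enc /=.
  by rewrite expgSr permM.
apply/seteqP; split => [_ [n _ <-]|_ [j /= ji <-]].
  by rewrite it; exists ((s^-1 ^+ n)%g i) => //=; rewrite -porbitV mem_porbit.
by move: ji; rewrite -porbitV => /porbitP[n ->]; exists n => //; rewrite it.
Qed.

(** Since [emb] inverts, the cycles are the orbits of [s^-1], which are those of [s]; [m 1 = 1] lets
    the fixed points enter the product. *)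
Lemma cycle_product_emb (R : comPzRingType) (m : nat -> R) s : m 1%N = 1 ->
  cycle_product m (emb (pos s)) = \prod_(C in porbits s) m #|C|.
Proof.
move=> m1; rewrite /cycle_product.
have -> : nontrivial_cycles (emb (pos s)) =
    positive_set @` [set` [pred C | (C \in porbits s) && (1 < #|C|)%N]].
  apply/seteqP; split => [_ [z zs <-]|_ [C /= /andP[/imsetP[i _ ->] C1] <-]].
    rewrite /mkset in zs; have [[[i []] zE]|/emb_dec/zs//] := int_enc z; last first.
      by move: zs; rewrite zE embE -posV posF.
    move: zs; rewrite zE embE -posV posT => si.
    exists (porbit s i); last by rewrite -cycle_of_emb.
    apply/andP; split; first exact: imset_f.
    have := card_porbit_neq0 s i.
    case E: #|porbit s i| => [|[|n]] // _; exfalso; apply: si.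
    have /eqP/cards1P[j sj] := E.
    have : s^-1%g i \in porbit s i by rewrite -porbitV (mem_porbit _ 1).
    have := porbit_id s i; rewrite sj !inE => /eqP <- /eqP ->//.
  exists (Posz i.+1); last by rewrite cycle_of_emb.
  have iE : Posz i.+1 = enc (i, true) by [].
  rewrite /mkset iE emb_fun_enc -posV posT => /enc_inj [si].
  by move: C1; rewrite porbit_fix ?cards1 // -{1}si permKV.
rewrite fsbig_image; last by move=> C D _ _; exact: positive_set_inj.
under eq_fsbigr do rewrite card_positive_set.
rewrite -(bigfs _ (index_enum_uniq _)); last by move=> C _; rewrite mem_index_enum.
rewrite big_mkcondr /=; apply: eq_bigr => C Cs; case: ltnP => // C1.
have [x _ CE] := imsetP Cs.
have -> : #|C| = 1%N; last by [].
by apply/eqP; rewrite eqn_leq C1 lt0n CE card_porbit_neq0.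
Qed.
End Embedding.

Lemma GE_bounded (g : GE) : exists M, forall z, (M < `|z|)%N -> g z = z.
Proof.
have [_ fg _] := GEP g.
have [n hn] : exists n, forall z, g z <> z -> (`|z| <= n)%N.
  exists (\max_(z <- fset_set [set i | g i <> i]) `|z|%N) => z gz.
  by rewrite leq_bigmax_seq // in_fset_set // inE.
exists n => z nz; apply: contrapT => /hn; by rewrite leqNgt nz.
Qed.

Section DisjointCycles.

Lemma iter_moved (g h : GE) i n : (forall z, g z = z \/ h z = z) -> g i <> i ->
  iter n (g * h)%g i = iter n g i /\ g (iter n g i) <> iter n g i.
Proof.
move=> gh gi; have [[g' gK _] _ _] := GEP g.
elim: n => [|n [IH1 IH2]] //; rewrite !iterS IH1; split.
  rewrite -[LHS]/(g (h (iter n g i))).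
  by have [/IH2 //|->] := gh (iter n g i).
by move/(can_inj gK).
Qed.

Lemma cycle_ofM (g h : GE) i : (forall z, g z = z \/ h z = z) -> g i <> i ->
  cycle_of (g * h)%g i = cycle_of g i.
Proof.
move=> gh gi; apply/seteqP; split => _ [n _ <-]; exists n => //.
  by have [-> _] := iter_moved n gh gi.
by have [<- _] := iter_moved n gh gi.
Qed.

Lemma disjoint_mulC (g h : GE) : (forall z, g z = z \/ h z = z) ->
  (g * h = h * g)%g.
Proof.
move=> gh; apply: GE_ext => z; rewrite -[LHS]/(g (h z)) -[RHS]/(h (g z)).
have [[g' gK _] _ _] := GEP g; have [[h' hK _] _ _] := GEP h.
have [gz|hz] := gh z.
  rewrite gz; have [//|] := gh (h z); move/(can_inj hK) => ->; by rewrite gz.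
rewrite hz; have [|->//] := gh (g z); move/(can_inj gK) => ->; by rewrite hz.
Qed.

Lemma finite_nontrivial_cycles (g : GE) : finite_set (nontrivial_cycles g).
Proof. by have [_ fg _] := GEP g; exact: finite_image. Qed.

Lemma cycle_productM (R : comPzRingType) (m : nat -> R) (g h : GE) :
  (forall z, g z = z \/ h z = z) ->
  cycle_product m (g * h)%g = cycle_product m g * cycle_product m h.
Proof.
move=> gh; have hg z : h z = z \/ g z = z by case: (gh z); [right|left].
rewrite /cycle_product.
have -> : nontrivial_cycles (g * h)%g = nontrivial_cycles g `|` nontrivial_cycles h.
  apply/seteqP; split => [_ [z zgh <-]|_ [[z zg <-]|[z zh <-]]].
  - have [gz|gz] := pselect (g z = z); last by left; exists z; rewrite ?cycle_ofM.
    have hz : h z <> z by move=> hz; apply: zgh; rewrite -[LHS]/(g (h z)) hz.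
    by right; exists z => //; rewrite disjoint_mulC // cycle_ofM.
  - exists z; last by rewrite cycle_ofM.
    by have [|hz] := gh z => //; rewrite /mkset -[X in X = _]/(g (h z)) hz.
  - exists z; last by rewrite disjoint_mulC // cycle_ofM.
    have [//|gz] := hg z.
    by rewrite /mkset disjoint_mulC // -[X in X = _]/(h (g z)) gz.
rewrite fsbigU0 //; try exact: finite_nontrivial_cycles.
move=> _ [[z /= zg <-] [t /= th tz]].
have : cycle_of h t z by rewrite tz; exists 0%N.
case=> n _ nz; have [_] := iter_moved n hg th; rewrite nz.
by have [/zg|] := gh z.
Qed.

End DisjointCycles.

(** * The biinvariant extension of a character *)

Section Extension.
Variables (R : realType) (m : nat -> R).
Hypothesis m1 : m 1%N = 1.

(** Power sums of the coloured model: a negative entry x is a pair of odd colours of size -x, and 2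
    (-1)^(k-1) (-x)^k equals -2 x^k. *)
Definition colour_sum (xs : seq R) k := \sum_(x <- xs) (if x < 0 then - 2 * x ^+ k else x ^+ k).

Section Colours.
Variables (xs : seq R) (M : nat).
Local Notation Col := ('I_(size xs) * bool)%type.

(** Every entry is given two colours for uniformity; for a nonnegative entry both are fixed by the
    involution and the second one has size 0, hence is invisible. *)
Definition colour_star (c : Col) : Col := (c.1, (xs`_c.1 < 0) (+) c.2).
Definition colour_size (c : Col) : R :=
  if (xs`_c.1 < 0) || c.2 then `|xs`_c.1| else 0.

Lemma colour_starK : involutive colour_star.
Proof. by case=> i b; rewrite /colour_star /= addbA addbb. Qed.

Lemma colour_star_odd c : (colour_star c != c) = (xs`_c.1 < 0).
Proof. by case: c => i []; rewrite /colour_star xpair_eqE eqxx /=; case: ltP. Qed.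

Lemma colour_star_half c : colour_star c != c -> (colour_star c).2 = ~~ c.2.
Proof. by rewrite colour_star_odd /colour_star /= => ->. Qed.

Lemma colour_size_ge0 c : 0 <= colour_size c.
Proof. by rewrite /colour_size; case: ifP. Qed.

Lemma colour_size_star c : colour_size (colour_star c) = colour_size c.
Proof. by case: c => i b; rewrite /colour_size /colour_star /=; case: ltP. Qed.

Definition coloured (g : {perm 'I_M * bool}) :=
  colour_kernel colour_star snd colour_size (oppp 'I_M) (oppp 'I_M ^ g)%g.

Lemma colour_sumE k : (0 < k)%N ->
  \sum_c (if odd_colour colour_star c then (-1) ^+ k.-1 else 1) * colour_size c ^+ k
  = colour_sum xs k.
Proof.
case: k => // k _; rewrite /colour_sum (big_nth 0) big_mkord.
rewrite -(pair_bigA _ (fun i b => (if odd_colour colour_star (i, b) then (-1) ^+ k else 1) *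
  colour_size (i, b) ^+ k.+1)) /=.
apply: eq_bigr => i _; rewrite big_bool /odd_colour !colour_star_odd /colour_size /=.
case: ltP => [x0|x0] /=; last by rewrite expr0n mulr0 addr0 mul1r ger0_norm.
rewrite -mulr2n ltr0_norm // [(- xs`_i) ^+ _]exprNn [(-1) ^+ k.+1]exprS mulN1r.
by rewrite mulNr mulrN signrMK mulNrn [RHS]mulNr mulr_natl.
Qed.

Lemma coloured_pos (s : {perm 'I_M}) : (0 < size xs)%N ->
  coloured (pos s) = \prod_(C in porbits s) colour_sum xs #|C|.
Proof.
move=> xs0; rewrite /coloured.
rewrite (colour_kernel_pos colour_starK colour_star_half colour_size_ge0 colour_size_star
  (Ordinal xs0, true)).
by apply: eq_bigr => C /imsetP[x _ ->]; rewrite colour_sumE // lt0n card_porbit_neq0.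
Qed.

Lemma oppp_hyperJ k : k \in hyper 'I_M -> (oppp 'I_M ^ k = oppp 'I_M)%g.
Proof. by move=> /cent1P kK; rewrite conjgE -kK mulKg. Qed.

Lemma coloured_biinvariant k1 g k2 : k1 \in hyper 'I_M -> k2 \in hyper 'I_M ->
  coloured (k1 * g * k2)%g = coloured g.
Proof.
move=> k1K k2K; rewrite /coloured !conjgM (oppp_hyperJ k1K).
by rewrite -{1}(oppp_hyperJ k2K) (colour_kernelJ _ _ colour_starK).
Qed.

(** Conjugating both matchings by the inverse of [g] makes one depend on [g] only and the other on
    [h] only. *)
Lemma coloured_gram (g h : {perm 'I_M * bool}) :
  coloured (h^-1 * g)%g =
  \sum_x colour_feature colour_star snd colour_size (oppp 'I_M ^ g^-1)%g x *
         colour_feature colour_star snd colour_size (oppp 'I_M ^ h^-1)%g x.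
Proof.
rewrite /coloured -(colour_kernelJ _ _ colour_starK _ _ g^-1%g) -conjgM mulgK.
rewrite (colour_kernel_gram _ _ colour_starK) //.
- by rewrite -conjVg opppV.
- by rewrite -conjVg opppV.
Qed.

End Colours.

Definition bounded_by M (g : GE) := forall z, (M < `|z|)%N -> g z = z.

Lemma bounded_byW M N g : (M <= N)%N -> bounded_by M g -> bounded_by N g.
Proof. by move=> MN gM z Nz; apply: gM; exact: leq_ltn_trans Nz. Qed.

Lemma bounded_emb M (h : {perm 'I_M * bool}) : bounded_by M (emb h).
Proof.
by move=> z Mz; apply: emb_dec; apply/eqP; rewrite dec_None Mz orbT.
Qed.

Lemma GE_hyper_pos_hyper M g : bounded_by M g -> exists k1 s k2,
  [/\ KE k1 /\ bounded_by M k1, Sinfty s /\ bounded_by M s,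
      KE k2 /\ bounded_by M k2 & g = (k1 * s * k2)%g].
Proof.
move=> /emb_onto[h ->].
have /hyper_pos_hyper[k1 [s [k2 [[k1K _] _ [k2K _] ->]]]] : perm_on (signed [set: 'I_M]%SET) h.
  by apply/fintype.subsetP => x; rewrite !inE.
exists (emb k1), (emb (pos s)), (emb k2); rewrite !embM.
by split => //; split; rewrite ?emb_KE //; [exact: bounded_emb|exact: emb_pos|exact: bounded_emb..].
Qed.

(** A decomposition exists by [GE_hyper_pos_hyper], so the default 0 is never met; when [m] is a
    limit of colour sums, the value is independent of the decomposition by
    [cycle_product_double_coset]. *)
Definition extension (g : GE) : R := xget 0 [set r | exists k1 s k2,
  [/\ KE k1, Sinfty s, KE k2, g = (k1 * s * k2)%g & r = cycle_product m s]].

Variable xs : nat -> seq R.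
Hypothesis xs_gt0 : forall j, (0 < size (xs j))%N.
Hypothesis xs_cvg : forall k, (0 < k)%N -> (colour_sum (xs j) k) @[j --> \oo] --> m k.

Lemma coloured_cvg_pos M (s : {perm 'I_M}) :
  coloured (xs j) (pos s) @[j --> \oo] --> cycle_product m (emb (pos s)).
Proof.
rewrite cycle_product_emb //.
under eq_fun do rewrite coloured_pos //.
apply: cvg_big => [|C /imsetP[x _ ->]]; first exact: mul_continuous.
by apply: xs_cvg; rewrite lt0n card_porbit_neq0.
Qed.

Lemma coloured_cvg_hyper M (h : {perm 'I_M * bool}) k1 s k2 :
  KE k1 -> bounded_by M k1 -> Sinfty s -> bounded_by M s ->
  KE k2 -> bounded_by M k2 -> emb h = (k1 * s * k2)%g ->
  coloured (xs j) h @[j --> \oo] --> cycle_product m s.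
Proof.
move=> + /emb_onto[h1 k1E] sS /emb_onto_pos/(_ sS)[t sE] + /emb_onto[h2 k2E].
rewrite {}k1E {}sE {}k2E !emb_KE -!embM => h1K h2K /emb_inj ->.
under eq_fun do rewrite coloured_biinvariant //.
exact: coloured_cvg_pos.
Qed.

(** All six elements live in one finite block, where both values are limits of the same sequence
    [coloured (xs j) h], each term of which is biinvariant. *)
Lemma cycle_product_double_coset k1 s k2 l1 t l2 :
  KE k1 -> Sinfty s -> KE k2 -> KE l1 -> Sinfty t -> KE l2 ->
  (k1 * s * k2 = l1 * t * l2)%g -> cycle_product m s = cycle_product m t.
Proof.
move=> k1K sS k2K l1K tS l2K E.
have [M [k1M sM k2M] [l1M tM l2M]] : exists2 M,
    [/\ bounded_by M k1, bounded_by M s & bounded_by M k2] &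
    [/\ bounded_by M l1, bounded_by M t & bounded_by M l2].
  have [M1 b1] := GE_bounded k1; have [M2 b2] := GE_bounded s.
  have [M3 b3] := GE_bounded k2; have [M4 b4] := GE_bounded l1.
  have [M5 b5] := GE_bounded t; have [M6 b6] := GE_bounded l2.
  by exists (M1 + M2 + M3 + M4 + M5 + M6)%N; split;
    [apply: bounded_byW b1|apply: bounded_byW b2|apply: bounded_byW b3|
     apply: bounded_byW b4|apply: bounded_byW b5|apply: bounded_byW b6]; lia.
have /emb_onto[h hE] : bounded_by M (k1 * s * k2)%g.
  by move=> z Mz; rewrite -[LHS]/(k1 (s (k2 z))) k2M // sM // k1M.
have c1 := coloured_cvg_hyper k1K k1M sS sM k2K k2M (esym hE).
have c2 := coloured_cvg_hyper l1K l1M tS tM l2K l2M (etrans (esym hE) E).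
exact: (cvg_unique _ c1 c2).
Qed.

Lemma extensionE k1 s k2 : KE k1 -> Sinfty s -> KE k2 ->
  extension (k1 * s * k2)%g = cycle_product m s.
Proof.
move=> k1K sS k2K; rewrite /extension; case: xgetP => [r _|/(_ (cycle_product m s))].
  case=> l1 [t [l2 [l1K tS l2K E ->]]].
  by apply: (cycle_product_double_coset l1K tS l2K k1K sS k2K).
by case; exists k1, s, k2.
Qed.

Lemma extension_cvg M (h : {perm 'I_M * bool}) :
  coloured (xs j) h @[j --> \oo] --> extension (emb h).
Proof.
have [k1 [s [k2 [[k1K k1M] [sS sM] [k2K k2M] E]]]] := GE_hyper_pos_hyper (bounded_emb h).
by rewrite E extensionE //; apply: coloured_cvg_hyper E.
Qed.

Lemma KE_mul k l : KE k -> KE l -> KE (k * l)%g.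
Proof.
by move=> kK lK z; rewrite -[LHS]/(k (l (- z))) lK kK.
Qed.

Lemma extension_biinvariant : biinvariant KE extension.
Proof.
move=> k1 g k2 k1K k2K; have [M gM] := GE_bounded g.
have [l1 [s [l2 [[l1K _] [sS _] [l2K _] ->]]]] := GE_hyper_pos_hyper gM.
have -> : (k1 * (l1 * s * l2) * k2 = (k1 * l1) * s * (l2 * k2))%g by rewrite !mulgA.
by rewrite !extensionE //; exact: KE_mul.
Qed.

Lemma KE1 : KE 1%g. Proof. by []. Qed.

Lemma extension_pos s : Sinfty s -> extension s = cycle_product m s.
Proof.
by move=> sS; rewrite -(extensionE KE1 sS KE1) mul1g mulg1.
Qed.

Lemma extension_unique f : biinvariant KE f ->
  (forall s, Sinfty s -> f s = cycle_product m s) -> f = extension.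
Proof.
move=> fK fS; apply/funext => g; have [M gM] := GE_bounded g.
have [k1 [s [k2 [[k1K _] [sS _] [k2K _] ->]]]] := GE_hyper_pos_hyper gM.
by rewrite extensionE // fK // fS.
Qed.

Lemma extensionV g : extension g^-1%g = extension g.
Proof.
have [M /emb_onto[h ->]] := GE_bounded g; rewrite -embV.
apply: (cvg_unique _ (@extension_cvg _ h^-1%g)) => //.
rewrite (_ : (fun j => _) = (fun j => coloured (xs j) h)); first exact: extension_cvg.
apply/funext => j.
have : coloured (xs j) (h^-1 * 1)%g = coloured (xs j) (1^-1 * h)%g.
  by rewrite !coloured_gram; apply: eq_bigr => x _; rewrite mulrC.
by rewrite mulg1 invg1 mul1g.
Qed.

(** For fixed [j] the double sum over [coloured] is a sum over colourings of squares, and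
    nonnegativity passes to the limit. *)
Lemma extension_psd (c : seq (R * GE)) :
  0 <= \sum_(p <- c) \sum_(q <- c) p.1 * q.1 * extension (q.2^-1 * p.2)%g.
Proof.
have [M cM] : exists M, forall p, p \in c -> bounded_by M p.2.
  elim: c => [|p c [M cM]]; first by exists 0%N.
  have [N pN] := GE_bounded p.2; exists (M + N)%N => q; rewrite inE => /orP[/eqP ->|qc].
    by apply: bounded_byW pN; rewrite leq_addl.
  by apply: bounded_byW (cM _ qc); rewrite leq_addr.
have [d cE] : exists d : seq (R * {perm 'I_M * bool}), c = [seq (p.1, emb p.2) | p <- d].
  elim: c cM => [|[a g] c IH] cM; first by exists [::].
  have [d dE] : exists d : seq (R * {perm 'I_M * bool}), c = [seq (p.1, emb p.2) | p <- d].
    by apply: IH => p pc; apply: cM; rewrite inE pc orbT.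
  have /emb_onto[h gE] := cM (a, g) (mem_head _ _).
  by exists ((a, h) :: d); rewrite dE /= -gE.
rewrite {}cE {cM c} big_map.
under eq_bigr do rewrite big_map.
under eq_bigr do under eq_bigr do rewrite /= -embV -embM.
pose S j := \sum_(p <- d) \sum_(q <- d) p.1 * q.1 * coloured (xs j) (q.2^-1 * p.2)%g.
have Scvg : S j @[j --> \oo] -->
    \sum_(p <- d) \sum_(q <- d) p.1 * q.1 * extension (emb (q.2^-1 * p.2)%g).
  apply: cvg_big => [|p _]; first exact: add_continuous.
  apply: cvg_big => [|q _]; first exact: add_continuous.
  by apply: cvgMr; exact: extension_cvg.
rewrite -(cvg_lim _ Scvg) //; apply: limr_ge; first by apply/cvg_ex; eexists; exact: Scvg.
apply: nearW => j; rewrite /S.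
under eq_bigr do under eq_bigr do rewrite coloured_gram mulr_sumr.
under eq_bigr do rewrite exchange_big /=.
rewrite exchange_big /=; apply: sumr_ge0 => x _.
pose T := \sum_(p <- d) p.1 *
  colour_feature (@colour_star (xs j)) snd (@colour_size (xs j)) (oppp 'I_M ^ p.2^-1)%g x.
rewrite [leRHS](_ : _ = T ^+ 2) ?sqr_ge0 // expr2 /T mulr_suml.
apply: eq_bigr => p _; rewrite mulr_sumr; apply: eq_bigr => q _.
by rewrite mulrACA.
Qed.

End Extension.

(** * Moving finite supports to disjoint blocks, and mixing *)

Section BlockMoves.
Variables M l : nat.

(** The exchange of the initial block of length [M] with the block number [l]; the identity for
    [l = 0]. *)
Definition block_swap (k : nat) : nat :=
  if (k < M)%N then (k + l * M)%N
  else if (l * M <= k < l.+1 * M)%N then (k - l * M)%N else k.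

Lemma block_swapK : involutive block_swap.
Proof.
move=> k; rewrite /block_swap mulSn.
have : (l * M = 0 \/ M <= l * M)%N.
  by case: (posnP l) => [->|l0]; [left|right; rewrite leq_pmull].
move: (l * M)%N => q q0; case: (ltnP k M) => kM.
  by case: (ltnP (k + q) M) => ?; [lia|rewrite ifT; lia].
by case: (boolP (q <= k < M + q)%N) => ?; [rewrite ifT; lia|rewrite ifF ?ifF; lia].
Qed.

Definition block_fun (z : int) : int :=
  match z with
  | Posz 0 => 0
  | Posz k.+1 => Posz (block_swap k).+1
  | Negz k => Negz (block_swap k)
  end.

Lemma block_funK : involutive block_fun.
Proof. by case=> [[|k]|k] //=; rewrite block_swapK. Qed.

Lemma block_swap_out k : (l.+1 * M <= k)%N -> block_swap k = k.
Proof.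
rewrite /block_swap mulSn => kM; rewrite ifF; last by apply/negbTE; lia.
by rewrite ifF //; apply/negbTE; lia.
Qed.

Lemma block_fun_bijection : finite_bijection0 block_fun.
Proof.
split => //; first by exists block_fun; exact: block_funK.
apply: (@sub_finite_set _ _ ((Posz @` `I_(l.+1 * M).+1) `|` (Negz @` `I_(l.+1 * M)))).
  move=> [[|k]|k] //= kM; [left|right].
    exists k.+1 => //=; rewrite ltnS ltnNge; apply/negP => h; apply: kM.
    by rewrite block_swap_out.
  exists k => //=; rewrite ltnNge; apply/negP => h; apply: kM.
  by rewrite block_swap_out.
by rewrite finite_setU; split; exact: finite_image.
Qed.

Definition block_move : GE := GE_of block_fun_bijection.

Lemma block_moveV : block_move^-1%g = block_move.
Proof.
have bb : (block_move * block_move = 1)%g by apply: GE_ext => z; exact: block_funK.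
by rewrite -[LHS]mulg1 -bb mulgA mulVg mul1g.
Qed.

Lemma KE_block_move : KE block_move.
Proof. by case=> [[|k]|[|k]]. Qed.

Lemma block_move_lt0 z : z < 0 -> block_move z < 0.
Proof. by case: z => [[|k]|k]. Qed.

Definition moved (g : GE) : GE := (block_move * g * block_move)%g.

Lemma movedE g z : moved g z = block_fun (g (block_fun z)).
Proof. by []. Qed.

Lemma movedM g h : moved (g * h)%g = (moved g * moved h)%g.
Proof. by apply: GE_ext => z; rewrite -[RHS]/(moved g (moved h z)) !movedE block_funK. Qed.

Lemma moved_KE g : KE g -> KE (moved g).
Proof. by move=> gK; apply: KE_mul KE_block_move; apply: KE_mul => //; exact: KE_block_move. Qed.

Lemma moved_Sinfty g : Sinfty g -> Sinfty (moved g).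
Proof.
by move=> gS z z0; rewrite movedE gS ?block_funK //; exact: block_move_lt0.
Qed.

Lemma moved_fix g z : bounded_by M g ->
  ~~ (l * M < `|z| <= l.+1 * M)%N -> moved g z = z.
Proof.
move=> gM zl; have [_ _ g0] := GEP g; rewrite movedE.
suff -> : g (block_fun z) = block_fun z by rewrite block_funK.
have sw k : ~~ (l * M < k.+1 <= l.+1 * M)%N -> (M < (block_swap k).+1)%N.
  rewrite /block_swap mulSn.
  have : (l * M = 0 \/ M <= l * M)%N.
    by case: (posnP l) => [->|l0]; [left|right; rewrite leq_pmull].
  move: (l * M)%N => q q0; case: (ltnP k M) => kM; first by lia.
  by case: (boolP (q <= k < M + q)%N) => ?; lia.
case: z zl => [[|k]|k] /= zl; rewrite ?g0 // gM // sw //.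
Qed.
End BlockMoves.

Lemma mulg_interchange (G : groupType) (a s b c t d : G) :
  (b * c = c * b -> s * c = c * s -> b * t = t * b ->
   a * s * b * (c * t * d) = a * c * (s * t) * (b * d))%g.
Proof.
move=> bc sc bt; rewrite !mulgA -(mulgA _ b c) bc !mulgA -(mulgA a s c) sc !mulgA.
by rewrite -(mulgA _ b t) bt !mulgA.
Qed.

Section Mixing.
Variables (R : realType) (m : nat -> R) (xs : nat -> seq R).
Hypothesis m1 : m 1%N = 1.
Hypothesis xs_gt0 : forall j, (0 < size (xs j))%N.
Hypothesis xs_cvg : forall k, (0 < k)%N -> (colour_sum (xs j) k) @[j --> \oo] --> m k.

Local Notation f := (extension m).

Lemma extension_moved M l g : f (moved M l g) = f g.
Proof.
apply: (extension_biinvariant m1 xs_gt0 xs_cvg); exact: KE_block_move.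
Qed.

Lemma moved_disjoint M l l' g h z : bounded_by M g -> bounded_by M h -> l != l' ->
  moved M l g z = z \/ moved M l' h z = z.
Proof.
move=> gM hM ll'.
have [zl|zl] := boolP (l * M < `|z| <= l.+1 * M)%N; last by left; exact: moved_fix.
right; rewrite moved_fix //; apply: contra ll' => zl'; apply/eqP.
move: zl zl'; rewrite !mulSn; nia.
Qed.

(** The two translates have disjoint supports, so their K S K decompositions combine into a single
    one, whose middle factor has the cycles of both. *)
Lemma extension_moved_mul M l l' g h : bounded_by M g -> bounded_by M h ->
  l != l' -> f (moved M l g * moved M l' h)%g = f g * f h.
Proof.
move=> gM hM ll'.
have [k1 [s [k2 [[k1K k1M] [sS sM] [k2K k2M] gE]]]] := GE_hyper_pos_hyper gM.
have [l1 [t [l2 [[l1K l1M] [tS tM] [l2K l2M] hE]]]] := GE_hyper_pos_hyper hM.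
have c1 : (moved M l k2 * moved M l' l1 = moved M l' l1 * moved M l k2)%g.
  by apply: disjoint_mulC => z; exact: moved_disjoint.
have c2 : (moved M l s * moved M l' l1 = moved M l' l1 * moved M l s)%g.
  by apply: disjoint_mulC => z; exact: moved_disjoint.
have c3 : (moved M l k2 * moved M l' t = moved M l' t * moved M l k2)%g.
  by apply: disjoint_mulC => z; exact: moved_disjoint.
have -> : (moved M l g * moved M l' h =
    (moved M l k1 * moved M l' l1) * (moved M l s * moved M l' t) *
    (moved M l k2 * moved M l' l2))%g.
  rewrite gE hE !movedM; exact: mulg_interchange.
have mK k l0 : KE k -> KE (moved M l0 k) by exact: moved_KE.
rewrite (extensionE m1 xs_gt0 xs_cvg) //; try by apply: KE_mul; exact: mK.
  rewrite cycle_productM; last by move=> z; exact: moved_disjoint.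
  rewrite -!(extension_pos m1 xs_gt0 xs_cvg); try exact: moved_Sinfty.
  rewrite !extension_moved gE hE !(extensionE m1 xs_gt0 xs_cvg) //.
  by rewrite !(extension_pos m1 xs_gt0 xs_cvg).
by move=> z z0; rewrite -[LHS]/(moved M l s (moved M l' t z)) !moved_Sinfty.
Qed.

(** The elements of [gs] lie in a common block [M], and [tau l] is an involution in K^E sending this
    block to the l-th one; biinvariance turns the argument of [f] into a product of two conjugates
    with disjoint supports. *)
Lemma extension_mixing (gs : seq GE) : exists tau : nat -> GE,
  (forall l, KE (tau l)) /\
  forall l l' g h, l != l' -> g \in gs -> h \in gs ->
    f ((tau l' * h)^-1 * (tau l * g))%g = f h^-1%g * f g.
Proof.
have [M gsM] : exists M, forall g, g \in gs -> bounded_by M g.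
  elim: gs => [|p c [M cM]]; first by exists 0%N.
  have [N pN] := GE_bounded p; exists (M + N)%N => q; rewrite inE => /orP[/eqP ->|qc].
    by apply: bounded_byW pN; rewrite leq_addl.
  by apply: bounded_byW (cM _ qc); rewrite leq_addr.
exists (block_move M); split => [l|l l' g h ll' gM hM]; first exact: KE_block_move.
have hV : bounded_by M h^-1%g.
  move=> z Mz; have := gsM h hM z Mz; move=> {1}<-.
  by rewrite -[LHS]/((h^-1 * h)%g z) mulVg.
have := extension_moved_mul hV (gsM g gM) (l := l') (l' := l); rewrite eq_sym => /(_ ll') <-.
have KB l0 : KE (block_move M l0) by exact: KE_block_move.
rewrite -(extension_biinvariant m1 xs_gt0 xs_cvg _ (KB l') (KB l)).
by rewrite /moved invMg block_moveV !mulgA.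
Qed.
End Mixing.

(** * The GNS representation *)

Lemma discriminant_le0 (R : realType) (a b s : R) : 0 <= b ->
  (forall t, 0 <= a + 2 * t * s + t ^+ 2 * b) -> s ^+ 2 <= a * b.
Proof.
move=> b0 h; have [b_gt0|] := ltP 0 b.
  have := h (- s / b); rewrite -(pmulr_lge0 _ b_gt0).
  rewrite [X in 0 <= X](_ : _ = a * b - s ^+ 2) ?subr_ge0 //.
  by field; rewrite gt_eqF.
move=> b_le0; have b_eq0 : b = 0 by apply/le_anti; rewrite b_le0.
rewrite b_eq0 mulr0; have [->|s0] := eqVneq s 0; first by rewrite expr0n.
(* For b = 0 the form is affine in t, and this t gives it the value -1. *)
have := h (- (a + 1) / (2 * s)).
rewrite b_eq0 mulr0 addr0 (_ : a + _ = -1) ?oppr_ge0 ?ler10 //.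
by field.
Qed.

Lemma cauchy_cvgn (R : realType) (x : nat -> R) :
  (forall e, 0 < e -> exists N, forall n m, (N <= n)%N -> (N <= m)%N ->
     `|x n - x m| <= e) -> cvgn x.
Proof.
move=> h; apply/cauchy_cvgP/cauchy_exP => _/posnumP[e].
have [N hN] := h (e%:num / 2) ltac:(by []).
exists (x N); exists N => // n /= Nn; rewrite /ball /=.
by apply: le_lt_trans (hN N n (leqnn _) Nn) _; rewrite ltr_pdivrMr // ltr_pMr // ltr1n.
Qed.

(** Real-valued functions: the Hilbert space is first built over the reals and complexified
    afterwards. *)
Record posdef (R : realType) (G : groupType) := PosDef {
  posdef_fun :> G -> R;
  posdefV : forall g, posdef_fun g^-1%g = posdef_fun g;
  posdef_ge0 : forall c : seq (R * G),
    0 <= \sum_(p <- c) \sum_(q <- c) p.1 * q.1 * posdef_fun (q.2^-1 * p.2)%g }.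

Section GNS.
Variables (R : realType) (G : groupType) (f : posdef R G).
Implicit Types (c d : seq (R * G)) (u v : G -> R) (C D : nat -> seq (R * G)).

(** Lists stand for formal real combinations of group elements; the inner product of the points g
    and h is f (h^-1 g). *)
Definition gform c d := \sum_(p <- c) \sum_(q <- d) p.1 * q.1 * f (q.2^-1 * p.2)%g.
Definition gscale (a : R) c := [seq (a * p.1, p.2) | p <- c].
Definition gact (g : G) c := [seq (p.1, (g * p.2)%g) | p <- c].
Definition gsub c d := c ++ gscale (-1) d.
Definition gpoint (x : G) : seq (R * G) := [:: (1, x)].

Lemma gformC c d : gform c d = gform d c.
Proof.
rewrite /gform exchange_big; apply: eq_bigr => q _; apply: eq_bigr => p _.
by rewrite -[f _]posdefV invMg invgK (mulrC p.1).
Qed.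

Lemma gformDl c c' d : gform (c ++ c') d = gform c d + gform c' d.
Proof. by rewrite /gform big_cat. Qed.

Lemma gformZl a c d : gform (gscale a c) d = a * gform c d.
Proof.
rewrite /gform big_map mulr_sumr; apply: eq_bigr => p _ /=.
by rewrite mulr_sumr; apply: eq_bigr => q _; rewrite !mulrA.
Qed.

Lemma gformDr c d d' : gform c (d ++ d') = gform c d + gform c d'.
Proof. by rewrite ![gform c _]gformC gformDl. Qed.

Lemma gformZr a c d : gform c (gscale a d) = a * gform c d.
Proof. by rewrite ![gform c _]gformC gformZl. Qed.

Lemma gformBl c c' d : gform (gsub c c') d = gform c d - gform c' d.
Proof. by rewrite gformDl gformZl mulN1r. Qed.

Lemma gformBr c d d' : gform c (gsub d d') = gform c d - gform c d'.
Proof. by rewrite gformDr gformZr mulN1r. Qed.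

Lemma gform_ge0 c : 0 <= gform c c. Proof. exact: posdef_ge0. Qed.

Lemma gform_act g c d : gform (gact g c) (gact g d) = gform c d.
Proof.
rewrite /gform big_map; apply: eq_bigr => p _; rewrite big_map; apply: eq_bigr => q _ /=.
by rewrite invMg -mulgA mulKg.
Qed.

Lemma gform_CS c d : gform c d ^+ 2 <= gform c c * gform d d.
Proof.
apply: discriminant_le0; first exact: gform_ge0.
move=> t; have := gform_ge0 (c ++ gscale t d).
rewrite !(gformDl, gformDr, gformZl, gformZr) [gform d c]gformC.
by congr (_ <= _); ring.
Qed.

Lemma gform_sub_le c d e :
  gform (gsub c e) (gsub c e) <=
  2 * gform (gsub c d) (gsub c d) + 2 * gform (gsub d e) (gsub d e).
Proof.
have := gform_ge0 (gsub (gsub c d) (gsub d e)).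
rewrite !(gformBl, gformBr) ![gform d c]gformC ![gform e _]gformC.
lra.
Qed.

Definition gcauchy C := forall e : R, 0 < e -> exists N, forall n m,
  (N <= n)%N -> (N <= m)%N -> gform (gsub (C n) (C m)) (gsub (C n) (C m)) <= e.

(** A point of the completion is represented by the function of its inner products with the group
    elements, which determines it. The completion is thus a space of functions, and no quotient is
    taken. *)
Definition gapprox C u :=
  gcauchy C /\ forall x, gform (C n) (gpoint x) @[n --> \oo] --> u x.

Lemma gcauchy_bounded C : gcauchy C -> exists2 B, 0 < B &
  \forall n \near \oo, gform (C n) (C n) <= B.
Proof.
move=> /(_ 1 ltr01) [N hN].
exists (2 + 2 * gform (C N) (C N)).
  by rewrite ltr_wpDr ?mulr_ge0 ?gform_ge0.
near=> n.
have e0 c : gform (gsub c [::]) (gsub c [::]) = gform c c by rewrite /gsub /= cats0.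
rewrite -e0; apply: le_trans (gform_sub_le (C n) (C N) [::]) _.
rewrite e0 lerD2r ler_piMr //; apply: hN => //.
by near: n; exact: nbhs_infty_ge.
Unshelve. all: end_near. Qed.

Lemma gform_small c d (B e : R) : 0 < B -> 0 <= e -> gform d d <= B ->
  gform c c <= e ^+ 2 / B -> `|gform c d| <= e.
Proof.
move=> B0 e0 dB cB; rewrite -(@ler_pXn2r _ 2%N) // ?nnegrE // real_normK ?num_real //.
apply: le_trans (gform_CS c d) _.
have -> : e ^+ 2 = e ^+ 2 / B * B by rewrite divfK // gt_eqF.
by apply: ler_pM; rewrite ?gform_ge0.
Qed.

Lemma gform_cauchy_cvg C D : gcauchy C -> gcauchy D ->
  cvgn (fun n => gform (C n) (D n)).
Proof.
move=> hC hD; have [B B0 hB] := gcauchy_bounded hC; have [B' B'0 hB'] := gcauchy_bounded hD.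
apply: cauchy_cvgn => e e0.
have e20 : 0 <= e / 2 by rewrite divr_ge0 // ltW.
have e2 K : 0 < K -> 0 < (e / 2) ^+ 2 / K by move=> K0; rewrite divr_gt0 ?exprn_gt0 ?divr_gt0.
have [N1 hN1] := hC _ (e2 _ B'0); have [N2 hN2] := hD _ (e2 _ B0).
move: hB hB' => [N3 _ hN3] [N4 _ hN4].
exists (maxn (maxn N1 N2) (maxn N3 N4)) => n m.
rewrite !geq_max => /andP[/andP[n1 n2] /andP[n3 n4]] /andP[/andP[m1 m2] /andP[m3 m4]].
have -> : gform (C n) (D n) - gform (C m) (D m) =
   gform (gsub (C n) (C m)) (D n) + gform (gsub (D n) (D m)) (C m).
  by rewrite !gformBl [gform (D n) (C m)]gformC [gform (D m) (C m)]gformC; ring.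
apply: le_trans (ler_normD _ _) _; rewrite [e in _ <= e](splitr e); apply: lerD.
  by apply: (@gform_small _ _ B') => //; [exact: hN4|exact: hN1].
by apply: (@gform_small _ _ B) => //; [exact: hN3|exact: hN2].
Qed.

Lemma gcauchyB C D : gcauchy C -> gcauchy D -> gcauchy (fun n => gsub (C n) (D n)).
Proof.
move=> hC hD e e0.
have e4 : 0 < e / 4 by rewrite divr_gt0.
have [N1 hN1] := hC _ e4; have [N2 hN2] := hD _ e4.
exists (maxn N1 N2) => n m; rewrite !geq_max => /andP[n1 n2] /andP[m1 m2].
have := hN1 n m n1 m1; have := hN2 n m n2 m2.
have := gform_ge0 (gsub (gsub (C n) (C m)) (gsub (D m) (D n))).
rewrite !(gformBl, gformBr).
rewrite [gform (D m) (C n)]gformC [gform (D m) (C m)]gformC.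
rewrite [gform (D n) (C n)]gformC [gform (D n) (C m)]gformC.
rewrite [gform (C m) (C n)]gformC [gform (D m) (D n)]gformC.
lra.
Qed.

(** This makes the representation by functions faithful. The sequence becomes orthogonal to every
    fixed combination, in particular to [C N2] for a large [N2], while [C n] stays close to [C N2];
    so its norm tends to 0. *)
Lemma gcauchy_null C : gcauchy C ->
  (forall x, gform (C n) (gpoint x) @[n --> \oo] --> (0 : R)) ->
  gform (C n) (C n) @[n --> \oo] --> (0 : R).
Proof.
move=> hC C0.
have C0' d : gform (C n) d @[n --> \oo] --> (0 : R).
  elim: d => [|[a x] d IHd].
    rewrite (_ : (fun n => _) = fun=> 0); first exact: cvg_cst.
    apply/funext => n; rewrite /gform big1 // => p _; exact: big_nil.
  rewrite (_ : (fun n => _) = (fun n => a * gform (C n) (gpoint x) + gform (C n) d)).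
    rewrite -[X in _ --> X]addr0 -{1}(mulr0 a).
    by apply: cvgD => //; apply: cvgMr; exact: C0.
  apply/funext => n; rewrite -gformZr -gformDr /gscale /=; congr gform.
  by rewrite mulr1.
have [B B0 [N1 _ hB]] := gcauchy_bounded hC.
apply/cvgrPdist_le => e e0.
have e2 : 0 < e / 2 by rewrite divr_gt0.
have [N2 hN2] : exists N, forall n m, (N <= n)%N -> (N <= m)%N ->
    gform (gsub (C n) (C m)) (gsub (C n) (C m)) <= (e / 2) ^+ 2 / B.
  by apply: hC; rewrite divr_gt0 ?exprn_gt0.
have /cvgrPdist_le/(_ _ e2)[N3 _ hN3] := C0' (C N2).
exists (maxn N1 (maxn N2 N3)) => // n /=; rewrite !geq_max => /and3P[n1 n2 n3].
rewrite sub0r normrN.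
have -> : gform (C n) (C n) = gform (C n) (C N2) + gform (gsub (C n) (C N2)) (C n).
  by rewrite gformBl [gform (C N2) _]gformC; ring.
apply: le_trans (ler_normD _ _) _; rewrite [e in _ <= e](splitr e); apply: lerD.
  by have := hN3 n n3; rewrite sub0r normrN.
by apply: (@gform_small _ _ B) => //; [exact: ltW|exact: hB|exact: hN2].
Qed.

Lemma gapprox_unique C D u : gapprox C u -> gapprox D u ->
  gform (gsub (C n) (D n)) (gsub (C n) (D n)) @[n --> \oo] --> (0 : R).
Proof.
move=> [hC Cu] [hD Du]; apply: (gcauchy_null (gcauchyB hC hD)) => x.
under eq_fun do rewrite gformBl.
by rewrite -(subrr (u x)); apply: cvgB.
Qed.

Definition gseq u : nat -> seq (R * G) := xget (fun=> [::]) [set C | gapprox C u].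

Definition gns_mem : {pred G -> R} := fun u => `[< exists C, gapprox C u >].

Lemma gseqP u : u \in gns_mem -> gapprox (gseq u) u.
Proof. by move=> /asboolP[C Cu]; rewrite /gseq; case: xgetP => [D _ //|/(_ C)]. Qed.

End GNS.

Arguments gpoint {R G}.

HB.lock Definition ginner (R : realType) (G : groupType) (f : posdef R G)
    (u v : G -> R) : R :=
  lim (gform f (gseq f u n) (gseq f v n) @[n --> \oo]).

Section GNSSpace.
Variables (R : realType) (G : groupType) (f : posdef R G).
Implicit Types (c d : seq (R * G)) (u v : G -> R) (C D : nat -> seq (R * G)).
Local Notation ginner := (ginner f).
Local Notation gform := (gform f).
Local Notation gcauchy := (gcauchy f).
Local Notation gapprox := (gapprox f).
Local Notation gseq := (gseq f).
Local Notation gform_ge0 := (gform_ge0 f).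
Local Notation gform_act := (gform_act f).
Local Notation gns_mem := (gns_mem f).

Lemma gform_cvg_null C D E : gcauchy D ->
  gform (gsub (C n) (E n)) (gsub (C n) (E n)) @[n --> \oo] --> (0 : R) ->
  gform (C n) (D n) - gform (E n) (D n) @[n --> \oo] --> (0 : R).
Proof.
move=> hD CE; have [B B0 hB] := gcauchy_bounded hD.
apply/cvgrPdist_le => e e0.
have e2 : 0 < e ^+ 2 / B by rewrite divr_gt0 ?exprn_gt0.
have /cvgrPdist_le/(_ _ e2) hCE := CE.
near=> n; rewrite sub0r normrN -gformBl.
apply: (gform_small B0 (ltW e0)); first by near: n.
apply: le_trans (ler_norm _) _; rewrite -normrN -sub0r.
by near: n.
Unshelve. all: end_near. Qed.

(** Independence of the approximating sequences: they are replaced one at a time, and each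
    replacement changes the form by a null sequence because the other sequence is bounded. *)
Lemma ginner_cvg C D u v : gapprox C u -> gapprox D v ->
  gform (C n) (D n) @[n --> \oo] --> ginner u v.
Proof.
move=> Cu Dv.
have um : u \in gns_mem by apply/asboolP; exists C.
have vm : v \in gns_mem by apply/asboolP; exists D.
have [cu cv] := (gseqP um, gseqP vm).
have h1 := gform_cvg_null Dv.1 (gapprox_unique Cu cu).
have h2 := gform_cvg_null cu.1 (gapprox_unique Dv cv).
have h3 : gform (gseq u n) (gseq v n) @[n --> \oo] --> ginner u v.
  by rewrite ginner.unlock; exact: (gform_cauchy_cvg cu.1 cv.1).
rewrite -[ginner u v]add0r -[X in X + _]addr0.
rewrite (_ : (fun n => gform (C n) (D n)) = (fun n =>
   (gform (C n) (D n) - gform (gseq u n) (D n)) +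
   (gform (D n) (gseq u n) - gform (gseq v n) (gseq u n)) +
   gform (gseq u n) (gseq v n))).
  by apply: cvgD => //; apply: cvgD.
apply/funext => n; rewrite [gform (D n) _]gformC [gform (gseq v n) _]gformC.
by ring.
Qed.

Lemma gapproxD C D u v : gapprox C u -> gapprox D v ->
  gapprox (fun n => C n ++ D n) (u + v).
Proof.
move=> [hC Cu] [hD Dv]; split; last first.
  move=> x; under eq_fun do rewrite gformDl.
  by apply: cvgD.
move=> e e0.
have e4 : 0 < e / 4 by rewrite divr_gt0.
have [N1 hN1] := hC _ e4; have [N2 hN2] := hD _ e4.
exists (maxn N1 N2) => n m; rewrite !geq_max => /andP[n1 n2] /andP[m1 m2].
have := hN1 n m n1 m1; have := hN2 n m n2 m2.
have := gform_ge0 (gsub (gsub (C n) (C m)) (gsub (D n) (D m))).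
rewrite !(gformBl, gformBr, gformDl, gformDr).
rewrite [gform (D m) (C n)]gformC [gform (D m) (C m)]gformC.
rewrite [gform (D n) (C n)]gformC [gform (D n) (C m)]gformC.
rewrite [gform (C m) (C n)]gformC [gform (D m) (D n)]gformC.
lra.
Qed.

Lemma gapproxZ a C u : gapprox C u -> gapprox (fun n => gscale a (C n)) (a *: u).
Proof.
move=> [hC Cu]; split; last first.
  move=> x; under eq_fun do rewrite gformZl.
  by apply: cvgMr; exact: Cu.
move=> e e0.
have [N hN] := hC (e / (a ^+ 2 + 1)) (divr_gt0 e0 (ltr_wpDl (sqr_ge0 a) ltr01)).
exists N => n m Nn Nm; have := hN n m Nn Nm.
rewrite ler_pdivlMr; last by rewrite ltr_wpDl ?sqr_ge0.
have := gform_ge0 (gsub (C n) (C m)).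
rewrite !(gformBl, gformBr, gformZl, gformZr).
set q := _ - _ - _ => q0 h; apply: le_trans h.
rewrite mulrDr mulr1; apply: le_trans (_ : q * a ^+ 2 <= _); last by rewrite lerDl.
by rewrite /q; rewrite le_eqVlt; apply/orP; left; apply/eqP; ring.
Qed.

Lemma gapprox_act g C u : gapprox C u ->
  gapprox (fun n => gact g (C n)) (fun x => u (g^-1 * x)%g).
Proof.
have subact c d : gsub (gact g c) (gact g d) = gact g (gsub c d).
  by rewrite /gsub /gact map_cat /gscale -!map_comp.
move=> [hC Cu]; split.
  move=> e e0; have [N hN] := hC e e0; exists N => n m Nn Nm.
  by rewrite subact gform_act; exact: hN.
move=> x; have := Cu (g^-1 * x)%g; apply: cvg_trans.
rewrite (_ : (fun n => _) = (fun n => gform (C n) (gpoint (g^-1 * x)%g))) //.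
apply/funext => n; rewrite -(gform_act g (C n)); congr gform.
by rewrite /gact /gpoint /= mulKVg.
Qed.

Definition gvec c : G -> R := fun x => gform c (gpoint x).

Lemma gapprox_cst c : gapprox (fun=> c) (gvec c).
Proof.
split; last by move=> x; exact: cvg_cst.
move=> e e0; exists 0%N => n m _ _.
by rewrite !(gformBl, gformBr) !subrr ltW.
Qed.

Fact gns_submod : submod_closed gns_mem.
Proof.
split; first by apply/asboolP; exists (fun=> [::]); have := gapprox_cst [::];
  rewrite (_ : gvec [::] = 0) //; apply/funext => x; rewrite /gvec /gform big_nil.
move=> a u v /asboolP[C Cu] /asboolP[D Dv]; apply/asboolP.
by eexists; apply: gapproxD Dv; apply: gapproxZ Cu.
Qed.

HB.instance Definition _ := GRing.isSubmodClosed.Build R (G -> R) gns_mem gns_submod.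

Record gns := Gns { gns_fun :> G -> R; _ : gns_fun \in gns_mem }.
HB.instance Definition _ := [isSub for gns_fun].
HB.instance Definition _ := [Choice of gns by <:].
HB.instance Definition _ := [SubChoice_isSubLmodule of gns by <:].

Implicit Types (w z : gns).

Lemma gns_ext w z : (forall x, w x = z x) -> w = z.
Proof. by move=> wz; apply: val_inj; apply/funext. Qed.

Lemma gns_addE w z x : (w + z) x = w x + z x. Proof. by []. Qed.
Lemma gns_scaleE a w x : (a *: w) x = a * w x. Proof. by []. Qed.

Lemma gns_oppE w x : (- w) x = - w x. Proof. by []. Qed.

Lemma gns_approx w : gapprox (gseq w) w.
Proof. by apply: gseqP; case: w. Qed.

Lemma ginnerC w z : ginner w z = ginner z w.
Proof.
apply: (cvg_unique _ (ginner_cvg (gns_approx w) (gns_approx z))) => //.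
rewrite /mkset; under eq_fun do rewrite gformC.
exact: ginner_cvg (gns_approx z) (gns_approx w).
Qed.

Lemma ginnerDl w w' z : ginner (w + w') z = ginner w z + ginner w' z.
Proof.
have h := gapproxD (gns_approx w) (gns_approx w').
apply: (cvg_unique _ (ginner_cvg h (gns_approx z))) => //.
rewrite /mkset; under eq_fun do rewrite gformDl.
by apply: cvgD; apply: ginner_cvg; exact: gns_approx.
Qed.

Lemma ginnerZl a w z : ginner (a *: w) z = a * ginner w z.
Proof.
have h := gapproxZ a (gns_approx w).
apply: (cvg_unique _ (ginner_cvg h (gns_approx z))) => //.
rewrite /mkset; under eq_fun do rewrite gformZl.
by apply: cvgMr; apply: ginner_cvg; exact: gns_approx.
Qed.

Lemma ginnerDr w z z' : ginner w (z + z') = ginner w z + ginner w z'.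
Proof. by rewrite ![ginner w _]ginnerC ginnerDl. Qed.

Lemma ginnerZr a w z : ginner w (a *: z) = a * ginner w z.
Proof. by rewrite ![ginner w _]ginnerC ginnerZl. Qed.

Lemma ginnerNl w z : ginner (- w) z = - ginner w z.
Proof. by rewrite -scaleN1r ginnerZl mulN1r. Qed.

Lemma ginnerNr w z : ginner w (- z) = - ginner w z.
Proof. by rewrite ![ginner w _]ginnerC ginnerNl. Qed.

Lemma ginner_ge0 w : 0 <= ginner w w.
Proof.
have h := ginner_cvg (gns_approx w) (gns_approx w).
rewrite -(cvg_lim _ h) //; apply: limr_ge; first by apply/cvg_ex; eexists; exact: h.
by apply: nearW => n; exact: gform_ge0.
Qed.

Lemma ginner_CS w z : ginner w z ^+ 2 <= ginner w w * ginner z z.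
Proof.
apply: discriminant_le0; first exact: ginner_ge0.
move=> t; have := ginner_ge0 (w + t *: z).
rewrite !(ginnerDl, ginnerDr, ginnerZl, ginnerZr) [ginner z w]ginnerC.
by congr (_ <= _); ring.
Qed.

Fact gvec_gns c : gvec c \in gns_mem.
Proof. by apply/asboolP; exists (fun=> c); exact: gapprox_cst. Qed.

Definition gelt c : gns := Gns (gvec_gns c).

Lemma ginner_elt c d : ginner (gelt c) (gelt d) = gform c d.
Proof.
apply: (cvg_unique _ (ginner_cvg (gapprox_cst c) (gapprox_cst d))) => //.
exact: cvg_cst.
Qed.

Lemma ginner_point w x : ginner w (gelt (gpoint x)) = w x.
Proof.
apply: (cvg_unique _ (ginner_cvg (gns_approx w) (gapprox_cst (gpoint x)))) => //.
exact: (gns_approx w).2.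
Qed.

Lemma geltD c d : gelt (c ++ d) = gelt c + gelt d.
Proof. by apply: gns_ext => x; rewrite gns_addE /= /gvec gformDl. Qed.

Lemma geltZ a c : gelt (gscale a c) = a *: gelt c.
Proof. by apply: gns_ext => x; rewrite gns_scaleE /= /gvec gformZl. Qed.

Lemma geltB c d : gelt (gsub c d) = gelt c - gelt d.
Proof. by rewrite geltD geltZ scaleN1r. Qed.

Lemma ginner_eq0 w : ginner w w = 0 -> w = 0.
Proof.
move=> w0; apply: gns_ext => x; rewrite -ginner_point -[RHS]/(0 : R).
have := ginner_CS w (gelt (gpoint x)); rewrite w0 mul0r => h.
by apply/eqP; rewrite -sqrf_eq0 eq_le h sqr_ge0.
Qed.

Lemma ginner_le2 w z : ginner (w + z) (w + z) <= 2 * ginner w w + 2 * ginner z z.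
Proof.
have := ginner_ge0 (w - z).
rewrite !(ginnerDl, ginnerDr, ginnerNl, ginnerNr) [ginner z w]ginnerC.
lra.
Qed.

Lemma ginner_subC w z : ginner (w - z) (w - z) = ginner (z - w) (z - w).
Proof. by rewrite -opprB ginnerNl ginnerNr opprK. Qed.

Lemma gns_dense C w : gapprox C w -> forall e, 0 < e ->
  exists N, forall n, (N <= n)%N -> ginner (w - gelt (C n)) (w - gelt (C n)) <= e.
Proof.
move=> Cw e e0; have [N hN] := Cw.1 e e0; exists N => n Nn.
have h : gapprox (fun m => gsub (C m) (C n)) (w - gelt (C n)).
  have := gapproxD Cw (gapproxZ (-1) (gapprox_cst (C n))).
  by rewrite scaleN1r.
have h2 := ginner_cvg h h.
rewrite -(cvg_lim _ h2) //; apply: limr_le; first by apply/cvg_ex; eexists; exact: h2.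
by exists N => // m Nm; exact: hN.
Qed.

(** Each [w k] is replaced by a formal combination at squared distance at most 1 / (k + 1). These
    combinations form a Cauchy sequence, and its pointwise limit is the required function. *)
Lemma gns_complete (w : nat -> gns) :
  (forall e, 0 < e -> exists N, forall n m, (N <= n)%N -> (N <= m)%N ->
     ginner (w n - w m) (w n - w m) <= e) ->
  exists z, forall e, 0 < e -> exists N, forall n, (N <= n)%N ->
     ginner (z - w n) (z - w n) <= e.
Proof.
move=> hw.
have hd k : exists c, ginner (w k - gelt c) (w k - gelt c) <= k.+1%:R^-1.
  have [|N hN] := gns_dense (gns_approx (w k)) (e := k.+1%:R^-1).
    by rewrite invr_gt0.
  by exists (gseq (w k) N); exact: hN.
have [d dP] := choice hd.
have small (e : R) : 0 < e -> exists N, forall n, (N <= n)%N -> n.+1%:R^-1 <= e.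
  move=> e0; have := near_infty_natSinv_lt (PosNum e0) => -[N _ hN].
  by exists N => n Nn; exact/ltW/hN.
have dC : gcauchy d.
  (* Two nested uses of [ginner_le2] on the three terms give at most 10 e / 16. *)
  move=> e e0; have e16 : 0 < e / 16 by rewrite divr_gt0.
  have [N1 hN1] := hw _ e16; have [N2 hN2] := small _ e16.
  exists (maxn N1 N2) => n m; rewrite !geq_max => /andP[n1 n2] /andP[m1 m2].
  rewrite -ginner_elt geltB.
  have -> : gelt (d n) - gelt (d m) =
     ((w n - w m) + (w m - gelt (d m))) - (w n - gelt (d n)).
    by apply: gns_ext => x; rewrite !(gns_addE, gns_oppE); ring.
  apply: le_trans (ginner_le2 _ _) _; rewrite ginnerNl ginnerNr opprK.
  have := ginner_le2 (w n - w m) (w m - gelt (d m)).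
  have := hN1 n m n1 m1; have := le_trans (dP n) (hN2 n n2).
  have := le_trans (dP m) (hN2 m m2); lra.
pose u x := lim (gform (d n) (gpoint x) @[n --> \oo]).
have du : gapprox d u.
  by split => // x; apply: gform_cauchy_cvg => //; exact: (gapprox_cst (gpoint x)).1.
have um : u \in gns_mem by apply/asboolP; exists d.
exists (Gns um) => e e0; have e4 : 0 < e / 4 by rewrite divr_gt0.
have [N1 hN1] := @gns_dense _ (Gns um) du _ e4; have [N2 hN2] := small _ e4.
exists (maxn N1 N2) => n; rewrite geq_max => /andP[n1 n2].
have -> : Gns um - w n = (Gns um - gelt (d n)) - (w n - gelt (d n)).
  by apply: gns_ext => x; rewrite !(gns_addE, gns_oppE); ring.
apply: le_trans (ginner_le2 _ _) _; rewrite ginnerNl ginnerNr opprK.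
have := hN1 n n1; have := le_trans (dP n) (hN2 n n2); lra.
Qed.

Fact gns_act_mem g w : (fun x => w (g^-1 * x)%g) \in gns_mem.
Proof.
by apply/asboolP; eexists; apply: gapprox_act; exact: gns_approx.
Qed.

Definition gns_act g w : gns := Gns (gns_act_mem g w).

Lemma gns_actE g w x : gns_act g w x = w (g^-1 * x)%g. Proof. by []. Qed.

Lemma ginner_act g w z : ginner (gns_act g w) (gns_act g z) = ginner w z.
Proof.
apply: (cvg_unique _ (ginner_cvg (gapprox_act g (gns_approx w)) (gapprox_act g (gns_approx z)))) => //.
rewrite /mkset; under eq_fun do rewrite gform_act.
by apply: ginner_cvg; exact: gns_approx.
Qed.
End GNSSpace.

(** * Complexification of the real completion *)

Definition cgns (R : realType) (G : groupType) (f : posdef R G) : Type :=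
  (gns f * gns f)%type.

Section ComplexGNS.
Variables (R : realType) (G : groupType) (f : posdef R G).
Local Notation W := (gns f).
Local Notation H := (cgns f).

HB.instance Definition _ := Choice.on H.
HB.instance Definition _ := GRing.Zmodule.on H.

Implicit Types (w z : H) (a b : R[i]).

Local Notation ginner := (ginner f).
Local Notation Re := complex.Re.
Local Notation Im := complex.Im.
Local Notation gnsE := (gns_addE, gns_scaleE, gns_oppE).

Definition cscale a w : H :=
  (Re a *: w.1 - Im a *: w.2, Re a *: w.2 + Im a *: w.1).

Lemma caddE w z : w + z = (w.1 + z.1, w.2 + z.2). Proof. by []. Qed.

Fact cscaleA a b w : cscale a (cscale b w) = cscale (a * b) w.
Proof.
case: a b w => [a1 a2] [b1 b2] [w1 w2].
rewrite -[_ * _]/((a1 * b1 - a2 * b2) +i* (a1 * b2 + a2 * b1)) /cscale.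
by congr pair; apply: gns_ext => x; cbn [fst snd Re Im]; rewrite !gnsE; ring.
Qed.

Fact cscale1 : left_id 1 cscale.
Proof.
case=> w1 w2; rewrite /cscale -[1]/(1 +i* 0).
by congr pair; apply: gns_ext => x; cbn [fst snd Re Im]; rewrite !gnsE; ring.
Qed.

Fact cscaleDr : right_distributive cscale +%R.
Proof.
move=> [a1 a2] [w1 w2] [z1 z2].
rewrite -[_ + _ in LHS]/((w1 + z1, w2 + z2) : H) /cscale -[RHS]/((_ + _, _ + _) : H).
by congr pair; apply: gns_ext => x; cbn [fst snd Re Im]; rewrite !gnsE; ring.
Qed.

Fact cscaleDl w : {morph cscale^~ w : a b / a + b}.
Proof.
case: w => w1 w2 [a1 a2] [b1 b2].
rewrite -[_ + _ in LHS]/((a1 + b1) +i* (a2 + b2)) /cscale -[RHS]/((_ + _, _ + _) : H).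
by congr pair; apply: gns_ext => x; cbn [fst snd Re Im]; rewrite !gnsE; ring.
Qed.

HB.instance Definition _ :=
  GRing.Zmodule_isLmodule.Build R[i] H cscaleA cscale1 cscaleDr cscaleDl.

Lemma cscaleE a w : a *: w = (Re a *: w.1 - Im a *: w.2, Re a *: w.2 + Im a *: w.1).
Proof. by []. Qed.

Definition cinner w z : R[i] :=
  (ginner w.1 z.1 + ginner w.2 z.2) +i* (ginner w.2 z.1 - ginner w.1 z.2).

Definition csq w : R := ginner w.1 w.1 + ginner w.2 w.2.

Lemma csq_ge0 w : 0 <= csq w.
Proof. by rewrite addr_ge0 ?ginner_ge0. Qed.

Lemma cinner_csq w : cinner w w = (csq w)%:C.
Proof. by rewrite /cinner [ginner w.2 w.1]ginnerC subrr. Qed.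

Definition cnorm w : R[i] := (Num.sqrt (csq w))%:C.

Local Notation ginnerE := (ginnerDl, ginnerDr, ginnerZl, ginnerZr, ginnerNl, ginnerNr).

Fact cnormD w z : cnorm (w + z) <= cnorm w + cnorm z.
Proof.
rewrite -rmorphD lecR /= -(@ler_pXn2r _ 2%N) ?nnegrE ?addr_ge0 ?sqrtr_ge0 //.
rewrite sqrrD !sqr_sqrtr ?csq_ge0 //.
pose s := ginner w.1 z.1 + ginner w.2 z.2.
have sle : s <= Num.sqrt (csq w) * Num.sqrt (csq z).
  rewrite -sqrtrM ?csq_ge0 //; apply: le_trans (ler_norm _) _.
  rewrite -sqrtr_sqr ler_wsqrtr //; apply: discriminant_le0; first exact: csq_ge0.
  move=> t; have := csq_ge0 (w + (t *: z.1, t *: z.2)).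
  rewrite caddE /csq /s; cbn [fst snd].
  rewrite !ginnerE [ginner z.1 _]ginnerC [ginner z.2 w.2]ginnerC.
  by congr (_ <= _); ring.
have -> : csq (w + z) = csq w + 2 * s + csq z.
  rewrite caddE /csq /s; cbn [fst snd].
  by rewrite !ginnerE [ginner z.1 _]ginnerC [ginner z.2 w.2]ginnerC; ring.
by rewrite lerD2r lerD2l mulr_natl lerMn2r.
Qed.

Fact cnormZ a w : cnorm (a *: w) = `|a| * cnorm w.
Proof.
rewrite normc_def -rmorphM /=; congr (_%:C).
rewrite -sqrtrM ?addr_ge0 ?sqr_ge0 //; congr Num.sqrt.
rewrite /csq cscaleE; cbn [fst snd].
by rewrite !ginnerE [ginner w.2 w.1]ginnerC; ring.
Qed.

Fact cnorm_eq0 w : cnorm w = 0 -> w = 0.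
Proof.
move=> /(congr1 (@complex.Re R)) /= /eqP; rewrite sqrtr_eq0 => w0.
have {w0} : csq w == 0 by rewrite eq_le w0 csq_ge0.
rewrite paddr_eq0 ?ginner_ge0 // => /andP[/eqP w1 /eqP w2].
by case: w w1 w2 => w1 w2 /= /ginner_eq0 -> /ginner_eq0 ->.
Qed.

HB.instance Definition _ :=
  Lmodule_isNormed.Build R[i] H cnormD cnormZ cnorm_eq0.

Lemma cnormE w : `|w| = (Num.sqrt (csq w))%:C. Proof. by []. Qed.

Lemma cnorm_le w (e : R) : 0 <= e -> (`|w| <= e%:C) = (csq w <= e ^+ 2).
Proof.
move=> e0; rewrite cnormE lecR -{2}(sqr_sqrtr (csq_ge0 w)).
by rewrite ler_pXn2r // nnegrE ?sqrtr_ge0.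
Qed.

Lemma gt0_complex a : 0 < a -> exists2 e : R, 0 < e & a = e%:C.
Proof.
by case: a => [e i]; rewrite ltcE /= => /andP[/eqP -> e0]; exists e.
Qed.

Lemma csqB w z : csq (w - z) =
  ginner (w.1 - z.1) (w.1 - z.1) + ginner (w.2 - z.2) (w.2 - z.2).
Proof. by []. Qed.

(** Centres of balls of radius 1 / (n + 1) that belong to the filter form a Cauchy sequence; its
    componentwise limit is a limit of the filter. *)
Fact cgns_complete (F : set_system H) : ProperFilter F -> cauchy F -> cvg F.
Proof.
move=> FF /cauchyP Fc.
pose r n : R := n.+1%:R^-1.
have r0 n : 0 < r n by rewrite invr_gt0.
have small (e : R) : 0 < e -> exists N, forall n, (N <= n)%N -> r n <= e.
  move=> e0; have := near_infty_natSinv_lt (PosNum e0) => -[N _ hN].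
  by exists N => n Nn; exact/ltW/hN.
have hx n : exists w, F (ball w ((r n)%:C : R[i])).
  by apply: Fc; rewrite ltcR.
have [x xP] := choice hx.
have xnm n m : csq (x n - x m) <= (r n + r m) ^+ 2.
  have [y [yn ym]] : ball (x n) ((r n)%:C : R[i]) `&` ball (x m) ((r m)%:C : R[i]) !=set0.
    exact: filter_ex (filterI (xP n) (xP m)).
  rewrite -cnorm_le; last by rewrite addr_ge0 // ltW.
  rewrite rmorphD /=.
  rewrite (_ : x n - x m = (x n - y) - (x m - y)); last by rewrite opprB addrA subrK.
  apply: le_trans (ler_normB _ _) _; apply: lerD.
    by move: yn; rewrite -ball_normE => /ltW.
  by move: ym; rewrite -ball_normE => /ltW.
have xc (e : R) : 0 < e -> exists N, forall n m, (N <= n)%N -> (N <= m)%N ->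
    csq (x n - x m) <= e.
  (* For r at most 1 and at most e / 4, (2 r)^2 <= 4 r <= e. *)
  move=> e0; have [|N hN] := small (Num.min 1 (e / 4)).
    by rewrite lt_min ltr01 divr_gt0.
  exists N => n m Nn Nm; apply: le_trans (xnm n m) _.
  have := hN n Nn; have := hN m Nm; rewrite !le_min => /andP[m1 m4] /andP[n1 n4].
  have := r0 n; have := r0 m; nra.
have [z1 hz1] : exists v : W, forall e : R, 0 < e -> exists N, forall n, (N <= n)%N ->
     ginner (v - (x n).1) (v - (x n).1) <= e.
  apply: gns_complete => e e0; have [N hN] := xc e e0; exists N => n m Nn Nm.
  by apply: le_trans (hN n m Nn Nm); rewrite csqB lerDl ginner_ge0.
have [z2 hz2] : exists v : W, forall e : R, 0 < e -> exists N, forall n, (N <= n)%N ->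
     ginner (v - (x n).2) (v - (x n).2) <= e.
  apply: gns_complete => e e0; have [N hN] := xc e e0; exists N => n m Nn Nm.
  by apply: le_trans (hN n m Nn Nm); rewrite csqB lerDr ginner_ge0.
apply/cvg_ex; exists ((z1, z2) : H); apply/fcvg_ballP => _ /gt0_complex[e e0 ->].
have e2 : 0 < e / 2 by rewrite divr_gt0.
have h8 : 0 < (e / 2) ^+ 2 / 2 by rewrite divr_gt0 ?exprn_gt0.
have [N1 hN1] := hz1 _ h8; have [N2 hN2] := hz2 _ h8.
have [N3 hN3] := small (e / 4) (divr_gt0 e0 (ltr0n _ 4)).
pose n := maxn N1 (maxn N2 N3).
have n1 : (N1 <= n)%N by rewrite leq_maxl.
have n2 : (N2 <= n)%N by rewrite /n; lia.
have n3 : (N3 <= n)%N by rewrite /n; lia.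
apply: filterS (xP n) => y; rewrite -!ball_normE /= => yx.
rewrite (_ : (z1, z2) - y = ((z1, z2) - x n) + (x n - y)); last by rewrite addrA subrK.
apply: le_lt_trans (ler_normD _ _) _.
rewrite [e]splitr rmorphD /=; apply: ler_ltD; last first.
  apply: lt_le_trans yx _; rewrite lecR; apply: le_trans (hN3 n n3) _.
  by rewrite ler_pM2l // lef_pV2 ?posrE // ler_nat.
rewrite cnorm_le; last exact: ltW.
rewrite csqB /=.
have := hN1 n n1; have := hN2 n n2; rewrite /=; lra.
Qed.

HB.instance Definition _ := Uniform_isComplete.Build H cgns_complete.

Let cplxB (a b c d : R) : (a +i* b) - (c +i* d) = (a - c) +i* (b - d).
Proof. by []. Qed.

Let cplxM (a b c d : R) : (a +i* b) * (c +i* d) = (a * c - b * d) +i* (a * d + b * c).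
Proof. by []. Qed.

Let cplxJ (a b : R) : Num.conj (a +i* b) = a +i* (- b).
Proof. by []. Qed.

Fact cinner_additivel z : zmod_morphism (cinner^~ z : H -> R[i]).
Proof.
move=> w w'; rewrite /cinner cplxB -[w - w']/((w.1 - w'.1, w.2 - w'.2) : H).
by congr (_ +i* _); cbn [fst snd]; rewrite !ginnerE; ring.
Qed.

Fact cinner_additiver w : zmod_morphism (cinner w : H -> R[i]).
Proof.
move=> z z'; rewrite /cinner cplxB -[z - z']/((z.1 - z'.1, z.2 - z'.2) : H).
by congr (_ +i* _); cbn [fst snd]; rewrite !ginnerE; ring.
Qed.

Fact cinner_scalel z : scalable_for ( *%R : R[i] -> R[i] -> R[i]) (cinner^~ z : H -> R[i]).
Proof.
move=> [a1 a2] w; rewrite /cinner cscaleE cplxM.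
by congr (_ +i* _); cbn [fst snd complex.Re complex.Im]; rewrite !ginnerE; ring.
Qed.

Fact cinner_scaler w :
  scalable_for (Num.conj \; *%R : R[i] -> R[i] -> R[i]) (cinner w : H -> R[i]).
Proof.
move=> [a1 a2] z; rewrite -[RHS]/(Num.conj (a1 +i* a2) * cinner w z).
rewrite /cinner cscaleE cplxJ cplxM.
by congr (_ +i* _); cbn [fst snd complex.Re complex.Im]; rewrite !ginnerE; ring.
Qed.

HB.instance Definition _ := @isBilinear.Build R[i] H H R[i] *%R (Num.conj \; *%R)
  cinner cinner_additivel cinner_additiver cinner_scalel cinner_scaler.

Fact cinner_hermitian (w z : H) :
  cinner w z = (-1) ^+ false * Num.conj (cinner z w).
Proof.
rewrite expr0 mul1r /cinner cplxJ.
rewrite [ginner z.1 w.1]ginnerC [ginner z.2 w.2]ginnerC.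
by rewrite [ginner z.2 w.1]ginnerC [ginner z.1 w.2]ginnerC opprB.
Qed.

HB.instance Definition _ :=
  isHermitianSesquilinear.Build R[i] H false Num.conj cinner cinner_hermitian.

Fact cinner_gt0 (w : H) : w != 0 -> 0 < cinner w w.
Proof.
move=> w0; rewrite cinner_csq ltcR lt0r csq_ge0 andbT.
by apply: contra w0 => /eqP c0; apply/eqP/cnorm_eq0; rewrite /cnorm c0 sqrtr0.
Qed.

HB.instance Definition _ := isDotProduct.Build R[i] H cinner cinner_gt0.

Fact cnorm_inner (w : H) : `|w| ^+ 2 = cinner w w.
Proof. by rewrite cinner_csq cnormE -rmorphXn /= sqr_sqrtr ?csq_ge0. Qed.

Definition gns_hilbert : hilbertType R := @Hilbert R H cinner cnorm_inner.
End ComplexGNS.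

(** * Averages over K and irreducibility *)

Section GNSAverages.
Variables (R : realType) (G : groupType) (f : posdef R G).
Local Notation W := (gns f).
Local Notation ginner := (ginner f).
Local Notation ginnerE := (ginnerDl, ginnerDr, ginnerZl, ginnerZr, ginnerNl, ginnerNr).
Implicit Types (w z : W).

Definition cyclic_vector : W := gelt f (gpoint 1%g).
Local Notation xi := cyclic_vector.

Lemma gns_act1 w : gns_act 1%g w = w.
Proof. by apply: gns_ext => x; rewrite gns_actE invg1 mul1g. Qed.

Lemma gns_actM g h w : gns_act (g * h)%g w = gns_act g (gns_act h w).
Proof. by apply: gns_ext => x; rewrite !gns_actE invMg mulgA. Qed.

Lemma gns_act_elt g c : gns_act g (gelt f c) = gelt f (gact g c).
Proof.
apply: gns_ext => x; rewrite gns_actE -[RHS]ginner_point ginner_elt.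
rewrite -[LHS]ginner_point ginner_elt -(gform_act f g c); congr gform.
by rewrite /gact /gpoint /= mulKVg.
Qed.

Lemma gns_act_cyclic g : gns_act g xi = gelt f (gpoint g).
Proof. by rewrite gns_act_elt /gact /= mulg1. Qed.

Lemma gform_point c g : gform f c (gpoint g) = \sum_(p <- c) p.1 * f (g^-1 * p.2)%g.
Proof. by apply: eq_bigr => p _; rewrite big_seq1 mulr1. Qed.

Lemma ginner_suml I (r : seq I) (F : I -> W) z :
  ginner (\sum_(i <- r) F i) z = \sum_(i <- r) ginner (F i) z.
Proof.
elim: r => [|i r IHr]; last by rewrite !big_cons ginnerDl IHr.
by rewrite !big_nil -(scale0r 0) ginnerZl mul0r.
Qed.

(** With S the sum, 2 n <u l, S> <= n^2 B + <S, S> for every l; summing over l and dividing by n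
    gives the bound. *)
Lemma ginner_sum_le (n : nat) (u : nat -> W) (B : R) :
  (forall l, ginner (u l) (u l) <= B) ->
  ginner (\sum_(l < n) u l) (\sum_(l < n) u l) <= n%:R ^+ 2 * B.
Proof.
move=> uB; set S := \sum_(l < n) u l.
have [n0|n0] := posnP n.
  by rewrite /S n0 big_ord0 -(scale0r 0) ginnerZl mul0r expr0n mul0r.
have nR : 0 < n%:R :> R by rewrite ltr0n.
have h l : 2 * n%:R * ginner (u l) S <= n%:R ^+ 2 * B + ginner S S.
  have := ginner_ge0 (n%:R *: u l - S); rewrite !ginnerE [ginner S _]ginnerC.
  have := ler_wpM2l (sqr_ge0 n%:R) (uB l).
  by rewrite expr2; lra.
have : \sum_(l < n) (2 * n%:R * ginner (u l) S) <= \sum_(l < n) (n%:R ^+ 2 * B + ginner S S).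
  by apply: ler_sum => l _; exact: h.
rewrite -mulr_sumr -ginner_suml -/S sumr_const card_ord -[X in _ <= X]mulr_natl => h1.
by rewrite -(ler_pM2l nR); lra.
Qed.

Variable K : set G.
Hypothesis f1 : f 1%g = 1.
Hypothesis fK : forall g k, K k -> f (g * k)%g = f g.
Hypothesis mixing : forall gs : seq G, exists tau : nat -> G,
  (forall l, K (tau l)) /\
  forall l l' g h, l != l' -> g \in gs -> h \in gs ->
    f ((tau l' * h)^-1 * (tau l * g))%g = f h^-1%g * f g.

Lemma cyclic_invariant k : K k -> gns_act k xi = xi.
Proof.
move=> kK; rewrite gns_act_cyclic; apply: gns_ext => x.
rewrite /= /gvec /gform !big_seq1; congr (_ * _).
by rewrite mulg1 fK.
Qed.

Lemma ginner_cyclic : ginner xi xi = 1.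
Proof. by rewrite ginner_elt /gform !big_seq1 invg1 mulg1 f1 !mulr1. Qed.

Lemma ginner_act_cyclic k w : K k -> ginner (gns_act k w) xi = ginner w xi.
Proof. by move=> kK; rewrite -{1}(cyclic_invariant kK) ginner_act. Qed.

Definition average (tau : nat -> G) n w : W := n%:R^-1 *: \sum_(l < n) gns_act (tau l) w.

Lemma ginner0l z : ginner (0 : W) z = 0.
Proof. by rewrite -(scale0r 0) ginnerZl mul0r. Qed.

Lemma average_le tau n w : ginner (average tau n w) (average tau n w) <= ginner w w.
Proof.
have [->|n0] := posnP n; first by rewrite /average big_ord0 scaler0 ginner0l ginner_ge0.
have nR : 0 < n%:R :> R by rewrite ltr0n.
rewrite !ginnerE mulrA -expr2 exprVn ler_pdivrMl ?exprn_gt0 //.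
by apply: (@ginner_sum_le n (fun l => gns_act (tau l) w)) => l; rewrite ginner_act.
Qed.

Lemma averageB tau n w z : average tau n (w - z) = average tau n w - average tau n z.
Proof.
rewrite /average -scalerBr; congr (_ *: _); rewrite -sumrB; apply: eq_bigr => l _.
exact: gns_ext.
Qed.

(** By mixing, distinct translates of [y] have inner product a^2, so the vectors [r l] are pairwise
    orthogonal, each of squared norm <y, y> - a^2; averaging n of them divides this by n. *)
Lemma average_elt tau n (gs : seq G) c :
  (forall l, K (tau l)) ->
  (forall l l' g h, l != l' -> g \in gs -> h \in gs ->
    f ((tau l' * h)^-1 * (tau l * g))%g = f h^-1%g * f g) ->
  {subset map snd c <= gs} -> (0 < n)%N ->
  ginner (average tau n (gelt f c) - ginner (gelt f c) xi *: xi)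
    (average tau n (gelt f c) - ginner (gelt f c) xi *: xi)
  <= n%:R^-1 * ginner (gelt f c) (gelt f c).
Proof.
move=> tauK tauf cgs n0; set y := gelt f c; set a := ginner y xi.
have nR : 0 < n%:R :> R by rewrite ltr0n.
pose r l := gns_act (tau l) y - a *: xi.
have aE : a = \sum_(p <- c) p.1 * f p.2.
  by rewrite /a ginner_elt gform_point; apply: eq_bigr => p _; rewrite invg1 mul1g.
have xa l : ginner (gns_act (tau l) y) xi = a by rewrite ginner_act_cyclic.
have rr l l' : ginner (r l) (r l') = if l == l' then ginner y y - a ^+ 2 else 0.
  rewrite /r !ginnerE [ginner xi (gns_act _ _)]ginnerC !xa ginner_cyclic.
  case: eqP => [->|/eqP ll']; first by rewrite ginner_act; ring.
  suff -> : ginner (gns_act (tau l) y) (gns_act (tau l') y) = a * a by ring.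
  rewrite !gns_act_elt ginner_elt /gform big_map {1}aE mulr_suml.
  apply: eq_big_seq => p pc /=; rewrite big_map aE mulr_sumr; apply: eq_big_seq => q qc /=.
  have pg : p.2 \in gs by apply: cgs; apply: map_f.
  have qg : q.2 \in gs by apply: cgs; apply: map_f.
  by rewrite tauf // posdefV; ring.
have -> : average tau n y - a *: xi = n%:R^-1 *: \sum_(l < n) r l.
  rewrite /average /r sumrB scalerBr; congr (_ - _).
  rewrite sumr_const card_ord -[X in _ = _ *: X]scaler_nat [RHS]scalerA.
  by rewrite mulVf ?scale1r // gt_eqF.
rewrite !ginnerE ginner_suml mulrA.
rewrite (eq_bigr (fun=> ginner y y - a ^+ 2)); last first.
  move=> l _; rewrite ginnerC ginner_suml (bigD1 l) //= rr eqxx big1 ?addr0 //.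
  by move=> l' ll'; rewrite rr ifN.
rewrite sumr_const card_ord -[X in _ * X]mulr_natl !mulrA mulfVK ?gt_eqF //.
by rewrite ler_pM2l ?invr_gt0 // gerBl sqr_ge0.
Qed.

Lemma gns_density w e : 0 < e -> exists c, ginner (w - gelt f c) (w - gelt f c) <= e.
Proof.
move=> e0; have [N hN] := gns_dense (gns_approx w) e0.
by exists (gseq f w N); exact: hN.
Qed.

(* Weak convergence of the translates to the projection on the invariant line
   becomes strong convergence for their averages, since the translates are
   asymptotically orthogonal modulo that line. *)
Lemma average_cvg w1 w2 (e : R) : 0 < e -> exists tau n,
  [/\ forall l, K (tau l),
   ginner (average tau n w1 - ginner w1 xi *: xi) (average tau n w1 - ginner w1 xi *: xi) <= e &
   ginner (average tau n w2 - ginner w2 xi *: xi) (average tau n w2 - ginner w2 xi *: xi) <= e].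
Proof.
(* Two nested uses of [ginner_le2] on the three terms of [main] give at most 10 e / 12. *)
move=> e0; have e12 : 0 < e / 12 by rewrite divr_gt0.
have [c1 hc1] := gns_density w1 e12; have [c2 hc2] := gns_density w2 e12.
have [tau [tauK tauf]] := mixing (map snd (c1 ++ c2)).
pose B := ginner (gelt f c1) (gelt f c1) + ginner (gelt f c2) (gelt f c2) + 1.
have B0 : 0 < B by rewrite ltr_wpDl // addr_ge0 // ginner_ge0.
have [n n0 hn] : exists2 n, (0 < n)%N & n%:R^-1 * B <= e / 12.
  have := near_infty_natSinv_lt (PosNum (divr_gt0 e12 B0)) => -[N _ /(_ N (leqnn N)) hN].
  exists N.+1 => //; rewrite -ler_pdivlMr //; exact: ltW.
have main w c : {subset map snd c <= map snd (c1 ++ c2)} ->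
  ginner (gelt f c) (gelt f c) <= B -> ginner (w - gelt f c) (w - gelt f c) <= e / 12 ->
  ginner (average tau n w - ginner w xi *: xi) (average tau n w - ginner w xi *: xi) <= e.
  move=> cs cB wc.
  have -> : average tau n w - ginner w xi *: xi =
    average tau n (w - gelt f c) + ((average tau n (gelt f c) - ginner (gelt f c) xi *: xi) +
      (ginner (gelt f c - w) xi *: xi)).
    rewrite averageB ginnerDl ginnerNl scalerBl.
    by apply: gns_ext => x; rewrite !(gns_addE, gns_oppE); ring.
  apply: le_trans (ginner_le2 _ _) _.
  have h1 := average_le tau n (w - gelt f c).
  have h2 := average_elt tauK tauf cs n0.
  have h3 := ginner_le2 (average tau n (gelt f c) - ginner (gelt f c) xi *: xi)
      (ginner (gelt f c - w) xi *: xi).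
  have h4 : ginner (ginner (gelt f c - w) xi *: xi) (ginner (gelt f c - w) xi *: xi)
     <= ginner (w - gelt f c) (w - gelt f c).
    rewrite ginnerZl ginnerZr ginner_cyclic mulr1 -expr2.
    by apply: le_trans (ginner_CS _ _) _; rewrite ginner_cyclic mulr1 ginner_subC.
  have h5 : n%:R^-1 * ginner (gelt f c) (gelt f c) <= e / 12.
    by apply: le_trans hn; rewrite ler_pM2l // invr_gt0 ltr0n.
  have := le_trans h2 h5; lra.
exists tau, n; split => //.
  apply: (main w1 c1) => //; first by move=> x; rewrite map_cat mem_cat => ->.
  by rewrite /B -addrA lerDl addr_ge0 // ginner_ge0.
apply: (main w2 c2) => //; first by move=> x; rewrite map_cat mem_cat => ->; rewrite orbT.
by rewrite /B [_ + ginner (gelt f c2) _]addrC -addrA lerDl addr_ge0 // ginner_ge0.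
Qed.

Local Notation H := (cgns f).

Definition crep_fun (g : G) (w : H) : H := (gns_act g w.1, gns_act g w.2).

Fact crep_linear g : linear (crep_fun g : H -> H).
Proof. by move=> a w z; congr pair; exact: gns_ext. Qed.

HB.instance Definition _ g :=
  GRing.isLinear.Build R[i] H H *:%R (crep_fun g) (crep_linear g).

Definition crep (g : G) : {linear H -> H} := crep_fun g.

Fact crep1 (w : H) : crep 1%g w = w.
Proof. by case: w => w1 w2; rewrite /crep /= /crep_fun !gns_act1. Qed.

Fact crepM g h (w : H) : crep (g * h)%g w = crep g (crep h w).
Proof. by rewrite /crep /= /crep_fun !gns_actM. Qed.

Fact crep_inner g (w z : gns_hilbert f) :
  inner (gns_hilbert f) (crep g w) (crep g z) = inner (gns_hilbert f) w z.
Proof. by rewrite /= /cinner /= !ginner_act. Qed.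

Definition gns_rep : unitary_rep G (gns_hilbert f) :=
  @UnitaryRep R G (gns_hilbert f) crep crep1 crepM crep_inner.

Definition cxi : H := (xi, 0).

Lemma ginner0r w : ginner w (0 : W) = 0.
Proof. by rewrite ginnerC ginner0l. Qed.

Lemma csq_cxi : csq cxi = 1.
Proof. by rewrite /csq ginner_cyclic ginner0l addr0. Qed.

Lemma cxi_neq0 : cxi != 0.
Proof.
apply/eqP => c0; have := csq_cxi; rewrite c0 /csq !ginner0l addr0 => /eqP.
by rewrite eq_sym oner_eq0.
Qed.

Lemma crep_cxi g : crep g cxi = (gelt f (gpoint g), 0).
Proof. by rewrite /crep /= /crep_fun gns_act_cyclic; congr pair; exact: gns_ext. Qed.

Lemma closed_ball_mem (V : set H) (w : H) : closed V ->
  (forall e : R, 0 < e -> exists2 v, V v & csq (w - v) <= e) -> V w.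
Proof.
move=> Vc h; apply: Vc => B /nbhs_ballP[_ /= /gt0_complex[e e0 ->] eB].
have e4 : 0 < (e / 2) ^+ 2 by rewrite exprn_gt0 // divr_gt0.
have [v Vv wv] := h _ e4; exists v; split => //; apply: eB.
rewrite -ball_normE /=; apply: (@le_lt_trans _ _ ((e / 2)%:C)).
  by rewrite cnorm_le // divr_ge0 // ltW.
by rewrite ltcR ltr_pdivrMr // ltr_pMr // ltr1n.
Qed.

Lemma gns_irreducible : irreducible_rep gns_rep.
Proof.
split; first by exists cxi; exact: cxi_neq0.
move=> V Vc Vsub Vinv.
have V0 : V 0 by have := Vsub.1; rewrite inE.
have Vlin a u v : V u -> V v -> V (a *: u + v).
  by move=> Vu Vv; have := Vsub.2 a u v; rewrite !inE; apply.
have VD u v : V u -> V v -> V (u + v) by move=> Vu Vv; rewrite -[u]scale1r; exact: Vlin.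
have VZ a u : V u -> V (a *: u) by move=> Vu; rewrite -[_ *: u]addr0; exact: Vlin.
have [V1|[v Vv v0]] : V = [set 0] \/ exists2 v, V v & v != 0.
  have [h|/forallNP h] := pselect (exists v, V v /\ v != 0).
    by right; have [v [? ?]] := h; exists v.
  left; apply/seteqP; split => [v Vv /=|v /= ->//].
  by apply/eqP; apply: contrapT => /negP v0; exact: (h v).
  by left.
right.
have [g gv] : exists g, v.1 g != 0 \/ v.2 g != 0.
  apply: contrapT => /forallNP h; move/eqP: v0; apply.
  by rewrite [v]surjective_pairing; congr pair; apply: gns_ext => x;
    have /not_orP[/negP/negPn/eqP h1 /negP/negPn/eqP h2] := h x.
pose v' := crep g^-1%g v.
have Vv' : V v' by exact: (Vinv g^-1%g).
pose c : R[i] := v.1 g +i* v.2 g.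
have c0 : c != 0.
  by apply/eqP => -[h1 h2]; case: gv; rewrite ?h1 ?h2 eqxx.
have cE1 : ginner v'.1 xi = v.1 g.
  rewrite -[v'.1]/(gns_act g^-1%g v.1) /cyclic_vector ginner_point gns_actE.
  by rewrite invgK mulg1.
have cE2 : ginner v'.2 xi = v.2 g.
  rewrite -[v'.2]/(gns_act g^-1%g v.2) /cyclic_vector ginner_point gns_actE.
  by rewrite invgK mulg1.
have Vcxi : V (c *: cxi).
  apply: closed_ball_mem => // e e0; have e2 : 0 < e / 2 by rewrite divr_gt0.
  have [tau [n [tauK h1 h2]]] := average_cvg v'.1 v'.2 e2.
  exists ((average tau n v'.1, average tau n v'.2) : H).
    rewrite (_ : (_, _) = (n%:R^-1)%:C *: \sum_(l < n) crep (tau l) v').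
      apply: VZ; elim/big_ind: _ => // l _; exact: (Vinv (tau l)).
    rewrite cscaleE /= !scale0r subr0 addr0 /average; congr pair; congr (_ *: _).
      by elim/big_ind2: _ => // [? ? ? ? -> ->].
    by elim/big_ind2: _ => // [? ? ? ? -> ->].
  have -> : c *: cxi = (ginner v'.1 xi *: xi, ginner v'.2 xi *: xi).
    rewrite cscaleE cE1 cE2 /cxi; cbn [fst snd complex.Re complex.Im c].
    by rewrite !scaler0 subr0 add0r.
  rewrite csqB; cbn [fst snd].
  by rewrite ginner_subC [X in _ + X]ginner_subC; lra.
have Vxi : V cxi by rewrite -[cxi]scale1r -(mulVf c0) -scalerA; exact: VZ.
have Vpoint g' : V ((gelt f (gpoint g'), 0) : H) by rewrite -crep_cxi; exact: (Vinv g').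
have V1 d : V ((gelt f d, 0) : H).
  elim: d => [|[a x] d IHd].
    rewrite (_ : (_, _) = 0) //; congr pair; apply: gns_ext => y.
    by rewrite /= /gvec /gform big_nil.
  rewrite (_ : (_, _) = a%:C *: ((gelt f (gpoint x), 0) : H) + ((gelt f d, 0) : H)).
    by apply: VD => //; exact: VZ.
  rewrite cscaleE caddE -[complex.Re _]/a -[complex.Im _]/(0 : R); cbn [fst snd].
  rewrite !scale0r subr0 !addr0 scaler0 -geltZ -geltD; congr (gelt f _, _).
  by rewrite /gscale /= mulr1.
have V2 d d' : V ((gelt f d, gelt f d') : H).
  rewrite (_ : (_, _) = (0 +i* 1) *: ((gelt f d', 0) : H) + ((gelt f d, 0) : H)).
    by apply: VD => //; exact: VZ.
  rewrite cscaleE caddE -[complex.Re _]/(0 : R) -[complex.Im _]/(1 : R); cbn [fst snd].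
  by rewrite !scale0r !scale1r subr0 !add0r addr0.
apply/seteqP; split => // w _; apply: closed_ball_mem => // e e0.
have e2 : 0 < e / 2 by rewrite divr_gt0.
have [d hd] := gns_density w.1 e2; have [d' hd'] := gns_density w.2 e2.
exists ((gelt f d, gelt f d') : H); first exact: V2.
by rewrite csqB; cbn [fst snd]; lra.
Qed.

Theorem gns_spherical : spherical_function K (fun g => (f g)%:C).
Proof.
exists (gns_hilbert f), gns_rep, cxi; split.
- split; first exact: gns_irreducible.
  exists cxi; first exact: cxi_neq0.
  move=> k kK; rewrite -[LHS]/(crep k cxi) /crep /= /crep_fun cyclic_invariant //.
  by congr pair; exact: gns_ext.
- move=> k kK; rewrite -[LHS]/(crep k cxi) /crep /= /crep_fun cyclic_invariant //.
  by congr pair; exact: gns_ext.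
- by rewrite [LHS]cnormE csq_cxi sqrtr1.
- move=> g; rewrite -[RHS]/(cinner (crep g cxi) cxi) crep_cxi /cinner /cxi.
  cbn [fst snd]; rewrite !ginner0l !ginner0r subrr addr0 ginner_elt /gform !big_seq1.
  by rewrite invg1 mul1g !mul1r.
Qed.
End GNSAverages.

(** * Moments of a Thoma measure *)

Section Moments.
Variables (R : realType) (mu : probability (measurableTypeR R) R).
Hypothesis mu1 : mu `[-1, 1]%classic = 1%E.
Local Notation D := (`[-1, 1]%classic : set R).

Lemma fine_muK (A : set (measurableTypeR R)) : measurable A -> (fine (mu A))%:E = mu A.
Proof. by move=> mA; rewrite fineK // fin_num_measure. Qed.

Lemma integrable_bounded (A : set R) (f : R -> R) (C : R) : measurable A ->
  measurable_fun A f -> (forall t, A t -> `|f t| <= C) -> mu.-integrable A (EFin \o f).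
Proof.
move=> mA mf fC; apply: (@measurable_bounded_integrable _ _ _ mu f A) => //.
  by rewrite (le_lt_trans (probability_le1 mu mA)) ?ltry.
by exists C; split; [exact: num_real|move=> x Cx t At; apply: le_trans (fC t At) (ltW Cx)].
Qed.

Lemma measurable_horner (A : set R) (p : {poly R}) : measurable_fun A (fun t => p.[t]).
Proof.
by apply: measurable_funTS; apply: continuous_measurable_fun => t; exact: continuous_horner.
Qed.

Lemma horner_bound (p : {poly R}) t : D t -> `|p.[t]| <= \sum_(i < size p) `|p`_i|.
Proof.
rewrite /= in_itv /= -ler_norml => t1; rewrite horner_coef.
apply: le_trans (ler_norm_sum _ _ _) _; apply: ler_sum => i _.
by rewrite normrM normrX ler_piMr // exprn_ile1.
Qed.

Lemma integrable_horner (A : set R) (p : {poly R}) : measurable A -> A `<=` D ->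
  mu.-integrable A (EFin \o (fun t => p.[t])).
Proof.
move=> mA AD; apply: (@integrable_bounded A _ (\sum_(i < size p) `|p`_i|)) => //.
  exact: measurable_horner.
by move=> t /AD; exact: horner_bound.
Qed.

Definition moment k : R := \int[mu]_(t in D) (t ^+ (k - 1)).

Lemma moment1 : moment 1 = 1.
Proof.
rewrite /moment subnn (@eq_Rintegral _ _ _ mu D (fun=> 1)) ?Rintegral_cst //.
by rewrite [X in fine X]mu1 mul1r.
Qed.

Lemma moment_horner k : moment k = \int[mu]_(t in D) ('X^(k - 1)).[t].
Proof. by apply: eq_Rintegral => t _; rewrite hornerXn. Qed.

Lemma measurable_seq (s : seq R) : measurable ([set` s] : set (measurableTypeR R)).
Proof.
apply: countable_measurable; first exact: measurable_set1.
exact/finite_set_countable/finite_seq.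
Qed.

Lemma Rintegral_points (p : {poly R}) (s : seq R) : uniq s -> {in s, forall a, D a} ->
  \int[mu]_(t in D) p.[t] =
  \sum_(a <- s) p.[a] * fine (mu [set a]) + \int[mu]_(t in D `\` [set` s]) p.[t].
Proof.
elim: s => [|a s IHs] /=; first by rewrite big_nil add0r set_nil setD0.
move=> /andP[sa us] sD; rewrite IHs //; last by move=> b bs; apply: sD; rewrite inE bs orbT.
suff -> : \int[mu]_(t in D `\` [set` s]) p.[t] = p.[a] * fine (mu [set a]) +
    \int[mu]_(t in D `\` [set` a :: s]) p.[t] by rewrite big_cons addrCA addrA.
have ms (r : seq R) : measurable (D `\` [set` r]).
  by apply: measurableD => //; exact: measurable_seq.
have Da : D a by apply: sD; rewrite mem_head.
have -> : D `\` [set` s] = [set a] `|` (D `\` [set` a :: s]).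
  apply/seteqP; split => [t [Dt ts]|t [->|[Dt ts]]].
  - have [->|ta] := eqVneq t a; [by left|right; split => //=].
    by rewrite inE (negPf ta).
  - by split => //=; apply/negP.
  - by split => //= ts'; apply: ts; rewrite /= inE ts' orbT.
rewrite Rintegral_setU //; last first.
- by apply/disj_setPS => t [/= -> [_]]; rewrite /= inE eqxx.
- apply: integrable_horner; first exact: measurableU.
  by move=> t [->|[]].
- exact: ms.
congr (_ + _); rewrite (@eq_Rintegral _ _ _ mu [set a] (fun=> p.[a])); last first.
  by move=> t; rewrite inE /= => ->.
by rewrite Rintegral_cst.
Qed.

(** The error is an integral off the chosen atoms, where powers of t are at most 1 in absolute
    value; the mass that bounds it is the case k = 1 of the same formula. *)
Lemma moment_points k (s : seq R) : (0 < k)%N -> uniq s -> {in s, forall a, D a} ->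
  `|moment k - \sum_(a <- s) a ^+ (k - 1) * fine (mu [set a])| <=
  1 - \sum_(a <- s) fine (mu [set a]).
Proof.
move=> k0 us sD.
have E j : moment j - \sum_(a <- s) a ^+ (j - 1) * fine (mu [set a]) =
    \int[mu]_(t in D `\` [set` s]) ('X^(j - 1)).[t].
  rewrite moment_horner (Rintegral_points _ us sD).
  under eq_bigr do rewrite hornerXn.
  by rewrite addrAC subrr add0r.
have := E 1%N; rewrite moment1 subnn.
under eq_bigr do rewrite expr0 mul1r.
rewrite E => ->.
have ms : measurable (D `\` [set` s]).
  by apply: measurableD => //; exact: measurable_seq.
have := @le_normr_Rintegral _ _ _ mu _ (fun t => ('X^(k - 1)).[t]) ms.
move=> /(_ (integrable_horner _ ms (@subDsetl _ D _)))/le_trans; apply.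
apply: le_Rintegral => //.
- apply: (@integrable_bounded _ _ 1) => //.
    by apply: measurableT_comp => //; exact: measurable_horner.
  move=> t [/= + _]; rewrite in_itv /= -ler_norml hornerXn normr_id normrX => t1.
  by rewrite exprn_ile1.
- by apply: integrable_horner => // t [].
- move=> t [/= + _]; rewrite in_itv /= -ler_norml !hornerXn normrX expr0 => t1.
  by rewrite exprn_ile1.
Qed.

Lemma fine_mu_points (s : seq R) : uniq s -> {in s, forall a, D a} ->
  fine (mu [set` s]) = \sum_(a <- s) fine (mu [set a]).
Proof.
elim: s => [|a s IHs] /=; first by rewrite set_nil measure0 big_nil.
move=> /andP[sa us] sD; rewrite big_cons -IHs //; last first.
  by move=> b bs; apply: sD; rewrite inE bs orbT.
have -> : [set` a :: s] = [set a] `|` [set` s].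
  apply/seteqP; split => t /=; rewrite inE; first by move=> /orP[/eqP|]; [left|right].
  by move=> [->|->]; rewrite ?eqxx ?orbT.
have ms : measurable ([set` s] : set (measurableTypeR R)) by exact: measurable_seq.
rewrite measureU //; first by rewrite fineD ?fin_num_measure.
by apply/seteqP; split => // t [/= ->]; rewrite /= (negPf sa).
Qed.

Hypothesis mu_atomic : exists2 A : set R, countable A & mu A = 1%E.

(** A countable carrier injects into nat; its points in [-1, 1] with code below n form an increasing
    sequence of finite sets, and the measure is continuous from below. *)
Lemma atoms_approx (e : R) : 0 < e -> exists s : seq R,
  [/\ uniq s, {in s, forall a, D a} & 1 - \sum_(a <- s) fine (mu [set a]) <= e].
Proof.
move=> e0; have [A cA A1] := mu_atomic.
have mA : measurable (A : set (measurableTypeR R)).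
  by apply: countable_measurable => //; exact: measurable_set1.
have [g ginj] : exists g : R -> nat, {in A `&` D &, injective g}.
  by apply/countable_injP; apply: sub_countable cA; apply: subset_card_le => t [].
pose F n := (A `&` D) `&` [set t | (g t < n)%N].
have finF n : finite_set (F n).
  have gF : {in F n &, injective g}.
    move=> t u; rewrite !inE => -[ADt _] [ADu _].
    by apply: ginj; rewrite inE.
  rewrite -(eq_finite_set (inj_card_eq gF)).
  by apply: (@sub_finite_set _ _ `I_n) => // _ [t [_ gt] <-].
have mF n : measurable (F n : set (measurableTypeR R)).
  by apply: countable_measurable; [exact: measurable_set1|exact: finite_set_countable].
have UF : \bigcup_n F n = A `&` D.
  apply/seteqP; split => [t [n _ [//]]|t ADt].
  by exists (g t).+1 => //; split => //=.
have AD1 : mu (A `&` D) = 1%E.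
  have mD : measurable (D : set (measurableTypeR R)) by exact: measurable_itv.
  have h : mu (A `\` D) = 0%E.
    apply/eqP; rewrite -measure_le0 -(subee (x := 1%E)) // -{2}mu1.
    rewrite -(probability_setC mu mD); apply: le_measure; rewrite ?inE //.
    - exact: measurableD.
    - exact: measurableC.
  have := measureDI mu mA mD; rewrite [X in (X + _)%E]h add0e => <-; exact: A1.
have cv : mu \o F @ \oo --> mu (\bigcup_n F n).
  apply: nondecreasing_cvg_mu => //; first by rewrite UF; exact: measurableI.
  move=> n m nm; apply/subsetPset => t [ADt /= gn]; split => //=.
  exact: leq_trans nm.
have cv1 : mu \o F @ \oo --> 1%:E by move: cv; rewrite UF [X in _ --> X -> _]AD1.
have /cvgrPdist_le/(_ _ e0)[n _ hn] : fine \o (mu \o F) @ \oo --> (1 : R).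
  exact: fine_cvg cv1.
exists (fset_set (F n)); have FE : [set` fset_set (F n)] = F n by rewrite fset_setK.
split; first exact: fset_uniq.
  by move=> a; rewrite in_fset_set // inE => -[[]].
rewrite -fine_mu_points ?fset_uniq //; last first.
  by move=> a; rewrite in_fset_set // inE => -[[]].
by apply: le_trans (ler_norm _) _; rewrite FE; exact: (hn n (leqnn n)).
Qed.

Lemma colour_sum_cat (r s : seq R) k :
  colour_sum (r ++ s) k = colour_sum r k + colour_sum s k.
Proof. exact: big_cat. Qed.

Lemma colour_sum_nseq n (x : R) k :
  colour_sum (nseq n x) k = n%:R * (if x < 0 then - 2 * x ^+ k else x ^+ k).
Proof. by rewrite /colour_sum big_nseq iter_addr_0 mulr_natl. Qed.

(** The mass accounted for by one list entry, that is its contribution to [colour_sum] at k = 1. *)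
Definition atom_size (x : R) := if x < 0 then - 2 * x else x.

Hypothesis mu_even : forall x : R, D x -> x != 0 ->
  exists n : nat, fine (mu [set x]) = n%:R * atom_size x.

(** The leftover mass g is split into J equal colours of size g / J. At k = 1 the total is then
    exactly 1; for k >= 2 these colours contribute J (g / J)^k, at most 1 / J. *)
Lemma colours_approx (e : R) : 0 < e -> exists xs : seq R, (0 < size xs)%N /\
  forall k, (0 < k)%N -> `|colour_sum xs k - moment k| <= e.
Proof.
move=> e0; have e2 : 0 < e / 2 by rewrite divr_gt0.
have [s [us sD hs]] := atoms_approx e2.
have [J J0 hJ] : exists2 J, (0 < J)%N & J%:R^-1 <= e / 2.
  have := near_infty_natSinv_lt (PosNum e2) => -[N _ /(_ N (leqnn N)) hN].
  by exists N.+1 => //; exact: ltW.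
have JR : 0 < J%:R :> R by rewrite ltr0n.
have [cnt cntP] : exists cnt : R -> nat, forall x : R, D x -> x != 0 ->
    fine (mu [set x]) = (cnt x)%:R * atom_size x.
  have h x : exists n : nat, D x -> x != 0 -> fine (mu [set x]) = n%:R * atom_size x.
    have [[Dx x0]|h] := pselect (D x /\ x != 0).
      by have [n ->] := mu_even Dx x0; exists n.
    by exists 0%N => Dx x0; exfalso; apply: h.
  by have [cnt h'] := choice h; exists cnt.
(* Colours of size 0 carry no mass, so an atom at 0 joins the leftover mass g. *)
pose s' := [seq a <- s | a != 0].
have us' : uniq s' by rewrite filter_uniq.
have s'D : {in s', forall a, D a} by move=> a; rewrite mem_filter => /andP[_ /sD].
pose g := 1 - \sum_(a <- s') fine (mu [set a]).
have g0 : 0 <= g.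
  rewrite /g -fine_mu_points // subr_ge0 -lee_fin fine_muK; last exact: measurable_seq.
  by apply: probability_le1; exact: measurable_seq.
have g1 : g <= 1.
  by rewrite /g gerBl sumr_ge0 // => a _; rewrite fine_ge0.
pose xs := flatten [seq nseq (cnt a) a | a <- s'] ++ nseq J (g / J%:R).
have xsE k : (0 < k)%N -> colour_sum xs k =
    \sum_(a <- s') a ^+ (k - 1) * fine (mu [set a]) + J%:R * (g / J%:R) ^+ k.
  move=> k0; rewrite colour_sum_cat colour_sum_nseq ifF; last first.
    by apply/negbTE; rewrite -leNgt divr_ge0 // ltW.
  congr (_ + _); rewrite /colour_sum big_flatten big_map; apply: eq_big_seq => a.
  rewrite mem_filter => /andP[a0 /sD Da].
  have := colour_sum_nseq (cnt a) a k; rewrite /colour_sum => ->.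
  rewrite (cntP a Da a0) mulrCA /atom_size; congr (_ * _).
  have -> : a ^+ k = a ^+ (k - 1) * a by rewrite -exprSr subn1 prednK.
  by case: ifP => _ //; ring.
exists xs; split.
  by rewrite size_cat size_nseq (leq_trans J0) ?leq_addl.
move=> k k0; rewrite xsE //.
have [->|k1] := eqVneq k 1%N.
  rewrite moment1 subnn expr1 mulrCA divff ?gt_eqF // mulr1.
  under eq_bigr do rewrite expr0 mul1r.
  by rewrite /g [X in `|X - _|]addrC subrK subrr normr0 ltW.
(* For k >= 2 an atom at 0 does not contribute, so the sum may run over all of [s]. *)
have -> : \sum_(a <- s') a ^+ (k - 1) * fine (mu [set a]) =
    \sum_(a <- s) a ^+ (k - 1) * fine (mu [set a]).
  rewrite /s' big_filter [RHS](bigID (fun a => a != 0)) /= [X in _ = _ + X]big1 ?addr0 //.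
  move=> a /negPn/eqP ->; rewrite expr0n.
  have /negPf -> : (k - 1 != 0)%N by rewrite subn_eq0 -ltnNge ltn_neqAle eq_sym k1.
  by rewrite mul0r.
rewrite addrAC; apply: le_trans (ler_normD _ _) _; rewrite [e in _ <= e]splitr; apply: lerD.
  by rewrite distrC; apply: le_trans (moment_points k0 us sD) hs.
rewrite ger0_norm; last by rewrite mulr_ge0 ?exprn_ge0 ?divr_ge0 // ltW.
have gJ : g / J%:R <= 1 by rewrite ler_pdivrMr // mul1r (le_trans g1) // ler1n.
have gJ0 : 0 <= g / J%:R by rewrite divr_ge0 // ltW.
apply: le_trans hJ; apply: (@le_trans _ _ (J%:R * (g / J%:R) ^+ 2)).
  by rewrite ler_pM2l // ler_wiXn2l // ltn_neqAle eq_sym k1.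
have -> : J%:R * (g / J%:R) ^+ 2 = g ^+ 2 * J%:R^-1 by field; rewrite gt_eqF.
by rewrite ler_piMl ?invr_ge0 ?(ltW JR) // exprn_ile1.
Qed.

Lemma colours_cvg : exists xs : nat -> seq R, (forall j, (0 < size (xs j))%N) /\
  forall k, (0 < k)%N -> (colour_sum (xs j) k) @[j --> \oo] --> moment k.
Proof.
have h (j : nat) : exists xs : seq R, (0 < size xs)%N /\
    forall k, (0 < k)%N -> `|colour_sum xs k - moment k| <= j.+1%:R^-1.
  by apply: colours_approx; rewrite invr_gt0.
have [xs xsP] := choice h; exists xs; split => [j|k k0]; first exact: (xsP j).1.
apply/cvgrPdist_le => e e0.
have := near_infty_natSinv_lt (PosNum e0); apply: filterS => j /= /ltW hj.
by rewrite distrC; apply: le_trans ((xsP j).2 k k0) hj.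
Qed.

Theorem even_spherical : spherical_function KE (fun g : GE => (thoma_extension mu g)%:C).
Proof.
have [xs [xs0 xsc]] := colours_cvg.
pose f := PosDef (extensionV moment1 xs0 xsc) (extension_psd moment1 xs0 xsc).
(* The set in the definition of [thoma_extension] contains [f], and by uniqueness nothing else. *)
have -> : thoma_extension mu = f :> (GE -> R).
  rewrite /thoma_extension; case: xgetP => [h _ [hK hS]|/(_ f)].
    exact: (extension_unique moment1 xs0 xsc hK hS).
  case; split; first exact: (extension_biinvariant moment1 xs0 xsc).
  by move=> s sS; exact: (extension_pos moment1 xs0 xsc sS).
have f1 : f 1%g = 1.
  rewrite /= (extension_pos moment1 xs0 xsc) //.
  rewrite /cycle_product fsbig1 // => C [z /= ]; by case.
apply: gns_spherical => //.
- by move=> g k kK; rewrite -[in LHS](mul1g g); exact: (extension_biinvariant moment1 xs0 xsc g KE1 kK).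
- exact: (extension_mixing moment1 xs0 xsc).
Qed.
End Moments.

(** * Tilted moments and positivity *)

Section LimitSum.
Variables (R : realType) (N : nat) (rho : R).
Local Notation X := ('I_N * bool)%type.
Variables (m : nat -> nat -> R) (F : nat -> {perm X} -> R).
Hypothesis FE : forall j k1 s k2, k1 \in hyper 'I_N -> k2 \in hyper 'I_N ->
  F j (k1 * pos s * k2)%g = \prod_(C in porbits s) m j #|C|.
Hypothesis m_cvg : forall r, (0 < r)%N -> m j r @[j --> \oo] --> rho ^+ r.-1.
Hypothesis F_ge0 : forall j, 0 <= \sum_g F j g.

Lemma decompose (g : {perm X}) : exists k1 s k2,
  [/\ k1 \in hyper 'I_N, k2 \in hyper 'I_N & g = (k1 * pos s * k2)%g].
Proof.
have gT : perm_on (signed [set: 'I_N]%SET) g by apply/fintype.subsetP => x; rewrite !inE.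
have [k1 [s [k2 [[k1K _] _ [k2K _] ->]]]] := hyper_pos_hyper gT.
by exists k1, s, k2.
Qed.

Lemma prod_rho (s : {perm 'I_N}) :
  \prod_(C in porbits s) rho ^+ #|C|.-1 = rho ^+ (#|'I_N| - #|porbits s|).
Proof.
rewrite prodrXr; congr (_ ^+ _).
have -> : #|'I_N| = (\sum_(C in porbits s) #|C|.-1 + #|porbits s|)%N.
  rewrite -sum1_card -big_split /= -sum1_card (partition_big (porbit s) (mem (porbits s))) /=; last first.
    by move=> i _; rewrite imset_f.
  apply: eq_bigr => C Cs; rewrite (eq_bigl (mem C)); last first.
    by move=> i; rewrite /= mem_porbits.
  rewrite sum1_card addn1 prednK //.
  by case/imsetP: Cs => x _ ->; rewrite lt0n card_porbit_neq0.
by rewrite addnK.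
Qed.

Lemma F_cvg k1 s k2 : k1 \in hyper 'I_N -> k2 \in hyper 'I_N ->
  F j (k1 * pos s * k2)%g @[j --> \oo] --> rho ^+ (#|'I_N| - #|porbits s|).
Proof.
move=> k1K k2K; rewrite -prod_rho; under eq_fun do rewrite FE //.
apply: cvg_big => [|C /imsetP[x _ ->]]; first exact: mul_continuous.
by apply: m_cvg; rewrite lt0n card_porbit_neq0.
Qed.

Let Flim g : R := lim (F j g @[j --> \oo]).

Let Flim_cvg g : F j g @[j --> \oo] --> Flim g.
Proof.
have [k1 [s [k2 [k1K k2K ->]]]] := decompose g.
by apply/cvg_ex; eexists; exact: F_cvg.
Qed.

Let FlimE k1 s k2 : k1 \in hyper 'I_N -> k2 \in hyper 'I_N ->
  Flim (k1 * pos s * k2)%g = rho ^+ (#|'I_N| - #|porbits s|).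
Proof. by move=> k1K k2K; apply: cvg_lim => //; exact: F_cvg. Qed.

(** Whatever the moments at stage [j], the limit function is biinvariant with a pure power of [rho]
    on [pos s], so its sum is known in closed form; the nonnegativity of the sums survives the
    limit. *)
Theorem limit_prod_ge0 : 0 <= \prod_(n < N) ((n.+1).*2%:R * (1 + n.*2%:R * rho)).
Proof.
have FK k1 g k2 : k1 \in hyper 'I_N -> k2 \in hyper 'I_N -> Flim (k1 * g * k2)%g = Flim g.
  move=> k1K k2K; have [l1 [s [l2 [l1K l2K ->]]]] := decompose g.
  have -> : (k1 * (l1 * pos s * l2) * k2 = (k1 * l1) * pos s * (l2 * k2))%g by rewrite !mulgA.
  by rewrite !FlimE ?groupM.
have Fpos s : Flim (pos s) = rho ^+ (#|'I_N| - #|porbits s|).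
  by rewrite -[pos s]mul1g -[(1 * _)%g]mulg1 FlimE ?group1.
have := sum_hyper_biinvariant FK Fpos [set: 'I_N]%SET.
rewrite cardsT card_ord => <-.
rewrite (eq_bigl xpredT); last by move=> g; apply/fintype.subsetP => x; rewrite !inE.
have h : \sum_g F j g @[j --> \oo] --> \sum_g Flim g.
  by apply: cvg_big => [|g _]; [exact: add_continuous|exact: Flim_cvg].
rewrite -(cvg_lim _ h) //; apply: limr_ge; first by apply/cvg_ex; eexists; exact: h.
by apply: nearW => j; exact: F_ge0.
Qed.
End LimitSum.

(** * Vectors dressed by operators with fresh indices *)

Section RepeatedInner.
Variables (R : realType) (H : hilbertType R).
Local Notation "'[ u , v ]" := (inner H u v).

(** The squared norm of the sum of the L vectors is at most L C + L (L - 1) B, which for B < 0 is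
    negative as soon as L exceeds C / (- B) + 1. *)
Lemma repeated_inner_ge0 (B C : R) :
  (forall L, exists w : 'I_L -> H,
     (forall l l', l != l' -> '[w l, w l'] = B%:C) /\
     (forall l, '[w l, w l] <= C%:C)) -> 0 <= B.
Proof.
move=> hw; rewrite leNgt; apply/negP => B0.
have key (L : nat) : 0 <= L%:R * C + L%:R * (L%:R - 1) * B.
  have [w [wB wC]] := hw L.
  have : 0 <= '[\sum_(l < L) w l, \sum_(l < L) w l].
    by rewrite -inner_norm exprn_ge0.
  have row (l : 'I_L) : '[w l, \sum_(l' < L) w l'] <= (C + (L%:R - 1) * B)%:C.
    rewrite raddf_sum (bigD1 l) //= rmorphD /= lerD //.
    rewrite (eq_bigr (fun=> B%:C)) => [|l' l'l]; last by rewrite wB // eq_sym.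
    have L1 : L.-1%:R = L%:R - 1 :> R.
      by rewrite -subn1 natrB // (leq_ltn_trans _ (ltn_ord l)).
    by rewrite sumr_const cardC1 card_ord -L1 rmorphM rmorph_nat mulr_natl.
  rewrite linear_sumlz => h0; have := le_trans h0 (ler_sum _ (fun l _ => row l)).
  by rewrite sumr_const card_ord -rmorphMn lecR -[X in _ <= X]mulr_natl mulrDr mulrA.
have [L L1 hL] : exists2 L : nat, (0 < L)%N & C / (- B) + 1 < L%:R.
  exists (Num.truncn (C / (- B) + 1)).+1 => //; exact: truncnS_gt.
have := key L; rewrite leNgt => /negP; apply.
have L0 : 0 < L%:R :> R by rewrite ltr0n.
rewrite -mulrA -mulrDr pmulr_rlt0 //.
have : C / (- B) < L%:R - 1 by rewrite ltrBrDr.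
rewrite ltr_pdivrMr ?oppr_gt0 // mulrN => h.
by rewrite -ltrBrDr sub0r.
Qed.
End RepeatedInner.

Section UnitaryInner.
Variables (R : realType) (G : groupType) (H : hilbertType R) (pi : unitary_rep G H).
Local Notation "'[ u , v ]" := (inner H u v).

Lemma inner_scalel (a : R) u v : '[a%:C *: u, v] = a%:C * '[u, v].
Proof. by rewrite linearZl_LR. Qed.

Lemma inner_scaler (a : R) u v : '[u, a%:C *: v] = a%:C * '[u, v].
Proof. by rewrite linearZr_LR /= -[Num.conj _]/(conjc _) conjc_real. Qed.

Lemma inner_repV g u v : '[pi g u, v] = '[u, pi g^-1%g v].
Proof. by rewrite -(rep_inner pi g u) -repM mulgV rep1. Qed.

Lemma norm_rep g v : `|pi g v| = `|v|.
Proof. by apply/eqP; rewrite -(eqrXn2 (n := 2)) // !inner_norm rep_inner. Qed.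
End UnitaryInner.

Section SlotOperators.
Variables (R : realType) (H : hilbertType R) (pi : unitary_rep GE H) (M : nat).
Local Notation "'[ u , v ]" := (inner H u v).
Local Notation slot := (slot R 'I_M).
Implicit Types (q : slot) (L : seq slot) (u v : H).

Definition slot_act v q := 
  q.2.1%:C *: v + q.2.2%:C *: pi (emb (tperm (q.1.2, true) q.1.1)) v.

Definition slots_act L v := foldl slot_act v L.

(** The coefficients are real and a transposition is its own inverse. *)
Lemma slot_act_adjoint q u v : '[slot_act u q, v] = '[u, slot_act v q].
Proof.
rewrite /slot_act linearDl linearDr /= !inner_scalel !inner_scaler inner_repV.
by rewrite -embV tpermV.
Qed.

Lemma slots_act_adjoint L u v : '[slots_act L u, v] = '[u, slots_act (rev L) v].
Proof.
rewrite /slots_act; elim: L u v => //= q L IHL u v.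
by rewrite IHL rev_cons foldl_rcons slot_act_adjoint.
Qed.

Lemma slot_actD q a b u v : slot_act (a%:C *: u + b%:C *: v) q =
  a%:C *: slot_act u q + b%:C *: slot_act v q.
Proof.
rewrite /slot_act (linearD (pi _)) !(linearZZ (pi _)) /= !scalerDr !scalerA.
by rewrite !(mulrC a%:C) !(mulrC b%:C) addrACA.
Qed.

Lemma slots_actD L a b u v : slots_act L (a%:C *: u + b%:C *: v) =
  a%:C *: slots_act L u + b%:C *: slots_act L v.
Proof.
by rewrite /slots_act; elim: L u v => //= q L IHL u v; rewrite slot_actD IHL.
Qed.

Definition slot_move (h : {perm 'I_M * bool}) q : slot := ((h^-1%g q.1.1, q.1.2), q.2).

(** As [h] fixes the fresh index, passing it through a transposition moves only the other endpoint;
    it moves it by the inverse of [h] because products act from left to right. *)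
Lemma rep_slots_act (h : {perm _}) L v :
  (forall q, q \in L -> h (q.1.2, true) = (q.1.2, true)) ->
  pi (emb h) (slots_act L v) = slots_act (map (slot_move h) L) (pi (emb h) v).
Proof.
rewrite /slots_act; elim: L v => //= q L IHL v hL.
rewrite IHL => [|q' q'L]; last by apply: hL; rewrite inE q'L orbT.
congr foldl; rewrite /slot_act (linearD (pi _)) !(linearZZ (pi _)) /= -!repM -!embM; congr (_ + _ *: pi (emb _) _).
by rewrite mul_tperm -{1}(hL q (mem_head _ _)) permK.
Qed.

Lemma slots_act_value (xi : H) (f : {perm 'I_M * bool} -> R) L g :
  (forall g, '[pi (emb g) xi, xi] = (f g)%:C) ->
  '[slots_act L (pi (emb g) xi), xi] = (slots_value f L g)%:C.
Proof.
move=> fE; elim: L g => [|[[y m] [a b]] L IHL] g; first exact: fE.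
rewrite -[slots_act _ _]/(slots_act L (slot_act _ _)) /slot_act /= -repM -embM slots_actD linearDl /= !inner_scalel !IHL.
by rewrite rmorphD !rmorphM.
Qed.

Lemma slots_act_norm L v :
  `|slots_act L v| <= (\prod_(q <- L) (`|q.2.1| + `|q.2.2|))%:C * `|v|.
Proof.
rewrite /slots_act; elim: L v => [|q L IHL] v; first by rewrite big_nil mul1r.
rewrite big_cons /= (le_trans (IHL _)) // mulrC rmorphM -mulrA mulrCA mulrC.
rewrite ler_wpM2l //.
  by rewrite lecR; apply: prodr_ge0 => q' _; rewrite addr_ge0.
apply: le_trans (ler_normD _ _) _; rewrite !normrZ norm_rep -mulrDl ler_wpM2r //.
by rewrite rmorphD lerD // !normc_def /= expr0n addr0 sqrtr_sqr.
Qed.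
End SlotOperators.

Section DressedSlots.
Variables (R : realType) (N L : nat) (cs : seq (R * R)).

Definition linear_factor (c : R * R) : {poly R} := c.1%:P + c.2 *: 'X.

Definition factors_prod : {poly R} := \prod_(c <- cs) linear_factor c.

Definition fresh_card := #|{: 'I_L * 'I_N * 'I_(size cs)}|.
Local Notation K := fresh_card.
Local Notation M := (N + K)%N.
Local Notation p := factors_prod.

(** Only positive points are dressed, once for each linear factor; the fresh index depends on the
    copy [l], so that different copies share none. *)
Definition dressing_slot (l : 'I_L) (x : 'I_N * 'I_(size cs)) : slot R 'I_M :=
  (((lshift K x.1, true), rshift N (enum_rank (l, x.1, x.2))), nth (0, 0) cs x.2).

Definition dressing (l : 'I_L) : seq (slot R 'I_M) :=
  map (dressing_slot l) (enum {: 'I_N * 'I_(size cs)}).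

Lemma prod_dressing (Q : pred ('I_M * bool)) l :
  \prod_(q <- dressing l | Q q.1.1) linear_factor q.2 =
  p ^+ (\sum_(i < N | Q (lshift K i, true)) 1).
Proof.
rewrite big_map big_enum_cond -prodrXr /factors_prod.
under [RHS]eq_bigr => i _ do rewrite expr1 (big_nth (0, 0)) big_mkord.
by rewrite pair_big_dep; apply: eq_bigl => x; rewrite andbT.
Qed.

Section Weights.
Variables (k1 k2 : {perm 'I_M * bool}) (s : {perm 'I_M}).
Hypothesis k1K : k1 \in hyper 'I_M.
Hypothesis k2K : k2 \in hyper 'I_M.
Hypothesis k1fix : forall m b, k1 (rshift N m, b) = (rshift N m, b).
Hypothesis k2fix : forall m b, k2 (rshift N m, b) = (rshift N m, b).
Hypothesis sfix : forall m, s (rshift N m) = rshift N m.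
Local Notation h := (k1 * pos s * k2)%g.

Definition base_card (C : {set 'I_M}) := \sum_(i < N | lshift K i \in C) 1%N.

(** The map on indices induced by [k] is injective, hence bijective, and fixes the fresh ones;
    subtracting these from the count over all indices leaves the base indices. *)
Lemma base_card_hyper (k : {perm 'I_M * bool}) (C : {set 'I_M}) : k \in hyper 'I_M ->
  (forall m b, k (rshift N m, b) = (rshift N m, b)) ->
  (\sum_(i < N | (k (lshift K i, true)).1 \in C) 1 = base_card C)%N.
Proof.
move=> /hyperP kK kfix; pose c i := (k (i, true)).1.
have c_inj : injective c.
  move=> i j; rewrite /c => cij.
  have [kij|kij] := eqVneq (k (i, true)).2 (k (j, true)).2.
    by have /perm_inj[] : k (i, true) = k (j, true) by apply/eqP; rewrite /eq_op /= cij kij !eqxx.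
  have : k (i, true) = opp (k (j, true)).
    rewrite /opp -cij; case: (k (i, true)) kij => a b /=.
    by case: b; case: (k (j, true)).2.
  by rewrite -kK => /perm_inj.
have E : (\sum_(i : 'I_M | c i \in C) 1 = \sum_(i : 'I_M | i \in C) 1)%N.
  by rewrite [RHS](reindex_inj c_inj).
move: E; rewrite !big_split_ord /= => E; apply/eqP; rewrite -(eqn_add2r (\sum_(i < K | rshift N i \in C) 1)).
rewrite -E; apply/eqP; congr addn; apply: eq_bigl => i.
by rewrite /c kfix.
Qed.

Lemma prod_fibres (g : 'I_N -> 'I_M) (C : {set 'I_M}) :
  \prod_(j in C) p ^+ (\sum_(i < N | g i == j) 1) = p ^+ (\sum_(i < N | g i \in C) 1).
Proof.
rewrite prodrXr; congr (_ ^+ _); rewrite [RHS](partition_big g (mem C)) //=.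
apply: eq_bigr => j jC; apply: eq_bigl => i.
by case: eqP => [->|]; rewrite ?jC ?andbF.
Qed.

(** Each of the two vectors gives one factor p per base index of the orbit. The slots of the second
    are seen through [k1], those of the first through the inverse of [k2], up to a step of [s] that
    stays in its orbit. *)
Lemma prod_weights l l' (C : {set 'I_M}) : C \in porbits s ->
  \prod_(j in C) slots_weight k1 (map (slot_move h) (dressing l) ++ rev (dressing l')) j =
  'X^#|C| * p ^+ (base_card C).*2.
Proof.
move=> Cs; rewrite /slots_weight big_split /= prodr_const; congr (_ * _).
rewrite (eq_bigr (fun j =>
    p ^+ (\sum_(i < N | (k1 (h^-1%g (lshift K i, true))).1 == j) 1) *
    p ^+ (\sum_(i < N | (k1 (lshift K i, true)).1 == j) 1))); last first.
  move=> j _; rewrite big_cat big_map (perm_big _ (permEl (perm_rev _))) /=.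
  rewrite (prod_dressing (fun x => (k1 (h^-1%g x)).1 == j)).
  by rewrite (prod_dressing (fun x => (k1 x).1 == j)).
rewrite big_split /= !prod_fibres -addnn exprD; congr (_ ^+ _ * _ ^+ _); last exact: base_card_hyper.
rewrite -(@base_card_hyper (k2^-1)%g) ?groupV //; last first.
  by move=> m b; rewrite -{1}(k2fix m b) permK.
apply: eq_bigl => i; rewrite !invMg !permM permKV -posV.
case: (k2^-1%g _) => j []; rewrite ?posF //= posT /=.
by rewrite -!(mem_porbits _ Cs) -(porbit_perm s 1 (s^-1%g j)) expg1 permKV.
Qed.

Variable e : {poly R} -> R.
Hypothesis eX : e 'X = 1.
Local Notation Z := (e ('X * p ^+ 2)).
Hypothesis Z0 : Z != 0.

(** For [e q] the integral of q(t) / t, these are the moments of the image under t -> t p(t)^2 / Z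
    of the probability p^2 mu / Z. *)
Definition tilted_moment r := e ('X^r * p ^+ r.*2) / Z ^+ r.

Lemma tilted_moment1 : tilted_moment 1 = 1.
Proof. by rewrite /tilted_moment expr1 expr1 divff. Qed.

(** A fresh index is an orbit by itself and contributes [e 'X], that is 1; an orbit of r base
    indices contributes Z^r times its tilted moment, and these powers of Z multiply to Z^N. *)
Lemma orbit_prod_weights l l' :
  orbit_prod e (slots_weight k1 (map (slot_move h) (dressing l) ++ rev (dressing l'))) s =
  Z ^+ N * \prod_(C in porbits s) tilted_moment #|C|.
Proof.
have -> : Z ^+ N = \prod_(C in porbits s) Z ^+ base_card C.
  rewrite prodrXr; congr (_ ^+ _); rewrite -[LHS]card_ord -sum1_card.
  rewrite (partition_big (fun i => porbit s (lshift K i)) (mem (porbits s))) /=; last first.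
    by move=> i _; rewrite imset_f.
  by apply: eq_bigr => C Cs; apply: eq_bigl => i; rewrite (mem_porbits _ Cs).
rewrite -big_split; apply: eq_bigr => C Cs /=; rewrite prod_weights //.
have [[m mC]|Cbase] := pselect (exists m, rshift N m \in C).
  have CE : C = [set rshift N m]%SET by rewrite -(porbit_fix (sfix m)); apply/esym/eqP; rewrite mem_porbits.
  have -> : base_card C = 0%N.
    by rewrite /base_card big_pred0 // => i; rewrite CE inE eq_lrshift.
  by rewrite CE cards1 tilted_moment1 expr1 !mulr1.
have -> : base_card C = #|C|.
  rewrite /base_card -[RHS]sum1_card big_split_ord /= [X in _ = (_ + X)%N]big_pred0 ?addn0 // => m.
  by apply/negP => mC; case: Cbase; exists m.
by rewrite /tilted_moment [RHS]mulrC divfK // expf_neq0.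
Qed.
End Weights.
End DressedSlots.

Section Positivity.
Variables (R : realType) (H : hilbertType R) (pi : unitary_rep GE H) (xi : H).
Variables (phi : GE -> R) (mom : nat -> R) (e : {poly R} -> R).
Local Notation "'[ u , v ]" := (inner H u v).
Hypothesis xiK : invariant_vector pi KE xi.
Hypothesis xi1 : `|xi| = 1.
Hypothesis phiE : forall g, '[pi g xi, xi] = (phi g)%:C.
Hypothesis phiS : forall s, Sinfty s -> phi s = cycle_product mom s.
Hypothesis momE : forall r, (0 < r)%N -> mom r = e 'X^r.
Hypothesis eL : forall a p q, e (a *: p + q) = a * e p + e q.
Hypothesis eX : e 'X = 1.

Lemma KE_inv k : KE k -> KE k^-1%g.
Proof.
move=> kK z; apply: (@can_inj _ _ k (k^-1)%g).
  by move=> x; rewrite -[LHS]/((k^-1 * k)%g x) mulVg.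
have kV x : k ((k^-1)%g x) = x by rewrite -[LHS]/((k * k^-1)%g x) mulgV.
by rewrite kK !kV.
Qed.

Lemma phi_hyper k1 g k2 : KE k1 -> KE k2 -> phi (k1 * g * k2)%g = phi g.
Proof.
move=> k1K k2K; apply: complexI; rewrite -!phiE !repM (xiK k2K) inner_repV.
by rewrite (xiK (KE_inv k1K)).
Qed.

Lemma phi_emb M k1 (s : {perm 'I_M}) k2 : k1 \in hyper 'I_M -> k2 \in hyper 'I_M ->
  phi (emb (k1 * pos s * k2)%g) = orbit_prod e (fun=> 'X) s.
Proof.
move=> k1K k2K; rewrite !embM phi_hyper; [|exact/emb_KE|exact/emb_KE].
rewrite phiS ?cycle_product_emb ?momE ?expr1 //; last exact: emb_pos.
apply: eq_bigr => C /imsetP[x _ ->]; rewrite prodr_const momE //.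
by rewrite lt0n card_porbit_neq0.
Qed.

Lemma emb_fix N K (g : {perm 'I_N * bool}) (h : {perm 'I_(N + K) * bool}) m b :
  emb h = emb g -> h (rshift N m, b) = (rshift N m, b).
Proof.
move=> hg; suff E : h^-1%g (rshift N m, b) = (rshift N m, b) by rewrite -{1}E permKV.
apply: enc_inj; rewrite -embE hg (@bounded_emb N g) // /enc.
by case: b => /=; rewrite ?absz_nat ltnS leq_addr.
Qed.

Variables (N : nat) (cs : seq (R * R)).
Local Notation p := (factors_prod cs).
Local Notation Z := (e ('X * p ^+ 2)).
Hypothesis Z0 : 0 < Z.

Definition dressed L (l : 'I_L) : H := slots_act pi (dressing N cs l) xi.

Lemma dressed_fresh L (l l' : 'I_L) (k : {perm _}) : l != l' ->
  let S := map (slot_move k) (dressing N cs l) ++ rev (dressing N cs l') in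
  uniq [seq q.1.2 | q <- S] /\ forall m, m \in [seq q.1.2 | q <- S] -> exists m', m = rshift N m'.
Proof.
move=> ll' /=.
have E (j : 'I_L) : [seq q.1.2 | q <- dressing N cs j] =
    [seq rshift N (enum_rank (j, x.1, x.2)) | x : 'I_N * 'I_(size cs)].
  by rewrite /dressing -map_comp.
rewrite map_cat map_rev -map_comp (_ : map _ (dressing N cs l) = [seq q.1.2 | q <- dressing N cs l]) //.
rewrite !E; split; last first.
  by move=> m; rewrite mem_cat mem_rev => /orP[] /mapP[x _ ->]; eexists.
have U (j : 'I_L) :
    uniq [seq rshift N (enum_rank (j, x.1, x.2)) | x : 'I_N * 'I_(size cs)].
  rewrite map_inj_uniq ?enum_uniq //.
  by move=> [i c] [i' c'] /rshift_inj/enum_rank_inj[-> ->].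
rewrite cat_uniq rev_uniq !U andbT /=.
apply/hasPn => m; rewrite mem_rev => /mapP[x _ ->]; apply/negP => /mapP[y _].
by move/rshift_inj/enum_rank_inj => [/esym l'l]; rewrite l'l eqxx in ll'.
Qed.

(** Taking adjoints moves the slots of the second vector behind those of the first, transported by
    the group element. Since [l != l'], the two families of fresh indices are disjoint, and
    [slots_valueE] applies to the concatenated list. *)
Lemma inner_dressed L (l l' : 'I_L) k1 s k2 : l != l' ->
  k1 \in hyper 'I_N -> k2 \in hyper 'I_N ->
  '[pi (emb (k1 * pos s * k2)%g) (dressed l), dressed l'] =
  (Z ^+ N * \prod_(C in porbits s) tilted_moment cs e #|C|)%:C.
Proof.
move=> ll' k1K k2K; set M := (N + fresh_card N L cs)%N.
have NM : (N <= M)%N by exact: leq_addr.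
have [K1 K1E] := emb_onto (bounded_byW NM (bounded_emb k1)).
have [K2 K2E] := emb_onto (bounded_byW NM (bounded_emb k2)).
have [S SE] := emb_onto_pos (bounded_byW NM (bounded_emb (pos s))) (@emb_pos _ s).
have K1K : K1 \in hyper 'I_M by apply/emb_KE; rewrite -K1E; apply/emb_KE.
have K2K : K2 \in hyper 'I_M by apply/emb_KE; rewrite -K2E; apply/emb_KE.
have Sfix m : S (rshift N m) = rshift N m.
  by have := emb_fix m true (esym SE); rewrite posT => -[->].
have K1fix m b := emb_fix m b (esym K1E); have K2fix m b := emb_fix m b (esym K2E).
have Zn0 : Z != 0 by rewrite gt_eqF.
have tm1 := tilted_moment1 Zn0.
have <- : orbit_prod e (slots_weight K1 (map (slot_move (K1 * pos S * K2)%g) (dressing N cs l)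
    ++ rev (dressing N cs l'))) S = Z ^+ N * \prod_(C in porbits s) tilted_moment cs e #|C|.
  rewrite (orbit_prod_weights K1K K2K) //.
  by rewrite -(cycle_product_emb S tm1) -SE cycle_product_emb.
have [fu fr] := dressed_fresh (K1 * pos S * K2)%g ll'.
have hfix m b : (K1 * pos S * K2)%g (rshift N m, b) = (rshift N m, b).
  by rewrite !permM K1fix; case: b; rewrite ?posT ?posF ?Sfix K2fix.
rewrite -(@slots_valueE _ _ e eL eX (phi \o @emb M) _ _ K1 S K2) //; first last.
- move=> m /fr[m' ->]; split => // q.
  rewrite mem_cat mem_rev => /orP[] /mapP[x].
    move=> /mapP[y _ ->] -> /=; apply/eqP.
    case E : ((K1 * pos S * K2)^-1%g _) => [j c] /= jm.
    have := congr1 (K1 * pos S * K2)%g E; rewrite permKV jm hfix => /(congr1 fst)/eqP /=.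
    by rewrite eq_lrshift.
  by move=> _ -> /=; rewrite eq_lrshift.
- by move=> *; rewrite /= phi_emb.
rewrite -(slots_act_value (pi := pi) (xi := xi)); last by move=> g; rewrite phiE.
rewrite /slots_act foldl_cat -/(slots_act _ _ _) -/(slots_act _ _ _) slots_act_adjoint revK.
rewrite -rep_slots_act; last first.
  by move=> q /mapP[x _ ->]; exact: hfix.
by rewrite !embM K1E K2E SE.
Qed.

Let bound : R := \prod_(x : 'I_N * 'I_(size cs))
  (`|(nth (0, 0) cs x.2).1| + `|(nth (0, 0) cs x.2).2|).

Lemma dressed_norm L (l : 'I_L) : `|dressed l| <= bound%:C.
Proof.
apply: le_trans (slots_act_norm _ _ _) _.
by rewrite xi1 mulr1 /bound big_map big_enum.
Qed.

(** Summing the translates of each dressed vector over the whole finite group G gives vectors whose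
    pairwise inner products all equal |G| Z^N times the sum of [F], with a norm bound that does not
    depend on the number of copies. *)
Theorem tilted_positive : exists F : {perm 'I_N * bool} -> R,
  (forall k1 s k2, k1 \in hyper 'I_N -> k2 \in hyper 'I_N ->
     F (k1 * pos s * k2)%g = \prod_(C in porbits s) tilted_moment cs e #|C|) /\
  0 <= \sum_g F g.
Proof.
have ZN : 0 < Z ^+ N by rewrite exprn_gt0.
(* Two copies suffice to define [F], because the coefficient depends neither on the number of copies
   nor on the pair chosen. *)
pose F (g : {perm 'I_N * bool}) := complex.Re '[pi (emb g) (dressed (@ord0 1)), dressed (@ord_max 1)] / Z ^+ N.
have FE k1 s k2 : k1 \in hyper 'I_N -> k2 \in hyper 'I_N ->
    F (k1 * pos s * k2)%g = \prod_(C in porbits s) tilted_moment cs e #|C|.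
  by move=> k1K k2K; rewrite /F inner_dressed //= mulrC mulKf // gt_eqF.
have FL L (l l' : 'I_L) g : l != l' ->
    '[pi (emb g) (dressed l), dressed l'] = (Z ^+ N * F g)%:C.
  have [k1 [s [k2 [k1K k2K ->]]]] := decompose g.
  by move=> ll'; rewrite inner_dressed // FE.
exists F; split => //.
pose G : R := #|{perm 'I_N * bool}|%:R.
have G0 : 0 < G by rewrite ltr0n; apply/card_gt0P; exists 1%g.
suff : 0 <= G * (Z ^+ N * \sum_g F g) by rewrite !pmulr_rge0.
apply: (@repeated_inner_ge0 _ H _ ((G * bound) ^+ 2)) => L.
exists (fun l => \sum_(g : {perm 'I_N * bool}) pi (emb g) (dressed l)); split => [l l' ll'|l].
  have E (g h : {perm 'I_N * bool}) :
      '[pi (emb g) (dressed l), pi (emb h) (dressed l')] = (Z ^+ N * F (h^-1 * g)%g)%:C.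
    by rewrite -(FL L l l') // embM repM embV [RHS]inner_repV invgK.
  rewrite linear_sumlz (eq_bigr (fun g => \sum_h (Z ^+ N * F (h^-1 * g)%g)%:C)) => [|g _].
    rewrite exchange_big /= (eq_bigr (fun=> (Z ^+ N * \sum_g F g)%:C)) => [|h _].
      by rewrite sumr_const -rmorphMn /G mulr_natl.
    rewrite mulr_sumr rmorph_sum (reindex_inj (mulgI h)); apply: eq_bigr => g _.
    by rewrite mulKg.
  by rewrite raddf_sum; apply: eq_bigr => h _; exact: E.
rewrite -inner_norm rmorphXn /= lerXn2r ?nnegrE //.
  by rewrite ler0c mulr_ge0 ?(ltW G0) // prodr_ge0 // => x _; rewrite addr_ge0.
apply: le_trans (ler_norm_sum _ _ _) _.
have -> : (G * bound)%:C = \sum_(g : {perm 'I_N * bool}) bound%:C.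
  by rewrite sumr_const -rmorphMn /G mulr_natl.
by apply: ler_sum => g _; rewrite norm_rep dressed_norm.
Qed.
End Positivity.

(** * Concentration at an atom *)

Section Peaks.
Variables (R : realType) (mu : probability (measurableTypeR R) R).
Hypothesis mu1 : mu `[-1, 1]%classic = 1%E.
Local Notation D := (`[-1, 1]%classic : set R).

(** The integral of q(t) / t, the constant coefficient of q being discarded: X^r stands for a cycle
    of length r, whose moment has exponent r - 1. *)
Definition shifted_integral (q : {poly R}) : R := \int[mu]_(t in D) (drop_poly 1 q).[t].

Lemma shifted_integral_linear a p q :
  shifted_integral (a *: p + q) = a * shifted_integral p + shifted_integral q.
Proof.
rewrite /shifted_integral -RintegralZl //; last exact: integrable_horner.
rewrite -RintegralD //; last exact: integrable_horner.
  by apply: eq_Rintegral => t _; rewrite drop_polyD drop_polyZ hornerD hornerZ.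
rewrite (_ : _ \o _ = EFin \o (fun t => (a *: drop_poly 1 p).[t])); last first.
  by apply/funext => t /=; rewrite hornerZ.
exact: integrable_horner.
Qed.

Lemma shifted_integralX r (q : {poly R}) :
  shifted_integral ('X^(r.+1) * q) = \int[mu]_(t in D) ('X^r * q).[t].
Proof.
apply: eq_Rintegral => t _.
by rewrite exprSr -mulrA mulrCA mulrC -['X]expr1 drop_polyMXn_id mulrC.
Qed.

Lemma moment_shifted r : (0 < r)%N -> moment mu r = shifted_integral 'X^r.
Proof.
case: r => // r _; rewrite -['X^_]mulr1 shifted_integralX mulr1.
by apply: eq_Rintegral => t _; rewrite hornerXn subn1.
Qed.

Variable x : R.
Hypothesis Dx : D x.
Let w : R := fine (mu [set x]).

(** The factors are 1 - (t - x) / 2 and 1 + (t - x) / 2, whose product is [peak]. On [-1, 1] one has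
    |t - x| <= 2, which is why the difference is halved. *)
Definition peak_factors j : seq (R * R) :=
  nseq j (1 + x / 2, - 2^-1) ++ nseq j (1 - x / 2, 2^-1).

Definition peak (t : R) := 1 - ((t - x) / 2) ^+ 2.

Lemma horner_peak j t : (factors_prod (peak_factors j)).[t] = peak t ^+ j.
Proof.
rewrite /factors_prod big_cat /= !big_nseq !iter_mulr_1 hornerM !horner_exp -exprMn.
by congr (_ ^+ _); rewrite /linear_factor !hornerE /peak /=; field.
Qed.

Lemma peak_x : peak x = 1.
Proof. by rewrite /peak subrr mul0r expr0n subr0. Qed.

Lemma peak_bound t : D t -> 0 <= peak t <= 1 /\ (t != x -> peak t < 1).
Proof.
move: Dx; rewrite /= !in_itv /= => /andP[x1 x2] /andP[t1 t2]; rewrite /peak.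
split; first by rewrite subr_ge0 gerBl sqr_ge0 andbT; nra.
move=> tx; rewrite gtrBl lt0r sqr_ge0 andbT sqrf_eq0 mulf_eq0 subr_eq0 (negPf tx) /=.
by rewrite invr_eq0 pnatr_eq0.
Qed.

(** The atom contributes exactly the limit for every [j], as the peak has height 1; the remaining
    integral tends to 0 by dominated convergence, with dominating function 1. *)
Lemma peak_cvg r : (0 < r)%N ->
  shifted_integral ('X^r * factors_prod (peak_factors j) ^+ r.*2) @[j --> \oo] -->
  x ^+ r.-1 * w.
Proof.
case: r => // r _ /=.
pose q j : {poly R} := 'X^r * factors_prod (peak_factors j) ^+ (r.+1).*2.
have qE j t : (q j).[t] = t ^+ r * (peak t ^+ (r.+1).*2) ^+ j.
  by rewrite /q hornerM hornerXn horner_exp horner_peak -!exprM mulnC.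
have E j : shifted_integral ('X^(r.+1) * factors_prod (peak_factors j) ^+ (r.+1).*2) =
    x ^+ r * w + \int[mu]_(t in D `\` [set` [:: x]]) (q j).[t].
  rewrite shifted_integralX (@Rintegral_points _ _ (q j) [:: x]) //; last first.
    by move=> a; rewrite inE => /eqP ->.
  by rewrite big_seq1 qE peak_x !expr1n mulr1.
under eq_fun do rewrite E.
suff I0 : \int[mu]_(t in D `\` [set` [:: x]]) (q j).[t] @[j --> \oo] --> 0.
  by have := cvgD (cvg_cst (x ^+ r * w)) I0; rewrite addr0; apply.
set A := D `\` _; have mA : measurable A by apply: measurableD => //; exact: measurable_seq.
have bound j t : A t -> `|(q j).[t]| <= 1.
  move=> [Dt _]; have [/andP[p0 p1] _] := peak_bound Dt.
  rewrite qE normrM mulr_ile1 // normrX ?exprn_ile1 //.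
    by move: Dt; rewrite /= in_itv /= -ler_norml.
  by rewrite ger0_norm ?exprn_ge0 // exprn_ile1.
have h : (\int[mu]_(t in A) ((q j).[t])%:E)%E @[j --> \oo] --> 0%:E.
  rewrite (_ : 0%:E = \int[mu]_(t in A) (cst 0%:E t))%E; last by rewrite integral0.
  have [] // := @dominated_convergence _ _ _ mu A mA (fun j t => ((q j).[t])%:E)
    (cst 0%:E) (cst 1%:E) _ _ _ _ _.
  - by move=> j; apply/measurable_EFinP; exact: measurable_horner.
  - apply: aeW => t [Dt /= tx]; apply: cvg_EFin; first exact: nearW.
    have [/andP[p0 p1] p2] := peak_bound Dt.
    rewrite [X in X @ _](_ : _ = geometric (t ^+ r) (peak t ^+ r.+1.*2)).
      apply: cvg_geometric; rewrite ger0_norm ?exprn_ge0 // exprn_ilt1 // p2 //.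
      by apply: contra_notN tx => /eqP->; rewrite inE.
    by apply/funext => j; rewrite /= qE.
  - by apply: (@integrable_bounded R mu A (cst 1) 1) => // t _; rewrite normr1.
  - by apply: aeW => t j At; rewrite lee_fin bound.
exact: fine_cvg h.
Qed.

Hypothesis w0 : 0 < w.

Lemma peak_mass_gt0 j : 0 < shifted_integral ('X * factors_prod (peak_factors j) ^+ 2).
Proof.
rewrite -['X]/('X^(0.+1)) shifted_integralX mul1r.
rewrite (@Rintegral_points _ _ _ [:: x]) //; last by move=> a; rewrite inE => /eqP ->.
rewrite big_seq1 horner_exp horner_peak peak_x !expr1n mul1r ltr_wpDr // Rintegral_ge0 //.
by move=> t _; rewrite horner_exp sqr_ge0.
Qed.

Lemma tilted_moment_cvg r : (0 < r)%N ->
  tilted_moment (peak_factors j) shifted_integral r @[j --> \oo] --> (x / w) ^+ r.-1.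
Proof.
move=> r0; have -> : (x / w) ^+ r.-1 = (x ^+ r.-1 * w) / (x ^+ 0 * w) ^+ r.
  case: r r0 => // r _ /=; rewrite expr_div_n expr0 mul1r exprS; field.
  by rewrite expf_neq0 gt_eqF.
apply: cvgM; first exact: peak_cvg.
apply: cvgV; first by rewrite expf_neq0 // expr0 mul1r gt_eqF.
apply: (@cvg_comp _ _ _ _ (fun z : R => z ^+ r)); first exact: (@peak_cvg 1).
exact: exprn_continuous.
Qed.

Lemma spherical_prod_ge0 N : spherical_function KE (fun g : GE => (thoma_extension mu g)%:C) ->
  0 <= \prod_(n < N) ((n.+1).*2%:R * (1 + n.*2%:R * (x / w))).
Proof.
move=> [H [pi [xi [_ xiK xi1 phiE]]]].
have phiS s : Sinfty s -> thoma_extension mu s = cycle_product (moment mu) s.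
  (* The default value 0 of [thoma_extension] is excluded, since a spherical function is 1 at the
     identity. *)
  move=> sS; move: phiE; rewrite /thoma_extension; case: xgetP => [h _ [_ hS] _|_ /(_ 1%g)].
    exact: hS.
  rewrite rep1 -inner_norm xi1 expr1n => /eqP.
  by rewrite eq_sym oner_eq0.
have eX : shifted_integral 'X = 1 by rewrite -['X]/('X^1) -moment_shifted // moment1.
have P j := tilted_positive xiK xi1 (fun g => esym (phiE g)) phiS moment_shifted
  shifted_integral_linear eX N (peak_mass_gt0 j).
have [F FP] := choice P.
apply: (@limit_prod_ge0 R N (x / w) (fun j => tilted_moment (peak_factors j) shifted_integral) F).
- by move=> j; exact: (FP j).1.
- exact: tilted_moment_cvg.
- by move=> j; exact: (FP j).2.
Qed.
End Peaks.

(** When w / |x| = 2 q + 1, the second factor at n is (2 q + 1 - 2 n) / (2 q + 1): positive up to n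
    = q and negative at n = q + 1, the last index here. For an even ratio some factor vanishes
    before any becomes negative. *)
Lemma odd_prod_lt0 (R : realFieldType) q :
  \prod_(n < q.+2) ((n.+1).*2%:R * (1 + n.*2%:R * (- (q.*2.+1)%:R^-1))) < 0 :> R.
Proof.
have E n : 1 + n.*2%:R * (- (q.*2.+1)%:R^-1) = ((q.*2.+1)%:R - n.*2%:R) / (q.*2.+1)%:R :> R.
  by rewrite mulrBl divff ?pnatr_eq0 // mulrN.
rewrite big_ord_recr /= pmulr_rlt0; last first.
  apply: prodr_gt0 => -[n /= nq] _; rewrite E mulr_gt0 ?ltr0n //.
  by rewrite divr_gt0 ?ltr0n // subr_gt0 ltr_nat; lia.
rewrite pmulr_rlt0 ?ltr0n // E pmulr_llt0 ?invr_gt0 ?ltr0n // subr_lt0 ltr_nat; lia.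
Qed.

Theorem theorem4 (R : realType) (mu : probability (measurableTypeR R) R)
    (hmu : thoma_measure mu) :
  spherical_function KE (fun g : GE => (thoma_extension mu g)%:C) <->
  (forall x : R, -1 <= x < 0 ->
     exists n : nat, fine (mu [set x]) / `|x| = (2 * n)%:R).
Proof.
have [mu1 mu_atomic mu_thoma] := hmu; split => [sph x /andP[x1 x0]|even].
  have Dx : (`[-1, 1]%classic : set R) x by rewrite /= in_itv /= x1 ltW // (lt_trans x0).
  have [v vE] : exists n : nat, fine (mu [set x]) / `|x| = n%:R.
    by apply: mu_thoma; rewrite ?lt_eqF // x1 ltW // (lt_trans x0).
  have [/eqP w0|w0] := boolP (fine (mu [set x]) == 0).
    by exists 0%N; rewrite w0 mul0r muln0.
  have {}w0 : 0 < fine (mu [set x]) by rewrite lt0r w0 fine_ge0.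
  exists v./2; rewrite vE mul2n -[in LHS](odd_double_half v).
  case: (boolP (odd v)) => [vodd|]; last by rewrite add0n.
  have := spherical_prod_ge0 mu1 Dx w0 (v./2).+2 sph.
  have -> : x / fine (mu [set x]) = - (v./2.*2.+1)%:R^-1.
    have <- : v = v./2.*2.+1 by rewrite -{1}(odd_double_half v) vodd.
    by rewrite -vE ltr0_norm // invf_div mulNr opprK.
  by rewrite leNgt odd_prod_lt0.
apply: even_spherical => // x Dx x0; rewrite /atom_size.
have x11 : -1 <= x <= 1 by move: Dx; rewrite /= in_itv.
have [xn|xp] := ltP x 0.
  have [|n nE] := even x; first by rewrite xn andbT; case/andP: x11.
  exists n; have : fine (mu [set x]) = (2 * n)%:R * `|x| by rewrite -nE divfK ?normr_eq0.
  by rewrite ltr0_norm // natrM => ->; ring.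
have [n nE] := mu_thoma x x11 x0; exists n.
by rewrite -nE ger0_norm // divfK.
Qed.
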